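(* Let $G$ be a Lie group and let $H=H(g,\xi,\mu,\nu)$ be a smooth function on the trivialized cotangent bundle $T^*TG\simeq (G\circledS\mathfrak g)\circledS(\mathfrak g^*\times\mathfrak g^* )$, with symplectic form $\Omega_{T^*TG}$. Then the components of the Hamiltonian vector field $X_H$ defined by $i_{X_H}\Omega_{T^*TG}=-dH$, i.e. the trivialized Hamilton's equations on $(T^*TG,\Omega_{T^*TG})$, are $$\frac{dg}{dt}=T_eR_g\frac{\delta H}{\delta\mu},\qquad \frac{d\xi}{dt}=\frac{\delta H}{\delta\nu}-\mathrm{ad}_\xi\frac{\delta H}{\delta\mu},$$ $$\frac{d\mu}{dt}=-T_e^*R_g\frac{\delta H}{\delta g}-\mathrm{ad}^*_\xi\frac{\delta H}{\delta\xi}+\mathrm{ad}^*_{\frac{\delta H}{\delta\mu}}\mu+\mathrm{ad}^*_{\frac{\delta H}{\delta\nu}}\nu,\qquad \frac{d\nu}{dt}=-\frac{\delta H}{\delta\xi}+\mathrm{ad}^*_{\frac{\delta H}{\delta\mu}}\nu .$$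
   Context: $G$ is a (finite-dimensional) Lie group with identity $e$, $\mathfrak g=T_eG$, dual $\mathfrak g^*$, pairing $\langle\cdot,\cdot\rangle$. $R_g$ is right multiplication, $T_e^*R_g:T_g^*G\to\mathfrak g^*$ is the dual of $T_eR_g$. $\mathrm{Ad}_g=T_e(h\mapsto ghg^{-1})$, $\mathrm{ad}_\xi\eta=[\xi,\eta]=\frac{d}{dt}|_{t=0}\mathrm{Ad}_{\exp t\xi}\eta$, $\langle \mathrm{Ad}_g^*\mu,\xi\rangle=\langle\mu,\mathrm{Ad}_{g^{-1}}\xi\rangle$, and $\mathrm{ad}_\xi^*\mu=\frac{d}{dt}|_{t=0}\mathrm{Ad}^*_{\exp t\xi}\mu$, i.e. $\langle\mathrm{ad}^*_\xi\mu,\eta\rangle=-\langle\mu,[\xi,\eta]\rangle$. $TG$ is identified with $G\circledS\mathfrak g$ by $V_g\mapsto(g,T_gR_{g^{-1}}V_g)$; its group law is $(g,\xi)(h,\eta)=(gh,\xi+\mathrm{Ad}_g\eta)$. $T^*TG=T^*(G\circledS\mathfrak g)$ is identified with $G\times\mathfrak g\times\mathfrak g^*\times\mathfrak g^*$ by right trivialization: a covector $(\alpha_g,\alpha_\xi)\in T^*_gG\times\mathfrak g^*$ at $(g,\xi)$ is sent to $(g,\xi,\mu,\nu)=(g,\xi,\,T_e^*R_g\alpha_g+\mathrm{ad}_\xi^*\alpha_\xi,\,\alpha_\xi)$. $\Omega_{T^*TG}$ is the canonical symplectic form $d\theta$ ($\theta$ the Liouville one-form, ''$p\,dq$'') transported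 by this map. $\frac{\delta H}{\delta g}\in T_g^*G$, $\frac{\delta H}{\delta\xi}\in\mathfrak g^*$, $\frac{\delta H}{\delta\mu},\frac{\delta H}{\delta\nu}\in\mathfrak g$ are the partial derivatives of $H$. *)

(* Defs.v *)
From HB Require Import structures.
From mathcomp Require Import all_boot all_order all_algebra.
From mathcomp Require Import all_classical all_reals all_analysis.

Set Implicit Arguments.
Unset Strict Implicit.
Unset Printing Implicit Defensive.

Import Order.TTheory GRing.Theory Num.Theory.
Import numFieldNormedType.Exports.

Local Open Scope classical_set_scope.
Local Open Scope ring_scope.

(* For U open in a finite-dimensional E: differentiability of all directional
   derivatives up to order k - 1, and continuity up to order k. *)
Fixpoint Ck_on (R : realType) (E F : normedModType R) (k : nat)
    (U : set E) (f : E -> F) : Prop :=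
  match k with
  | 0%N => forall x, U x -> {for x, continuous f}
  | k'.+1 => (forall x, U x -> differentiable f x) /\
             (forall v, Ck_on k' U (fun x => 'd f x v))
  end.

Definition smooth_on (R : realType) (E F : normedModType R)
    (U : set E) (f : E -> F) : Prop := forall k, Ck_on k U f.

(* The dual of 'rV_k is again represented by 'rV_k, in dual coordinates. *)
Definition pairing (R : realType) (k : nat) (a v : 'rV[R]_k) : R :=
  \sum_(i < k) a 0 i * v 0 i.

(* For l linear, the unique a such that <a, v> = l v for all v. *)
Definition dual_vec (R : realType) (k : nat) (l : 'rV[R]_k -> R) : 'rV[R]_k :=
  \row_(i < k) l (delta_mx 0 i).

(* Charts are indexed by the points of M: chart p is a chart around p, with
   domain dom p and inverse chart_inv p.  Every atlas provides such a family
   (choose a chart around each point), defining the same smooth structure.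
   The topology of M is the one induced by the charts; it is not required to
   be second countable, nor Hausdorff (which is automatic for a Lie group).
   The tangent space T_p M is 'rV_k, a tangent vector being represented by its
   coordinates in the chart indexed by p; T_p^* M is 'rV_k, in the dual
   coordinates. *)
Record atlas (R : realType) (M : Type) (k : nat) := Atlas {
  dom : M -> set M;
  chart : M -> M -> 'rV[R]_k;
  chart_inv : M -> 'rV[R]_k -> M }.

Definition is_manifold (R : realType) (M : Type) (k : nat)
    (A : atlas R M k) : Prop :=
  [/\ forall p, dom A p p,
      forall p q, dom A p q -> chart_inv A p (chart A p q) = q,
      forall p q, open (chart A p @` (dom A p `&` dom A q)) &
      forall p q, smooth_on (chart A p @` (dom A p `&` dom A q))
                            (chart A q \o chart_inv A p)].

Definition local_rep (R : realType) (M N : Type) (k l : nat)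
    (A : atlas R M k) (B : atlas R N l) (f : M -> N) (p : M) :
    'rV[R]_k -> 'rV[R]_l :=
  chart B (f p) \o f \o chart_inv A p.

Definition smooth_map (R : realType) (M N : Type) (k l : nat)
    (A : atlas R M k) (B : atlas R N l) (f : M -> N) : Prop :=
  forall p, exists W : set 'rV[R]_k,
    [/\ open W, W (chart A p p), W `<=` chart A p @` dom A p,
        forall x, W x -> dom B (f p) (f (chart_inv A p x)) &
        smooth_on W (local_rep A B f p)].

Definition tangent_map (R : realType) (M N : Type) (k l : nat)
    (A : atlas R M k) (B : atlas R N l) (f : M -> N) (p : M)
    (v : 'rV[R]_k) : 'rV[R]_l :=
  'd (local_rep A B f p) (chart A p p) v.

Definition smooth_fun (R : realType) (M : Type) (k : nat)
    (A : atlas R M k) (h : M -> R) : Prop :=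
  forall p, smooth_on (chart A p @` dom A p) (h \o chart_inv A p).

Definition differential (R : realType) (M : Type) (k : nat)
    (A : atlas R M k) (h : M -> R) (p : M) (v : 'rV[R]_k) : R :=
  'd (h \o chart_inv A p) (chart A p p) v.

(* The curve c is differentiable at t, with velocity v in T_(c t) M. *)
Definition has_velocity (R : realType) (M : Type) (k : nat)
    (A : atlas R M k) (c : R -> M) (t : R) (v : 'rV[R]_k) : Prop :=
  (\forall s \near t, dom A (c t) (c s)) /\
  is_derive t 1 (chart A (c t) \o c) v.

Definition vector_atlas (R : realType) (k : nat) : atlas R 'rV[R]_k k :=
  Atlas (fun=> setT) (fun=> id) (fun=> id).

Definition prod_atlas (R : realType) (M N : Type) (k l : nat)
    (A : atlas R M k) (B : atlas R N l) : atlas R (M * N) (k + l) :=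
  Atlas (fun p => dom A p.1 `*` dom B p.2)
        (fun p q => row_mx (chart A p.1 q.1) (chart B p.2 q.2))
        (fun p z => (chart_inv A p.1 (lsubmx z), chart_inv B p.2 (rsubmx z))).

(* The pullback of the one-form th by the parametrization (chart p)^-1. *)
Definition form_rep (R : realType) (M : Type) (k : nat) (A : atlas R M k)
    (th : M -> 'rV[R]_k -> R) (p : M) (y w : 'rV[R]_k) : R :=
  let q := chart_inv A p y in th q ('d (chart A q \o chart_inv A p) y w).

(* d th (V, W) = V (th W) - W (th V) for V, W constant in the chart at p. *)
Definition ext_deriv (R : realType) (M : Type) (k : nat) (A : atlas R M k)
    (th : M -> 'rV[R]_k -> R) (p : M) (V W : 'rV[R]_k) : R :=
  'd (fun y => form_rep A th p y W) (chart A p p) V -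
  'd (fun y => form_rep A th p y V) (chart A p p) W.

Definition pullback2 (R : realType) (M N : Type) (k l : nat)
    (A : atlas R M k) (B : atlas R N l) (f : M -> N)
    (om : N -> 'rV[R]_l -> 'rV[R]_l -> R) (p : M) (V W : 'rV[R]_k) : R :=
  om (f p) (tangent_map A B f p V) (tangent_map A B f p W).

(* T^*M is M * 'rV_k as a set.  Its chart at (p, _) is the usual one,
   (q, b) |-> (y, b o T_y (chart p)^-1) with y = chart p q. *)
Definition cotangent_atlas (R : realType) (M : Type) (k : nat)
    (A : atlas R M k) : atlas R (M * 'rV[R]_k) (k + k) :=
  Atlas (fun p => [set q | dom A p.1 q.1])
        (fun p q => let y := chart A p.1 q.1 in
           row_mx y (dual_vec (fun w =>
             pairing q.2 ('d (chart A q.1 \o chart_inv A p.1) y w))))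
        (fun p z => let q := chart_inv A p.1 (lsubmx z) in
           (q, dual_vec (fun v => pairing (rsubmx z)
             ('d (chart A p.1 \o chart_inv A q) (chart A q q) v)))).

Definition liouville (R : realType) (M : Type) (k : nat) (A : atlas R M k)
    (b : M * 'rV[R]_k) (V : 'rV[R]_(k + k)) : R :=
  pairing b.2 (tangent_map (cotangent_atlas A) A fst b V).

Definition canonical_form (R : realType) (M : Type) (k : nat)
    (A : atlas R M k) :
    M * 'rV[R]_k -> 'rV[R]_(k + k) -> 'rV[R]_(k + k) -> R :=
  ext_deriv (cotangent_atlas A) (liouville A).

Definition is_lie_group (R : realType) (n : nat) (G : groupType)
    (A : atlas R G n) : Prop :=
  [/\ is_manifold A,
      smooth_map (prod_atlas A A) A (fun p => (p.1 * p.2)%g) &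
      smooth_map A A (fun g => g^-1%g)].

(* T_e R_g : T_e G -> T_g G. *)
Definition TR (R : realType) (n : nat) (G : groupType) (A : atlas R G n)
    (g : G) (xi : 'rV[R]_n) : 'rV[R]_n :=
  tangent_map A A (fun h => (h * g)%g) 1%g xi.

(* T_e^* R_g : T_g^* G -> g^*. *)
Definition TRstar (R : realType) (n : nat) (G : groupType) (A : atlas R G n)
    (g : G) (a : 'rV[R]_n) : 'rV[R]_n :=
  dual_vec (fun xi => pairing a (TR A g xi)).

Definition Ad (R : realType) (n : nat) (G : groupType) (A : atlas R G n)
    (g : G) (xi : 'rV[R]_n) : 'rV[R]_n :=
  tangent_map A A (fun h => (g * h * g^-1)%g) 1%g xi.

Definition Adstar (R : realType) (n : nat) (G : groupType) (A : atlas R G n)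
    (g : G) (mu : 'rV[R]_n) : 'rV[R]_n :=
  dual_vec (fun xi => pairing mu (Ad A g^-1%g xi)).

(* A homomorphism R -> G which is differentiable at 0 is smooth, and is
   determined by its velocity at 0. *)
Definition one_parameter_subgroup (R : realType) (n : nat) (G : groupType)
    (A : atlas R G n) (xi : 'rV[R]_n) (c : R -> G) : Prop :=
  (forall s t, c (s + t) = (c s * c t)%g) /\ has_velocity A c 0 xi.

Definition lie_exp (R : realType) (n : nat) (G : groupType)
    (A : atlas R G n) (xi : 'rV[R]_n) : G :=
  xget 1%g [set h | exists2 c, one_parameter_subgroup A xi c & h = c 1].

Definition ad (R : realType) (n : nat) (G : groupType) (A : atlas R G n)
    (xi eta : 'rV[R]_n) : 'rV[R]_n :=
  derive1 (fun t : R => Ad A (lie_exp A (t *: xi)) eta) 0.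

Definition adstar (R : realType) (n : nat) (G : groupType) (A : atlas R G n)
    (xi mu : 'rV[R]_n) : 'rV[R]_n :=
  derive1 (fun t : R => Adstar A (lie_exp A (t *: xi)) mu) 0.

(* TG, right-trivialized to G x g. *)
Definition TG_atlas (R : realType) (n : nat) (G : groupType)
    (A : atlas R G n) : atlas R (G * 'rV[R]_n) (n + n) :=
  prod_atlas A (vector_atlas R n).

(* G x g x g^* x g^*, with points ((g, xi), (mu, nu)). *)
Definition trivT (R : realType) (n : nat) (G : groupType) : Type :=
  ((G * 'rV[R]_n) * ('rV[R]_n * 'rV[R]_n))%type.

Definition triv_atlas (R : realType) (n : nat) (G : groupType)
    (A : atlas R G n) : atlas R (trivT R n G) ((n + n) + (n + n)) :=
  prod_atlas (prod_atlas A (vector_atlas R n))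
             (prod_atlas (vector_atlas R n) (vector_atlas R n)).

(* The covector (alpha_g, alpha_xi) is row_mx alpha_g alpha_xi. *)
Definition trivialization (R : realType) (n : nat) (G : groupType)
    (A : atlas R G n) (b : (G * 'rV[R]_n) * 'rV[R]_(n + n)) : trivT R n G :=
  let g := b.1.1 in let xi := b.1.2 in
  let alpha_g := lsubmx b.2 in let alpha_xi := rsubmx b.2 in
  ((g, xi), (TRstar A g alpha_g + adstar A xi alpha_xi, alpha_xi)).

(* The trivialization is a bijection when G is a Lie group; pinv is then its
   inverse. *)
Definition trivialization_inv (R : realType) (n : nat) (G : groupType)
    (A : atlas R G n) : trivT R n G -> (G * 'rV[R]_n) * 'rV[R]_(n + n) :=
  'pinv_(fun=> ((1%g, 0), 0)) setT (trivialization A).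

Definition Omega (R : realType) (n : nat) (G : groupType) (A : atlas R G n) :
    trivT R n G -> 'rV[R]_((n + n) + (n + n)) ->
    'rV[R]_((n + n) + (n + n)) -> R :=
  pullback2 (triv_atlas A) (cotangent_atlas (TG_atlas A))
    (trivialization_inv A) (canonical_form (TG_atlas A)).

(* i_X Omega = - dH *)
Definition is_hamiltonian_field (R : realType) (n : nat) (G : groupType)
    (A : atlas R G n) (H : trivT R n G -> R)
    (X : trivT R n G -> 'rV[R]_((n + n) + (n + n))) : Prop :=
  forall p V, Omega A p (X p) V = - differential (triv_atlas A) H p V.

Definition tangent4 (R : realType) (n : nat) (vg vxi vmu vnu : 'rV[R]_n) :
    'rV[R]_((n + n) + (n + n)) :=
  row_mx (row_mx vg vxi) (row_mx vmu vnu).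

Section Partial.
Variables (R : realType) (n : nat) (G : groupType) (A : atlas R G n).
Variables (H : trivT R n G -> R) (p : trivT R n G).
Let g := p.1.1.
Let xi := p.1.2.
Let mu := p.2.1.
Let nu := p.2.2.

(* In T_g^* G. *)
Definition dH_g : 'rV[R]_n :=
  dual_vec (differential A (fun g' => H ((g', xi), (mu, nu))) g).

(* In g^*. *)
Definition dH_xi : 'rV[R]_n :=
  dual_vec ('d (fun xi' => H ((g, xi'), (mu, nu))) xi).

(* In g, identified with the dual of g^*. *)
Definition dH_mu : 'rV[R]_n :=
  dual_vec ('d (fun mu' => H ((g, xi), (mu', nu))) mu).

Definition dH_nu : 'rV[R]_n :=
  dual_vec ('d (fun nu' => H ((g, xi), (mu, nu'))) nu).

End Partial.

(* Main.v *)
Require Import Defs.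
From HB Require Import structures.
From mathcomp Require Import all_boot all_order all_algebra.
From mathcomp Require Import all_classical all_reals all_analysis.
From mathcomp Require Import ring lra.

Set Implicit Arguments.
Unset Strict Implicit.
Unset Printing Implicit Defensive.

Import Order.TTheory GRing.Theory Num.Theory.
Import numFieldNormedType.Exports.

Local Open Scope classical_set_scope.
Local Open Scope ring_scope.

(* In the standard charts of T^*M the canonical form is d p /\ d q.  The inverse
   trivialization keeps g, xi and nu and sends mu to the covector alpha with
   <alpha, T R_g eta> = <mu, eta> + <nu, [xi, eta]> for all eta.  Differentiating
   this identity in (g, xi, mu, nu) expresses d alpha through the derivatives of
   the right-invariant fields, and these enter Omega only through the commutator
   [X_a, X_b] = - X_[a, b].  With V_g = T R_g a and W_g = T R_g b this gives
     Omega(V, W) = <V_mu, b> + <V_nu, [xi, b]> + <nu, [V_xi, b]>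
                 - <W_mu, a> - <W_nu, [xi, a]> - <nu, [W_xi, a]>
                 + <mu, [a, b]> + <nu, [xi, [a, b]]>
                 + <V_nu, W_xi> - <W_nu, V_xi>,
   and Hamilton's equations follow by solving Omega(X, W) = - dH(W) for W in each
   of the four slots, using the Jacobi identity.

   As ad is defined through lie_exp, one-parameter subgroups must be constructed.
   They are the curves c with c(t) = c(t/2)^2 and velocity xi at 0: such a curve
   exists as the limit of (t xi / 2^k)^(2^k), and it is unique because the
   distance d of two of them satisfies d(t) <= (2 + C|t|) d(t/2) and d(t) = o(t).
   The same estimate applied to Ad_c(t) xi - xi, which is o(t) since
   [xi, xi] = 0, shows that the values of c commute; hence r |-> c(rs) c(rt)
   again satisfies the halving equation and c is a homomorphism by uniqueness. *)

(** * Differentials and C^k maps *)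

(** A vector or covector at [g] is a row vector in the chart indexed by [g], so nothing that varies
    with [g] can be differentiated before it is moved into one fixed chart. The right-invariant
    frame [rfield] and its inverse serve this purpose: paired with the frame, a covector becomes an
    element of g^* independent of the chart, and the inverse trivialization gets a smooth explicit
    formula in place of [pinv].

    The bracket is taken as a derivative of Ad, which yields bilinearity, antisymmetry and the
    Jacobi identity without an exponential; the latter only serves to identify [ad] and [adstar].
    Squaring constructs it without differential equations: its derivative at the identity is
    multiplication by 2 and its remainder is quadratic, so halving the argument is compensated to
    first order. Iterating d(t) <= (2 + C|t|) d(t/2) gives d(t) <= K 2^k d(t/2^k), since the product
    of the factors 1 + C|t|/2^(j+1) is bounded, and d(t) = o(t) sends the right-hand side to 0. *)

Section Germs.
Variables (R : realType) (V W : normedModType R).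
Implicit Types (f g : V -> W) (x : V).

(** An epsilon form of the little-o definition; uniqueness of the differential then identifies
    ['d f x] with the candidate [L]. *)
Lemma diff_epsP f x (L : {linear V -> W}) : continuous L ->
  (forall e : R, 0 < e ->
    \forall h \near 0, `|f (h + x) - f x - L h| <= e * `|h|) ->
  differentiable f x /\ 'd f x = L :> (V -> W).
Proof.
move=> cL fL.
have fxE : f \o shift x = cst (f x) + L +o_ 0 id.
  apply/eqaddoP => e e0; have := fL e e0; apply: filterS => h.
  by rewrite /= opprD addrA.
have dE := diff_unique cL fxE.
by split=> //; apply/diff_locallyP; rewrite dE.
Qed.

Lemma diff_eps f x : differentiable f x -> forall e : R, 0 < e ->
  \forall h \near 0, `|f (h + x) - f x - 'd f x h| <= e * `|h|.
Proof.
move=> /diff_locallyP[_ /eqaddoP fx] e e0; have := fx e e0.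
by apply: filterS => h; rewrite /= opprD addrA.
Qed.

Lemma near_differentiable f g x : {near x, f =1 g} -> differentiable f x ->
  differentiable g x /\ 'd g x = 'd f x :> (V -> W).
Proof.
move=> fg df.
apply: diff_epsP; first exact: diff_continuous.
move=> e e0.
have fgx : f x = g x := nbhs_singleton fg.
have fg0 : \forall h \near 0, f (h + x) = g (h + x).
  by move: fg; rewrite (near_shift 0 x) /=; apply: filterS => h; rewrite subr0.
have := diff_eps df e0; apply: filterS2 fg0 => h fgh.
by rewrite fgh fgx.
Qed.
End Germs.

Section Continuity.
Variables (R : realType) (V W : normedModType R).

Lemma continuous_near_eq (f g : V -> W) x : {near x, f =1 g} ->
  {for x, continuous f} -> {for x, continuous g}.
Proof.
move=> fg; rewrite /prop_for /continuous_at -(nbhs_singleton fg).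
by apply: cvg_trans; apply: near_eq_cvg; apply: filterS fg.
Qed.
End Continuity.

(* Sealing 'd keeps unification from unfolding the differentials of two
   unrelated functions. *)
HB.lock Definition ddiff (R : realType) (V W : normedModType R) (f : V -> W)
  (x v : V) : W := 'd f x v.

Section Ddiff.
Variables (R : realType) (V W : normedModType R).
Implicit Types (f g : V -> W).

Lemma ddiffE f x v : 'd f x v = ddiff f x v.
Proof. by rewrite unlock. Qed.

Lemma ddiffv_sum f x (I : Type) (r : seq I) (P : pred I) (u : I -> V) :
  ddiff f x (\sum_(i <- r | P i) u i) = \sum_(i <- r | P i) ddiff f x (u i).
Proof. by rewrite unlock linear_sum. Qed.

Lemma ddiffvD f x u v : ddiff f x (u + v) = ddiff f x u + ddiff f x v.
Proof. by rewrite unlock linearD. Qed.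

Lemma ddiffvZ f x (a : R) v : ddiff f x (a *: v) = a *: ddiff f x v.
Proof. by rewrite unlock linearZ_LR. Qed.

Lemma ddiffv0 f x : ddiff f x 0 = 0.
Proof. by rewrite unlock linear0. Qed.

Lemma ddiff_near f g x v : {near x, f =1 g} -> differentiable f x ->
  ddiff g x v = ddiff f x v.
Proof.
move=> fg df; rewrite unlock.
exact: (congr1 (@^~ v) (near_differentiable fg df).2).
Qed.

Lemma ddiffD f g x v : differentiable f x -> differentiable g x ->
  ddiff (fun y => f y + g y) x v = ddiff f x v + ddiff g x v.
Proof.
by move=> df dg; rewrite unlock; exact: (congr1 (@^~ v) (diffD df dg)).
Qed.

Lemma ddiffN f x v : differentiable f x ->
  ddiff (fun y => - f y) x v = - ddiff f x v.
Proof. by move=> df; rewrite unlock; exact: (congr1 (@^~ v) (diffN df)). Qed.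

Lemma ddiffM (f g : V -> R) x v : differentiable f x -> differentiable g x ->
  ddiff (fun y => f y * g y) x v = f x * ddiff g x v + g x * ddiff f x v.
Proof.
by move=> df dg; rewrite unlock; exact: (congr1 (@^~ v) (diffM df dg)).
Qed.

Lemma ddiff_cst (a : W) (x v : V) : ddiff (fun=> a) x v = 0.
Proof. by rewrite unlock; have /(congr1 (@^~ v)) := @diff_cst R V W a x. Qed.
End Ddiff.

Lemma ddiff_comp (R : realType) (U V W : normedModType R) (f : U -> V)
    (g : V -> W) x v : differentiable f x -> differentiable g (f x) ->
  ddiff (fun y => g (f y)) x v = ddiff g (f x) (ddiff f x v).
Proof.
move=> df dg; rewrite unlock; exact: (congr1 (@^~ v) (diff_comp df dg)).
Qed.

Section Linear.
Variables (R : realType) (n : nat) (W : normedModType R).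

(** In finite dimension a linear map is a finite combination of coordinate functions, hence
    continuous, and so it is its own differential. *)
Lemma linear_rV_diff (f : 'rV[R]_n -> W) x : linear f ->
  differentiable f x /\ forall v, ddiff f x v = f v.
Proof.
move=> lf.
pose lfM := GRing.isLinear.Build _ _ _ _ _ lf.
pose fL : {linear 'rV[R]_n -> W} := HB.pack f lfM.
have cf : continuous fL.
  have -> : (fL : _ -> _) = (fun v => \sum_(i < n) v 0 i *: fL (delta_mx 0 i)).
    apply/funext => v; rewrite {1}(row_sum_delta v) linear_sum.
    by apply: eq_bigr => i _; rewrite linearZ_LR.
  move=> v; apply: differentiable_continuous.
  rewrite (_ : (fun v => _) =
    \sum_(i < n) (fun v : 'rV[R]_n => v 0 i *: fL (delta_mx 0 i))); last first.
    by apply/funext => w; rewrite fct_sumE.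
  apply: differentiable_sum => i.
  by apply: differentiableZl; exact: differentiable_coord.
split; first exact: (@linear_differentiable _ _ _ fL).
by move=> v; rewrite -ddiffE (@diff_lin _ _ _ fL).
Qed.
End Linear.

Section Coordinates.
Variables (R : realType) (E : normedModType R) (m : nat).
Implicit Type f : E -> 'rV[R]_m.

Lemma coord_linear i : linear (fun v : 'rV[R]_m => v 0 i).
Proof. by move=> a u v; rewrite !mxE. Qed.

Lemma diff_coord f x i : differentiable f x ->
  differentiable (fun y => f y 0 i) x /\
  forall v, ddiff (fun y => f y 0 i) x v = ddiff f x v 0 i.
Proof.
move=> df; have [dc cE] := linear_rV_diff (f x) (@coord_linear i).
split; first exact: (differentiable_comp df dc).
by move=> v; rewrite (ddiff_comp v df dc) cE.
Qed.

Lemma differentiable_rV f x :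
  (forall i, differentiable (fun y => f y 0 i) x) -> differentiable f x.
Proof.
move=> df; rewrite (_ : f =
    \sum_(i < m) (fun y => f y 0 i *: (delta_mx 0 i : 'rV[R]_m))); last first.
  by apply/funext => w; rewrite fct_sumE [LHS]row_sum_delta.
by apply: differentiable_sum => i; apply: differentiableZl.
Qed.
End Coordinates.

Section Ck.
Variables (R : realType) (E : normedModType R).
Implicit Types (U V : set E).

Lemma open_near U x : open U -> U x -> \forall y \near x, U y.
Proof. by move=> oU Ux; apply: open_nbhs_nbhs. Qed.

Lemma CkS (F : normedModType R) k U (f : E -> F) : Ck_on k.+1 U f <->
  (forall x, U x -> differentiable f x) /\
  forall v, Ck_on k U (fun x => ddiff f x v).
Proof.
have ddE v : (fun x => ddiff f x v) = (fun x => 'd f x v).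
  by apply/funext => x; rewrite ddiffE.
by split=> -[df Cf]; split=> // v; have := Cf v; rewrite ddE.
Qed.

(** Since [U] is open, functions equal on [U] have equal germs at its points, hence equal
    directional derivatives. *)
Lemma Ck_ext (F : normedModType R) k U (f g : E -> F) : open U ->
  (forall x, U x -> f x = g x) -> Ck_on k U f -> Ck_on k U g.
Proof.
move=> oU; elim: k f g => [|k IH] f g fg /=.
  move=> cf x Ux; apply: continuous_near_eq (cf x Ux).
  by apply: filterS (open_near oU Ux).
have nfg x : U x -> {near x, f =1 g}.
  by move=> Ux; apply: filterS (open_near oU Ux).
move=> /CkS[df Cf]; apply/CkS; split=> [x Ux|v].
  by have [] := near_differentiable (nfg x Ux) (df x Ux).
apply: IH (Cf v) => x Ux.
by rewrite (ddiff_near v (nfg x Ux)) //; exact: df.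
Qed.

Lemma Ck_sub (F : normedModType R) k U V (f : E -> F) : V `<=` U ->
  Ck_on k U f -> Ck_on k V f.
Proof.
move=> VU; elim: k f => [|k IH] f; first by move=> + x /VU; exact.
by move=> /CkS[df Cf]; apply/CkS; split=> [x /VU /df //|v]; exact: IH.
Qed.

Lemma CkW (F : normedModType R) k U (f : E -> F) :
  Ck_on k.+1 U f -> Ck_on k U f.
Proof.
elim: k f => [|k IH] f /CkS[df Cf].
  by move=> x Ux; apply: differentiable_continuous; exact: df.
by apply/CkS; split=> // v; exact: IH.
Qed.

Lemma Ck_cst (F : normedModType R) k U (a : F) : Ck_on k U (fun=> a).
Proof.
elim: k a => [|k IH] a; first by move=> x _; exact: cst_continuous.
apply/CkS; split=> [x _|v]; first exact: differentiable_cst.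
rewrite (_ : (fun x => _) = fun=> 0) //.
by apply/funext => x; exact: ddiff_cst.
Qed.

Lemma CkD (F : normedModType R) k U (f g : E -> F) : open U ->
  Ck_on k U f -> Ck_on k U g -> Ck_on k U (fun x => f x + g x).
Proof.
move=> oU; elim: k f g => [|k IH] f g.
  by move=> cf cg x Ux; apply: continuousD; [exact: cf|exact: cg].
move=> /CkS[df Cf] /CkS[dg Cg]; apply/CkS; split=> [x Ux|v].
  by apply: differentiableD; [exact: df|exact: dg].
apply: Ck_ext (IH _ _ (Cf v) (Cg v)) => // x Ux.
by rewrite (ddiffD v (df x Ux) (dg x Ux)).
Qed.

Lemma Ck_sum (F : normedModType R) k U n (f : 'I_n -> E -> F) : open U ->
  (forall i, Ck_on k U (f i)) -> Ck_on k U (fun x => \sum_(i < n) f i x).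
Proof.
move=> oU; elim: n f => [|n IH] f Cf.
  apply: Ck_ext (Ck_cst k U (0 : F)) => // x _; by rewrite big_ord0.
apply: Ck_ext (CkD oU (IH (fun i =>
  f (widen_ord (leqnSn n) i)) _) (Cf ord_max)) => //.
by move=> x _; rewrite big_ord_recr.
Qed.

Lemma CkM k U (f g : E -> R) : open U ->
  Ck_on k U f -> Ck_on k U g -> Ck_on k U (fun x => f x * g x).
Proof.
move=> oU; elim: k f g => [|k IH] f g.
  by move=> cf cg x Ux; apply: continuousM; [exact: cf|exact: cg].
move=> Sf Sg; have [/CkS[df Cf] /CkS[dg Cg]] := (Sf, Sg).
apply/CkS; split=> [x Ux|v].
  by apply: differentiableM; [exact: df|exact: dg].
(* The product rule leaves one factor undifferentiated; [CkW] lowers it to class k. *)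
apply: Ck_ext (CkD oU (IH _ _ (CkW Sf) (Cg v)) (IH _ _ (CkW Sg) (Cf v))) => //.
by move=> x Ux; rewrite (ddiffM v (df x Ux) (dg x Ux)).
Qed.

Lemma Ck_rV k U m (f : E -> 'rV[R]_m) : open U ->
  (forall i, Ck_on k U (fun x => f x 0 i)) -> Ck_on k U f.
Proof.
move=> oU; elim: k f => [|k IH] f Cf.
  move=> x Ux; rewrite (_ : f =
    (fun y => \sum_(i < m) f y 0 i *: (delta_mx 0 i : 'rV[R]_m))); last first.
    by apply/funext => w; rewrite [LHS]row_sum_delta.
  refine (@Ck_sum _ 0 U m _ oU _ x Ux) => i y Uy.
  by apply: continuousZr_tmp; exact: Cf.
have df x : U x -> differentiable f x.
  by move=> Ux; apply: differentiable_rV => i; have /CkS[+ _] := Cf i; exact.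
apply/CkS; split=> // v; apply: IH => i; have /CkS[_ /(_ v)] := Cf i.
by apply: Ck_ext => // x Ux; have [_ ->] := diff_coord i (df x Ux).
Qed.

Lemma Ck_coord k U m (f : E -> 'rV[R]_m) i : open U ->
  Ck_on k U f -> Ck_on k U (fun x => f x 0 i).
Proof.
move=> oU; elim: k f => [|k IH] f.
  move=> Cf x Ux.
  by apply: (@continuous_comp _ _ _ f (fun M : 'rV[R]_m => M 0 i) x (Cf x Ux));
    exact: coord_continuous.
move=> /CkS[df Cf]; apply/CkS; split=> [x Ux|v].
  by have [] := diff_coord i (df x Ux).
apply: Ck_ext (IH _ (Cf v)) => // x Ux.
by have [_ ->] := diff_coord i (df x Ux).
Qed.
End Ck.

Section CkComp.
Variables (R : realType) (E : normedModType R).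

Lemma Ck_comp_scalar k n (U : set E) (V : set 'rV[R]_n) f (g : 'rV[R]_n -> R) :
  open U -> (forall x, U x -> V (f x)) ->
  Ck_on k U f -> Ck_on k V g -> Ck_on k U (g \o f).
Proof.
move=> oU UV; elim: k f g UV => [|k IH] f g UV.
  by move=> cf cg x Ux; apply: continuous_comp; [exact: cf|exact/cg/UV].
move=> Sf Sg; have [/CkS[df Cf] /CkS[dg Cg]] := (Sf, Sg).
apply/CkS; split=> [x Ux|v].
  by apply: differentiable_comp; [exact: df|exact/dg/UV].
(* [Ck_on] controls derivatives in fixed directions, while in the chain rule the direction
   [ddiff f x v] moves with [x]. Expanding it in the standard basis leaves products of its
   coordinates with fixed partial derivatives of [g]. *)
have Ck_i i : Ck_on k U (fun x =>
  ddiff f x v 0 i * ddiff g (f x) (delta_mx 0 i)).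
  apply: CkM => //; first exact: Ck_coord.
  by apply: (IH f (fun y => ddiff g y (delta_mx 0 i))) => //; exact: CkW.
apply: Ck_ext (Ck_sum oU Ck_i) => // x Ux.
rewrite (ddiff_comp v (df x Ux) (dg _ (UV _ Ux))).
rewrite [in RHS](row_sum_delta (ddiff f x v)) ddiffv_sum.
by apply: eq_bigr => i _; rewrite ddiffvZ.
Qed.

Lemma Ck_comp k n m (U : set E) (V : set 'rV[R]_n) f
    (g : 'rV[R]_n -> 'rV[R]_m) :
  open U -> open V -> (forall x, U x -> V (f x)) ->
  Ck_on k U f -> Ck_on k V g -> Ck_on k U (g \o f).
Proof.
move=> oU oV UV Cf Cg; apply: Ck_rV => // i.
by apply: (@Ck_comp_scalar k n U V f (fun y => g y 0 i)) => //; exact: Ck_coord.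
Qed.
End CkComp.

(** * Smooth maps *)

Lemma ddiff_is_derive (R : realType) (V W : normedModType R) (f : V -> W) x v :
  differentiable f x ->
  is_derive x v f (ddiff f x v).
Proof.
by move=> df; apply: DeriveDef;
  [exact: diff_derivable|rewrite deriveE // ddiffE].
Qed.

Lemma is_derive_diff (R : realType) (V : normedModType R) (c : R -> V)
    (t : R) w :
  is_derive t 1 c w <-> differentiable c t /\ ddiff c t 1 = w.
Proof.
split=> [[/derivable1_diffP dc <-]|[dc <-]]; last exact: ddiff_is_derive.
by split=> //; rewrite deriveE // ddiffE.
Qed.

Section Curves.
Variables (R : realType) (V W : normedModType R).

Lemma is_derive_comp (c : R -> V) (f : V -> W) (t : R) w : is_derive t 1 c w ->
  differentiable f (c t) -> is_derive t 1 (fun s => f (c s)) (ddiff f (c t) w).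
Proof.
move=> /is_derive_diff[dc <-] df; apply/is_derive_diff.
by split; [exact: (differentiable_comp dc df)|exact: ddiff_comp].
Qed.

Lemma is_derive_line (x v : V) (t : R) : is_derive t 1 (fun s => x + s *: v) v.
Proof.
have dl : is_derive t 1 (fun s : R => s *: v) v.
  apply/is_derive_diff; split; first exact: differentiableZl.
  by rewrite unlock diffZl // diff_val /= scale1r.
by have := is_deriveD (is_derive_cst x t 1) dl; rewrite add0r.
Qed.
End Curves.

Section MeanValue.
Variables (R : realType) (V : normedModType R).

(** Restriction to the segment reduces this to one variable. Values are real because no such
    equality holds for vector values; vector maps are treated by coordinates. *)
Lemma segment_MVT (f : V -> R) x v :
  (forall t : R, 0 <= t <= 1 -> differentiable f (x + t *: v)) ->
  exists2 t : R, 0 <= t <= 1 & f (x + v) - f x = ddiff f (x + t *: v) v.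
Proof.
move=> df; pose g (t : R) := f (x + t *: v).
have dg (t : R) : 0 <= t <= 1 -> is_derive t 1 g (ddiff f (x + t *: v) v).
  by move=> t01; apply: (is_derive_comp (is_derive_line x v t)); exact: df.
have [t|t t01|t t01 gE] := @MVT_segment R g (fun t =>
  ddiff f (x + t *: v) v) 0 1 ler01.
- by rewrite in_itv /= => /andP[t0 t1]; apply: dg; rewrite !ltW.
- by apply: derivable_within_continuous => s s01;
    have [|+ _] := dg s; first by move: s01; rewrite in_itv.
by exists t; [move: t01; rewrite in_itv|move: gE;
  rewrite /g scale1r scale0r addr0 subr0 mulr1].
Qed.
End MeanValue.

Section Smooth.
Variables (R : realType).

(** One neighbourhood serves all orders, so smoothness at [x] passes to directional derivatives and
    to nearby points without following domains by hand. *)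
Definition smooth_at (E F : normedModType R) (f : E -> F) (x : E) : Prop :=
  exists U : set E, [/\ open U, U x & smooth_on U f].

Section General.
Variables (E F : normedModType R).
Implicit Types (f g : E -> F) (x : E).

Lemma smooth_on_at (U : set E) f x :
  open U -> smooth_on U f -> U x -> smooth_at f x.
Proof. by move=> oU fU Ux; exists U. Qed.

Lemma smooth_at_near f x : smooth_at f x -> \forall y \near x, smooth_at f y.
Proof.
move=> [U [oU Ux fU]]; apply: filterS (open_near oU Ux) => y Uy.
by exists U.
Qed.

Lemma smooth_at_eq f g x : {near x, f =1 g} -> smooth_at f x -> smooth_at g x.
Proof.
move=> fg [U [oU Ux fU]]; move: fg;
  rewrite /prop_near1 nbhsE => -[V [oV Vx] VE].
have oUV := openI oU oV.
exists (U `&` V); split => // k.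
apply: Ck_ext (Ck_sub (@subIsetl _ _ _) (fU k)) => // y [_ Vy]; exact: VE.
Qed.

Lemma smooth_at_diff f x : smooth_at f x -> differentiable f x.
Proof. by move=> [U [oU Ux /(_ 1%N)/CkS[+ _]]]; exact. Qed.

Lemma smooth_at_ddiff f x v : smooth_at f x -> smooth_at (ddiff f ^~ v) x.
Proof.
by move=> [U [oU Ux fU]]; exists U; split=> // k; have /CkS[_] := fU k.+1;
  exact.
Qed.

(** Being of class k on [U] is a condition at each point, and [ddiff] does not refer to the
    neighbourhood, so local witnesses glue. *)
Lemma Ck_local k (U : set E) f :
  (forall x, U x -> exists V : set E, [/\ open V, V x & Ck_on k V f]) ->
  Ck_on k U f.
Proof.
elim: k f => [|k IH] f fU.
  by move=> x /fU[V [_ Vx +]]; exact.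
apply/CkS; split=> [x /fU[V [_ Vx /CkS[+ _]]]|v]; first exact.
apply: IH => x /fU[V [oV Vx /CkS[_ Cf]]]; by exists V.
Qed.

Lemma smooth_onP (U : set E) f : (forall x, U x -> smooth_at f x) ->
  smooth_on U f.
Proof.
by move=> fU k; apply: Ck_local => x /fU[V [oV Vx fV]]; exists V.
Qed.

Lemma smooth_at_cst (a : F) x : smooth_at (fun=> a) x.
Proof.
by exists setT; split=> // [|k]; [exact: openT|exact: Ck_cst].
Qed.

Lemma smooth_atD f g x : smooth_at f x -> smooth_at g x ->
  smooth_at (fun y => f y + g y) x.
Proof.
move=> [U [oU Ux fU]] [V [oV Vx gV]]; have oUV := openI oU oV.
exists (U `&` V); split=> // k; apply: CkD => //.
  exact: Ck_sub (fU k).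
exact: Ck_sub (gV k).
Qed.

Lemma smooth_at_sum n (f : 'I_n -> E -> F) x : (forall i, smooth_at (f i) x) ->
  smooth_at (fun y => \sum_(i < n) f i y) x.
Proof.
elim: n f => [|n IH] f sf.
  apply: smooth_at_eq (smooth_at_cst 0 x); apply: nearW => y;
    by rewrite big_ord0.
apply: smooth_at_eq (smooth_atD (IH (fun i =>
  f (widen_ord (leqnSn n) i)) _) (sf ord_max)) => //.
by apply: nearW => y; rewrite big_ord_recr.
Qed.
End General.

Lemma smooth_atM (E : normedModType R) (f g : E -> R) x :
  smooth_at f x -> smooth_at g x -> smooth_at (fun y => f y * g y) x.
Proof.
move=> [U [oU Ux fU]] [V [oV Vx gV]]; have oUV := openI oU oV.
exists (U `&` V); split=> // k; apply: CkM => //.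
  exact: Ck_sub (fU k).
exact: Ck_sub (gV k).
Qed.

Lemma smooth_at_coord (E : normedModType R) m (f : E -> 'rV[R]_m) x i :
  smooth_at f x -> smooth_at (fun y => f y 0 i) x.
Proof.
by move=> [U [oU Ux fU]]; exists U; split=> // k; exact: Ck_coord.
Qed.

Lemma smooth_at_rV (E : normedModType R) m (f : E -> 'rV[R]_m) x :
  (forall i, smooth_at (fun y => f y 0 i) x) -> smooth_at f x.
Proof.
move=> sf; rewrite (_ : f = (fun y => \sum_(i < m) f y 0 i *: delta_mx 0 i)).
  apply: (@smooth_at_sum E _ m (fun i y => f y 0 i *: delta_mx 0 i)) => i.
  have [U [oU Ux fU]] := sf i.
  exists U; split=> // k; apply: Ck_rV => // j.
  apply: Ck_ext (CkM oU (fU k) (Ck_cst k U ((delta_mx 0 i : 'rV[R]_m) 0 j))) =>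
    //.
  by move=> y _; rewrite [RHS]mxE.
by apply/funext => y; rewrite [LHS]row_sum_delta.
Qed.

Lemma smooth_at_linear n (F : normedModType R) (f : 'rV[R]_n -> F) x :
  linear f -> smooth_at f x.
Proof.
move=> lf; exists setT; split=> //; first exact: openT.
case=> [|k].
  by move=> y _; apply: differentiable_continuous;
    have [] := linear_rV_diff y lf.
apply/CkS; split=> [y _|v]; first by have [] := linear_rV_diff y lf.
rewrite (_ : (fun y => _) = (fun=> f v)); first exact: Ck_cst.
by apply/funext => y; have [_ ->] := linear_rV_diff y lf.
Qed.

Lemma smooth_at_id n x : smooth_at (fun y : 'rV[R]_n => y) x.
Proof. exact: smooth_at_linear. Qed.

Lemma smooth_at_comp (E : normedModType R) n m (f : E -> 'rV[R]_n)
    (g : 'rV[R]_n -> 'rV[R]_m) x :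
  smooth_at f x -> smooth_at g (f x) -> smooth_at (fun y => g (f y)) x.
Proof.
move=> [U [oU Ux fU]] [V [oV Vfx gV]].
have oW : open (U `&` f @^-1` V).
  rewrite openE => y [Uy Vfy]; apply: filterI; first exact: open_near oU Uy.
  exact: (fU 0%N y Uy _ (open_near oV Vfy)).
exists (U `&` f @^-1` V); split=> // k.
by apply: (@Ck_comp _ _ k _ _ _ V) => // [y []//|]; exact: Ck_sub (fU k).
Qed.

(** Base point and direction both move; the direction is expanded in the standard basis so that only
    derivatives in fixed directions are composed with [a]. *)
Lemma smooth_at_ddiff2 (E : normedModType R) n m (f : 'rV[R]_n -> 'rV[R]_m)
    (a b : E -> 'rV[R]_n) x :
  smooth_at f (a x) -> smooth_at a x -> smooth_at b x ->
  smooth_at (fun y => ddiff f (a y) (b y)) x.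
Proof.
move=> sf sa sb; apply: smooth_at_rV => i.
rewrite (_ : (fun y => _) = (fun y =>
    \sum_(j < n) b y 0 j * ddiff f (a y) (delta_mx 0 j) 0 i)).
  apply: (@smooth_at_sum E _ n (fun j y =>
    b y 0 j * ddiff f (a y) (delta_mx 0 j) 0 i)) => j.
  apply: smooth_atM; first exact: smooth_at_coord.
  apply: smooth_at_coord.
  apply: (@smooth_at_comp _ _ _ a (fun y => ddiff f y (delta_mx 0 j))) => //.
  exact: smooth_at_ddiff.
apply/funext => y; rewrite {1}(row_sum_delta (b y)) ddiffv_sum summxE.
by apply: eq_bigr => j _; rewrite ddiffvZ mxE.
Qed.

End Smooth.

Section RowMx.
Variables (R : realType).

Lemma ddiff_linear_rV n (W : normedModType R) (f : 'rV[R]_n -> W) x v :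
  linear f -> ddiff f x v = f v.
Proof. by move=> lf; have [_ ->] := linear_rV_diff x lf. Qed.

Lemma differentiable_linear_rV n (W : normedModType R) (f : 'rV[R]_n -> W) x :
  linear f -> differentiable f x.
Proof. by move=> lf; have [] := linear_rV_diff x lf. Qed.

Lemma ddiffZ (V W : normedModType R) (k : R) (f : V -> W) x v :
  differentiable f x -> ddiff (fun y => k *: f y) x v = k *: ddiff f x v.
Proof.
by move=> df; rewrite unlock; exact: (congr1 (@^~ v) (diffZ k df)).
Qed.

Lemma ddiff_comp_linear (E W : normedModType R) n (L : 'rV[R]_n -> W)
    (f : E -> 'rV[R]_n) x v :
  linear L -> differentiable f x ->
  ddiff (fun y => L (f y)) x v = L (ddiff f x v).
Proof.
move=> lL df; rewrite ddiff_comp // ?ddiff_linear_rV //.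
exact: differentiable_linear_rV.
Qed.

Lemma lsubmx_is_linear n m : linear (@lsubmx R 1 n m).
Proof. by move=> a u v; rewrite linearP. Qed.

Lemma rsubmx_is_linear n m : linear (@rsubmx R 1 n m).
Proof. by move=> a u v; rewrite linearP. Qed.

Lemma smooth_at_row_mx (E : normedModType R) n m (f : E -> 'rV[R]_n)
    (g : E -> 'rV[R]_m) x :
  smooth_at f x -> smooth_at g x -> smooth_at (fun y => row_mx (f y) (g y)) x.
Proof.
move=> sf sg; apply: smooth_at_rV => i; case: (split_ordP i) => j ->.
  rewrite (_ : (fun y => _) = (fun y => f y 0 j)); first exact: smooth_at_coord.
  by apply/funext => y; rewrite row_mxEl.
rewrite (_ : (fun y => _) = (fun y => g y 0 j)); first exact: smooth_at_coord.
by apply/funext => y; rewrite row_mxEr.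
Qed.

Lemma differentiable_row_mx (E : normedModType R) n m (f : E -> 'rV[R]_n)
    (g : E -> 'rV[R]_m) x :
  differentiable f x -> differentiable g x ->
  differentiable (fun y => row_mx (f y) (g y)) x.
Proof.
move=> df dg; apply: differentiable_rV => i; case: (split_ordP i) => j ->.
  rewrite (_ : (fun y => _) = (fun y => f y 0 j));
    first by have [] := diff_coord j df.
  by apply/funext => y; rewrite row_mxEl.
rewrite (_ : (fun y => _) = (fun y => g y 0 j));
  first by have [] := diff_coord j dg.
by apply/funext => y; rewrite row_mxEr.
Qed.

Lemma differentiable_row_mxP (E : normedModType R) n m (f : E -> 'rV[R]_n)
    (g : E -> 'rV[R]_m) x :
  differentiable (fun y => row_mx (f y) (g y)) x ->
  differentiable f x /\ differentiable g x.
Proof.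
move=> d; split.
  rewrite (_ : f = fun y => lsubmx (row_mx (f y) (g y))); last first.
    by apply/funext => y; rewrite row_mxKl.
  exact: (differentiable_comp d (differentiable_linear_rV _ (@lsubmx_is_linear n
    m))).
rewrite (_ : g = fun y => rsubmx (row_mx (f y) (g y))); last first.
  by apply/funext => y; rewrite row_mxKr.
exact: (differentiable_comp d (differentiable_linear_rV _ (@rsubmx_is_linear n
  m))).
Qed.

Lemma ddiff_row_mx (E : normedModType R) n m (f : E -> 'rV[R]_n)
    (g : E -> 'rV[R]_m) x v :
  differentiable f x -> differentiable g x ->
  ddiff (fun y => row_mx (f y) (g y)) x v = row_mx (ddiff f x v) (ddiff g x v).
Proof.
move=> df dg; have d := differentiable_row_mx df dg.
rewrite -[LHS]hsubmxK -(ddiff_comp_linear v (@lsubmx_is_linear n m) d).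
rewrite -(ddiff_comp_linear v (@rsubmx_is_linear n m) d).
by congr (row_mx (ddiff _ x v) (ddiff _ x v)); apply/funext => y;
  rewrite ?row_mxKl ?row_mxKr.
Qed.

Lemma smooth_at_lsubmx (E : normedModType R) n m (f : E -> 'rV[R]_(n + m)) x :
  smooth_at f x -> smooth_at (fun y => lsubmx (f y)) x.
Proof.
move=> sf; apply: (smooth_at_comp sf).
exact/smooth_at_linear/lsubmx_is_linear.
Qed.

Lemma smooth_at_rsubmx (E : normedModType R) n m (f : E -> 'rV[R]_(n + m)) x :
  smooth_at f x -> smooth_at (fun y => rsubmx (f y)) x.
Proof.
move=> sf; apply: (smooth_at_comp sf).
exact/smooth_at_linear/rsubmx_is_linear.
Qed.
End RowMx.

(** * Symmetry of second derivatives *)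

Section Schwarz.
Variables (R : realType) (n : nat).
Implicit Types (x v w : 'rV[R]_n).

(** Two uses of the mean value theorem: for y |-> f(y + w) - f y along [v], then for the derivative
    of [f] in direction [v] along [w]. *)
Lemma second_difference_MVT (f : 'rV[R]_n -> R) x v w :
  (forall a b : R, 0 <= a <= 1 -> 0 <= b <= 1 ->
    smooth_at f (x + a *: v + b *: w)) ->
  exists a b : R, [/\ 0 <= a <= 1, 0 <= b <= 1 &
    f (x + v + w) - f (x + v) - (f (x + w) - f x) =
    ddiff (ddiff f ^~ v) (x + a *: v + b *: w) w].
Proof.
move=> sf; have I0 : 0 <= (0 : R) <= 1 by rewrite lexx ler01.
have I1 : 0 <= (1 : R) <= 1 by rewrite lexx ler01.
pose g y := f (y + w) - f y.
have dshift y : differentiable (fun z => z + w) y.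
  by apply: differentiableD; [exact: differentiable_linear_rV|exact:
    differentiable_cst].
have dfw (a : R) : 0 <= a <= 1 -> differentiable (fun y =>
  f (y + w)) (x + a *: v).
  move=> a01; apply: (differentiable_comp (dshift _)); apply: smooth_at_diff.
  by have := sf a 1 a01 I1; rewrite scale1r.
have df (a : R) : 0 <= a <= 1 -> differentiable f (x + a *: v).
  by move=> a01; apply: smooth_at_diff; have := sf a 0 a01 I0;
    rewrite scale0r addr0.
have [a a01|a a01 gE] := @segment_MVT R _ g x v.
  by apply: differentiableB; [exact: dfw|exact: df].
have {}gE : g (x + v) - g x =
    ddiff f (x + a *: v + w) v - ddiff f (x + a *: v) v.
  rewrite gE /g.
  rewrite ddiffD ?ddiffN; [|exact: df|exact: dfw|].
    congr (_ - _); rewrite ddiff_comp //; last first.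
      by apply: smooth_at_diff; have := sf a 1 a01 I1; rewrite scale1r.
    congr ddiff; rewrite ddiffD; [|exact: differentiable_linear_rV|exact:
      differentiable_cst].
    by rewrite ddiff_cst addr0 ddiff_linear_rV.
  by apply: differentiableN; exact: df.
have [b b01|b b01 hE] := @segment_MVT R _ (ddiff f ^~ v) (x + a *: v) w.
  by apply: smooth_at_diff; apply: smooth_at_ddiff; exact: sf.
by exists a, b; split; rewrite // -hE -gE.
Qed.

(** The second difference over a small parallelogram is symmetric in its sides. Computed in both
    orders, it gives the two mixed derivatives at two nearby points, and continuity brings both back
    to [x]. *)
Lemma schwarz_scalar (f : 'rV[R]_n -> R) x v w : smooth_at f x ->
  ddiff (ddiff f ^~ v) x w = ddiff (ddiff f ^~ w) x v.
Proof.
move=> sf; pose P u z y := ddiff (ddiff f ^~ u) y z.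
have cP u z : {for x, continuous (P u z)}.
  apply: differentiable_continuous; apply: smooth_at_diff.
  by do 2 apply: smooth_at_ddiff.
apply/eqP; rewrite -subr_eq0 -normr_le0; apply/ler_addgt0Pl => e e0;
  rewrite addr0.
have e20 : 0 < e / 2 by rewrite divr_gt0.
have nP u z : \forall y \near x, `|P u z x - P u z y| < e / 2.
  by have /cvgrPdist_lt := cP u z; exact.
have : \forall y \near x, [/\ smooth_at f y, `|P v w x - P v w y| < e / 2 &
    `|P w v x - P w v y| < e / 2].
  apply: filterS3 (smooth_at_near sf) (nP v w) (nP w v) => y; exact: And3.
move=> /nbhs_ballP[r /= r0 xr].
(* With this scale the parallelogram of sides [h *: v] and [h *: w] lies in the ball of radius [r];
   the summand 1 keeps the denominator positive. *)
pose h := r / 2 / (1 + `|v| + `|w|).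
have D0 : 0 < 1 + `|v| + `|w| by rewrite ltr_pwDl // ltr_pwDl.
have h0 : 0 < h by rewrite !divr_gt0.
have inball (a b : R) : 0 <= a <= 1 -> 0 <= b <= 1 ->
    ball x r (x + a *: (h *: v) + b *: (h *: w)).
  move=> /andP[a0 a1] /andP[b0 b1]; rewrite -ball_normE /=.
  rewrite -addrA opprD addrA subrr add0r normrN.
  apply: le_lt_trans (ler_normD _ _) _; rewrite !normrZ.
  rewrite !ger0_norm // ?ltW //.
  have -> : a * (h * `|v|) + b * (h * `|w|) = h * (a * `|v| + b * `|w|) by ring.
  apply: le_lt_trans (_ : h * (1 + `|v| + `|w|) < r).
    rewrite ler_pM2l //; apply: lerD; last by rewrite ler_piMl.
    by apply: le_trans (_ : `|v| <= _); [rewrite ler_piMl|rewrite lerDr].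
  by rewrite /h divfK ?gt_eqF // ltr_pdivrMr // ltr_pMr // ltr1n.
have inball' (a b : R) : 0 <= a <= 1 -> 0 <= b <= 1 ->
    ball x r (x + a *: (h *: w) + b *: (h *: v)).
  by move=> a01 b01; rewrite -addrA (addrC (a *: _)) addrA; exact: inball.
have [a [b [a01 b01 E1]]] := @second_difference_MVT f x (h *: v) (h *: w)
  (fun a b a01 b01 => let: And3 s _ _ := xr _ (inball a b a01 b01) in s).
have [c [d [c01 d01 E2]]] := @second_difference_MVT f x (h *: w) (h *: v)
  (fun a b a01 b01 => let: And3 s _ _ := xr _ (inball' a b a01 b01) in s).
have hP u z y : smooth_at f y ->
    ddiff (ddiff f ^~ (h *: u)) y (h *: z) = h * h * P u z y.
  move=> sfy; rewrite ddiffvZ.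
  have -> : (fun y => ddiff f y (h *: u)) = (fun y => h *: ddiff f y u).
    by apply/funext => y'; rewrite ddiffvZ.
  by rewrite ddiffZ ?scalerA //; apply: smooth_at_diff; exact: smooth_at_ddiff.
have [s1 V1 _] := xr _ (inball a b a01 b01).
have [s2 _ V2] := xr _ (inball' c d c01 d01).
(* Both sides, multiplied by h^2, equal the same second difference. *)
have PE : P v w (x + a *: (h *: v) + b *: (h *: w)) =
          P w v (x + c *: (h *: w) + d *: (h *: v)).
  apply: (@mulfI _ (h * h)); first by rewrite mulf_neq0 ?gt_eqF.
  rewrite -!hP // -E1 -E2 (addrAC x (h *: w)); ring.
rewrite -/(P v w x) -/(P w v x) (splitr e).
rewrite -(subrK (P v w (x + a *: (h *: v) + b *: (h *: w))) (P v w x)) -addrA.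
apply: le_trans (ler_normD _ _) _; apply: lerD; first exact: ltW.
by rewrite PE distrC ltW.
Qed.

Lemma schwarz m (f : 'rV[R]_n -> 'rV[R]_m) x v w : smooth_at f x ->
  ddiff (ddiff f ^~ v) x w = ddiff (ddiff f ^~ w) x v.
Proof.
move=> sf; apply/rowP => i.
have E u z : ddiff (ddiff f ^~ u) x z 0 i =
    ddiff (ddiff (fun y => f y 0 i) ^~ u) x z.
  have [|_ <-] := @diff_coord R _ _ (ddiff f ^~ u) x i.
    by apply: smooth_at_diff; exact: smooth_at_ddiff.
  apply: ddiff_near.
    apply: filterS (smooth_at_near sf) => y /smooth_at_diff sfy.
    by have [_ ->] := diff_coord i sfy.
  by apply: smooth_at_diff; apply: smooth_at_ddiff; exact: smooth_at_coord.
by rewrite !E; apply: schwarz_scalar; exact: smooth_at_coord.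
Qed.
End Schwarz.

(** * Manifolds *)

Lemma differentiable_near (R : realType) (V W : normedModType R) (f : V -> W) x
    (P : set W) : differentiable f x -> (\forall z \near f x, P z) ->
  \forall y \near x, P (f y).
Proof. by move=> /differentiable_continuous cf nP; exact: cf. Qed.

Section Charts.
Variables (R : realType) (M : Type) (k : nat) (A : atlas R M k).
Hypothesis hA : is_manifold A.

Definition chart_im (p : M) : set 'rV[R]_k := chart A p @` dom A p.

Lemma dom_self p : dom A p p.
Proof. by case: hA. Qed.

Lemma chartK p q : dom A p q -> chart_inv A p (chart A p q) = q.
Proof. by case: hA => _ + _ _; exact. Qed.

Lemma chart_im_open p : open (chart_im p).
Proof. by case: hA => _ _ /(_ p p) + _; rewrite setIid. Qed.

Lemma chart_im_chart p q : dom A p q -> chart_im p (chart A p q).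
Proof. by move=> pq; exists q. Qed.

Lemma chart_im_self p : chart_im p (chart A p p).
Proof. exact/chart_im_chart/dom_self. Qed.

Lemma chart_invK p x : chart_im p x -> chart A p (chart_inv A p x) = x.
Proof. by move=> [q pq <-]; rewrite chartK. Qed.

Lemma dom_chart_inv p x : chart_im p x -> dom A p (chart_inv A p x).
Proof. by move=> [q pq <-]; rewrite chartK. Qed.

Lemma chart_im_near p x : chart_im p x -> \forall y \near x, chart_im p y.
Proof. exact/open_near/chart_im_open. Qed.

Lemma overlapE p q x : (chart A p @` (dom A p `&` dom A q)) x <->
  chart_im p x /\ dom A q (chart_inv A p x).
Proof.
split=> [[r [pr qr] <-]|[[r pr <-]]]; first by rewrite chartK //; split => //;
  exists r.
by rewrite chartK // => qr; exists r.
Qed.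

Lemma overlap_near p q x : chart_im p x -> dom A q (chart_inv A p x) ->
  \forall y \near x, chart_im p y /\ dom A q (chart_inv A p y).
Proof.
move=> px qx; have [_ _ /(_ p q) oO _] := hA.
have : (chart A p @` (dom A p `&` dom A q)) x by apply/overlapE.
by move/(open_near oO); apply: filterS => y /overlapE.
Qed.

Lemma transition_smooth p q x : chart_im p x -> dom A q (chart_inv A p x) ->
  smooth_at (fun y => chart A q (chart_inv A p y)) x.
Proof.
move=> px qx; have [_ _ /(_ p q) oO /(_ p q) sO] := hA.
by apply: (smooth_on_at oO sO); apply/overlapE.
Qed.

(* Smoothness at x of a map into M, in one or equivalently in all charts. *)
Definition psmooth (E : normedModType R) (F : E -> M) (x : E) : Prop :=
  forall q, dom A q (F x) ->
    (\forall y \near x, dom A q (F y)) /\ smooth_at (fun y =>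
      chart A q (F y)) x.

Section Param.
Variables (E : normedModType R).
Implicit Types (F : E -> M) (x : E).

Lemma psmooth_dom F x q : psmooth F x -> dom A q (F x) ->
  \forall y \near x, dom A q (F y).
Proof. by move=> sF /sF[]. Qed.

Lemma psmooth_chart F x q : psmooth F x -> dom A q (F x) ->
  smooth_at (fun y => chart A q (F y)) x.
Proof. by move=> sF /sF[]. Qed.

Lemma psmooth_self F x : psmooth F x -> smooth_at (fun y =>
  chart A (F x) (F y)) x.
Proof. by move=> sF; apply: psmooth_chart => //; exact: dom_self. Qed.

(** One chart suffices: near [x] the values of [F] stay in the open overlap of the two domains, and
    the expression in the chart at [r] is the one at [q] followed by a smooth transition map. *)
Lemma psmooth_intro F x q : dom A q (F x) ->
  (\forall y \near x, dom A q (F y)) ->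
  smooth_at (fun y => chart A q (F y)) x -> psmooth F x.
Proof.
move=> qx nq sq r rx.
have iq := chart_im_chart qx.
have nr : \forall y \near x, dom A r (F y).
  have : \forall z \near chart A q (F x), dom A r (chart_inv A q z).
    apply: filterS (overlap_near iq (_ : dom A r _)) => [z []//|].
    by rewrite chartK.
  move/(differentiable_near (smooth_at_diff sq)); apply: filterS2 nq => y qy.
  by rewrite chartK.
split=> //; apply: (@smooth_at_eq _ _ _
    (fun y => chart A r (chart_inv A q (chart A q (F y))))).
  by apply: filterS nq => y qy; rewrite chartK.
apply: (@smooth_at_comp _ _ _ _ _ (fun z => chart A r (chart_inv A q z)) _ sq).
by apply: transition_smooth => //; rewrite chartK.
Qed.

Lemma psmooth_cst m x : psmooth (fun=> m) x.
Proof.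
by move=> q qm; split; [exact: nearW|exact: smooth_at_cst].
Qed.

(* The velocity at x of F in the direction v, in the coordinates at F x. *)
Definition velocity F x v : 'rV[R]_k := ddiff (fun y =>
  chart A (F x) (F y)) x v.

Lemma velocity_near F G x v : {near x, F =1 G} -> psmooth F x ->
  velocity G x v = velocity F x v.
Proof.
move=> FG sF; rewrite /velocity -(nbhs_singleton FG); apply: ddiff_near.
  by apply: filterS FG => y ->.
exact/smooth_at_diff/psmooth_self.
Qed.

(** The transformation law of tangent vectors: the derivative of the transition map carries a
    velocity from the chart indexed by [F x] to the one at [q]. *)
Lemma velocity_chart F x q v : psmooth F x -> dom A q (F x) ->
  ddiff (fun y => chart A q (F y)) x v =
  ddiff (fun y => chart A q (chart_inv A (F x) y)) (chart A (F x) (F x))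
        (velocity F x v).
Proof.
move=> sF qx; rewrite /velocity.
set T := fun y => chart A q (chart_inv A (F x) y).
have dF := smooth_at_diff (psmooth_self sF).
have dT : differentiable T (chart A (F x) (F x)).
  apply/smooth_at_diff/transition_smooth; first exact: chart_im_self.
  by rewrite chartK //; exact: dom_self.
rewrite -(ddiff_comp v dF dT); apply: ddiff_near.
  apply: filterS (psmooth_dom sF (@dom_self (F x))) => y xy.
  by rewrite /T chartK.
exact: (differentiable_comp dF dT).
Qed.
End Param.

Lemma psmooth_chart_inv p x : chart_im p x -> psmooth (chart_inv A p) x.
Proof.
move=> px; apply: (psmooth_intro (q := p)).
- exact: dom_chart_inv.
- by apply: filterS (chart_im_near px) => y; exact: dom_chart_inv.
apply: smooth_at_eq (smooth_at_id x).
by apply: filterS (chart_im_near px) => y py; rewrite chart_invK.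
Qed.

Lemma psmooth_comp (E : normedModType R) n (F : 'rV[R]_n -> M)
    (a : E -> 'rV[R]_n) x :
  psmooth F (a x) -> smooth_at a x -> psmooth (fun y => F (a y)) x.
Proof.
move=> sF sa q qx; have [nF sq] := sF q qx; split.
  exact: (differentiable_near (smooth_at_diff sa) nF).
exact: (smooth_at_comp sa sq).
Qed.

Lemma velocity_comp (E : normedModType R) n (F : 'rV[R]_n -> M)
    (a : E -> 'rV[R]_n) x v :
  psmooth F (a x) -> smooth_at a x ->
  velocity (fun y => F (a y)) x v = velocity F (a x) (ddiff a x v).
Proof.
move=> sF sa.
exact: (ddiff_comp v (smooth_at_diff sa) (smooth_at_diff (psmooth_self sF))).
Qed.

Lemma velocity_chart_inv p x v : chart_im p x ->
  ddiff (fun y => chart A p (chart_inv A p y)) x v = v.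
Proof.
move=> px; rewrite -[RHS](@ddiff_linear_rV R _ _ id x v) //.
apply: ddiff_near; last exact: differentiable_linear_rV.
by apply: filterS (chart_im_near px) => y py; rewrite chart_invK.
Qed.

End Charts.

Section Maps.
Variables (R : realType) (M N : Type) (k l : nat).
Variables (A : atlas R M k) (B : atlas R N l).
Hypotheses (hA : is_manifold A) (hB : is_manifold B).
Variable f : M -> N.
Hypothesis hf : smooth_map A B f.

Lemma smooth_map_local_rep p : smooth_at (local_rep A B f p) (chart A p p).
Proof. by have [W [oW Wp _ _ sW]] := hf p; exact: smooth_on_at oW sW Wp. Qed.

Lemma psmooth_map (E : normedModType R) (F : E -> M) x :
  psmooth A F x -> psmooth B (fun y => f (F y)) x.
Proof.
move=> sF; set p := F x.
have [W [oW Wp Wi Wd sW]] := hf p.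
have sp := psmooth_self hA sF.
have nW : \forall y \near x, dom A p (F y) /\ W (chart A p (F y)).
  apply: filterS2 (psmooth_dom sF (dom_self hA p))
    (differentiable_near (smooth_at_diff sp) (open_near oW Wp)) => y.
  by split.
apply: (psmooth_intro hB (q := f p)); first exact: dom_self.
  by apply: filterS nW => y [py /Wd]; rewrite chartK.
apply: (@smooth_at_eq _ _ _ (fun y => local_rep A B f p (chart A p (F y)))).
  by apply: filterS nW => y [py _]; rewrite /local_rep /= chartK.
exact: (smooth_at_comp sp (smooth_map_local_rep p)).
Qed.

Lemma tangent_mapE p v :
  tangent_map A B f p v = velocity B (fun x =>
    f (chart_inv A p x)) (chart A p p) v.
Proof. by rewrite /tangent_map /velocity chartK ?ddiffE //;
  exact: dom_self. Qed.

End Maps.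

Section Products.
Variables (R : realType).

Lemma vector_atlas_manifold k : is_manifold (vector_atlas R k).
Proof.
have imT : id @` (setT `&` setT) = setT :> set 'rV[R]_k.
  by rewrite setIid image_id.
split=> // p q; rewrite imT; first exact: openT.
by apply: smooth_onP => x _; exact: smooth_at_id.
Qed.

Variables (M N : Type) (k l : nat) (A : atlas R M k) (B : atlas R N l).
Hypotheses (hA : is_manifold A) (hB : is_manifold B).

Lemma prod_atlas_manifold : is_manifold (prod_atlas A B).
Proof.
pose C := prod_atlas A B.
(* Overlaps are products of overlaps, written as intersections of preimages so that openness follows
   from continuity of the two projections. *)
have imE p q : chart C p @` (dom C p `&` dom C q) =
    (lsubmx @^-1` (chart A p.1 @` (dom A p.1 `&` dom A q.1))) `&`
    (rsubmx @^-1` (chart B p.2 @` (dom B p.2 `&` dom B q.2))).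
  apply/seteqP; split=> z.
    move=> [r [[p1 p2] [q1 q2]] <-]; split; rewrite /= ?row_mxKl ?row_mxKr.
      by exists r.1.
    by exists r.2.
  move=> [[r1 [p1 q1] r1z] [r2 [p2 q2] r2z]]; exists (r1, r2) => //.
  by rewrite /= r1z r2z hsubmxK.
split.
- by move=> p; split; exact: dom_self.
- by move=> p q [p1 p2]; rewrite /= row_mxKl row_mxKr !chartK //; case: q p1 p2.
- move=> p q; rewrite imE; apply: openI.
    apply: open_comp => [z _|]; first
      exact/differentiable_continuous/differentiable_lsubmx.
    by case: hA.
  apply: open_comp => [z _|]; first
    exact/differentiable_continuous/differentiable_rsubmx.
  by case: hB.
- move=> p q; rewrite imE; apply: smooth_onP =>
  z [/= /(overlapE hA)[zp zq] /(overlapE hB)[zp' zq']].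
  apply: smooth_at_row_mx.
    exact: (smooth_at_comp (smooth_at_lsubmx (smooth_at_id z))
      (transition_smooth hA zp zq)).
  exact: (smooth_at_comp (smooth_at_rsubmx (smooth_at_id z))
    (transition_smooth hB zp' zq')).
Qed.

Lemma psmooth_pair (E : normedModType R) (F : E -> M) (G : E -> N) x :
  psmooth A F x -> psmooth B G x ->
  psmooth (prod_atlas A B) (fun y => (F y, G y)) x.
Proof.
move=> sF sG q [/= q1 q2]; have [nF sq1] := sF _ q1; have [nG sq2] := sG _ q2.
split; first by apply: filterS2 nF nG => y; split.
exact: smooth_at_row_mx.
Qed.

End Products.

(** * The canonical form of a cotangent bundle *)

Lemma differentiable_sum_fun (R : realType) (E F : normedModType R) n
    (f : 'I_n -> E -> F) x : (forall i, differentiable (f i) x) ->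
  differentiable (fun y => \sum_(i < n) f i y) x.
Proof.
move=> df; rewrite (_ : (fun y => _) = \sum_(i < n) f i).
  exact: differentiable_sum.
by apply/funext => y; rewrite fct_sumE.
Qed.

Lemma ddiff_sum (R : realType) (E F : normedModType R) n
    (f : 'I_n -> E -> F) x v : (forall i, differentiable (f i) x) ->
  ddiff (fun y => \sum_(i < n) f i y) x v = \sum_(i < n) ddiff (f i) x v.
Proof.
elim: n f => [|n IH] f df.
  rewrite big_ord0 (_ : (fun y => _) = fun=> 0) ?ddiff_cst //.
  by apply/funext => y; rewrite big_ord0.
rewrite big_ord_recr /= -IH // -ddiffD //; last exact: differentiable_sum_fun.
by congr ddiff; apply/funext => y; rewrite big_ord_recr.
Qed.

Section Pairing.
Variables (R : realType) (k : nat).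
Implicit Types (a b u v : 'rV[R]_k).

Lemma pairing_dual_vec (l : 'rV[R]_k -> R) v :
  linear l -> pairing (dual_vec l) v = l v.
Proof.
move=> ll; pose lM := GRing.isLinear.Build _ _ _ _ _ ll.
pose lL : {linear 'rV[R]_k -> R} := HB.pack l lM.
rewrite -[RHS]/(lL v) (row_sum_delta v) linear_sum.
rewrite -(row_sum_delta v); apply: eq_bigr => i _.
by rewrite linearZ mxE mulrC.
Qed.

Lemma pairingC u v : pairing u v = pairing v u.
Proof. by apply: eq_bigr => i _; rewrite mulrC. Qed.

Lemma pairing_linear a : linear (pairing a).
Proof.
move=> c u v; rewrite /pairing.
under eq_bigr => i _ do rewrite !mxE mulrDr mulrCA.
by rewrite big_split /= -mulr_sumr.
Qed.

Lemma pairingDr a u v : pairing a (u + v) = pairing a u + pairing a v.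
Proof. by rewrite -[u]scale1r pairing_linear !scale1r. Qed.

Lemma pairingZr a c v : pairing a (c *: v) = c * pairing a v.
Proof.
by rewrite /pairing mulr_sumr; apply: eq_bigr => i _; rewrite mxE mulrCA.
Qed.

Lemma pairingNr a v : pairing a (- v) = - pairing a v.
Proof. by rewrite -scaleN1r pairingZr mulN1r. Qed.

Lemma pairingBr a u v : pairing a (u - v) = pairing a u - pairing a v.
Proof. by rewrite pairingDr pairingNr. Qed.

Lemma pairing0r a : pairing a 0 = 0.
Proof. by rewrite -(scale0r 0) pairingZr mul0r. Qed.

Lemma pairingDl a b v : pairing (a + b) v = pairing a v + pairing b v.
Proof. by rewrite pairingC pairingDr !(pairingC v). Qed.

Lemma pairingNl a v : pairing (- a) v = - pairing a v.
Proof. by rewrite pairingC pairingNr (pairingC v). Qed.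

Lemma pairingBl a b v : pairing (a - b) v = pairing a v - pairing b v.
Proof. by rewrite pairingDl pairingNl. Qed.

Lemma pairing0l v : pairing 0 v = 0.
Proof. by rewrite pairingC pairing0r. Qed.

Lemma pairing_delta a i : pairing a (delta_mx 0 i) = a 0 i.
Proof.
rewrite /pairing (bigD1 i) //= big1 => [|j /negbTE ji].
  by rewrite mxE !eqxx mulr1 addr0.
by rewrite mxE ji andbF mulr0.
Qed.

Lemma pairing_inj a b : (forall v, pairing a v = pairing b v) -> a = b.
Proof. by move=> ab; apply/rowP => i; rewrite -!pairing_delta. Qed.

Lemma pairing_row_mx m (a u : 'rV[R]_k) (b v : 'rV[R]_m) :
  pairing (row_mx a b) (row_mx u v) = pairing a u + pairing b v.
Proof.
rewrite /pairing big_split_ord; congr (_ + _); apply: eq_bigr => i _.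
  by rewrite !row_mxEl.
by rewrite !row_mxEr.
Qed.

Lemma smooth_at_pairing (E : normedModType R) (f g : E -> 'rV[R]_k) x :
  smooth_at f x -> smooth_at g x -> smooth_at (fun y => pairing (f y) (g y)) x.
Proof.
move=> sf sg; apply: (@smooth_at_sum R E R k (fun i y => f y 0 i * g y 0 i)) =>
  i.
by apply: smooth_atM; exact: smooth_at_coord.
Qed.

Lemma smooth_at_dual_vec (E : normedModType R) (l : E -> 'rV[R]_k -> R) x :
  (forall v, smooth_at (l ^~ v) x) -> smooth_at (fun y => dual_vec (l y)) x.
Proof.
move=> sl; apply: smooth_at_rV => i.
by under eq_fun do rewrite mxE; exact: sl.
Qed.

Lemma ddiff_pairing (E : normedModType R) (f g : E -> 'rV[R]_k) x (v : E) :
  differentiable f x -> differentiable g x ->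
  ddiff (fun y => pairing (f y) (g y)) x v =
  pairing (ddiff f x v) (g x) + pairing (f x) (ddiff g x v).
Proof.
move=> df dg; rewrite /pairing -big_split /=.
have d i : differentiable (fun y => f y 0 i * g y 0 i) x.
  apply: differentiableM; first by have [] := diff_coord i df.
  by have [] := diff_coord i dg.
have dE i : ddiff (fun y => f y 0 i * g y 0 i) x v =
    ddiff f x v 0 i * g x 0 i + f x 0 i * ddiff g x v 0 i.
  have [dfi fiE] := diff_coord i df; have [dgi giE] := diff_coord i dg.
  by rewrite ddiffM // fiE giE addrC (mulrC (g x 0 i)).
under [RHS]eq_bigr => i _ do rewrite -dE.
exact: ddiff_sum.
Qed.
End Pairing.

Section CanonicalForm.
Variables (R : realType) (M : Type) (k : nat) (A : atlas R M k).
Hypothesis hA : is_manifold A.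

(** The chain rule for the cocycle of transition maps, the chart at [q] being inserted between those
    at [p] and [r]. *)
Lemma ddiff_transition p q r x v : chart_im A p x ->
  dom A q (chart_inv A p x) -> dom A r (chart_inv A p x) ->
  ddiff (fun y => chart A r (chart_inv A p y)) x v =
  ddiff (fun y => chart A r (chart_inv A q y)) (chart A q (chart_inv A p x))
    (ddiff (fun y => chart A q (chart_inv A p y)) x v).
Proof.
move=> px qx rx.
have sq := transition_smooth hA px qx.
have sr : smooth_at (fun y => chart A r (chart_inv A q y))
    (chart A q (chart_inv A p x)).
  by apply: transition_smooth; rewrite ?chartK //; exact: chart_im_chart.
rewrite -(ddiff_comp v (smooth_at_diff sq) (smooth_at_diff sr)).
apply: ddiff_near; last exact/smooth_at_diff/(smooth_at_comp sq sr).
by apply: filterS (overlap_near hA px qx) => y [_ qy]; rewrite chartK.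
Qed.

Lemma chart_cotangentE p q : chart (cotangent_atlas A) p q =
  row_mx (chart A p.1 q.1) (dual_vec (fun w => pairing q.2
    (ddiff (fun y => chart A q.1 (chart_inv A p.1 y)) (chart A p.1 q.1) w))).
Proof.
rewrite /=; congr row_mx; congr dual_vec; apply/funext => w.
by rewrite unlock.
Qed.

Lemma chart_inv_cotangentE p z : chart_inv (cotangent_atlas A) p z =
  (chart_inv A p.1 (lsubmx z), dual_vec (fun v => pairing (rsubmx z)
    (ddiff (fun y => chart A p.1 (chart_inv A (chart_inv A p.1 (lsubmx z)) y))
      (chart A (chart_inv A p.1 (lsubmx z)) (chart_inv A p.1 (lsubmx z))) v))).
Proof.
rewrite /=; congr pair; congr dual_vec; apply/funext => w.
by rewrite unlock.
Qed.

(** In the chart indexed by the base point itself, the bundle projection reads as [lsubmx]. *)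
Lemma liouvilleE b V : liouville A b V = pairing b.2 (lsubmx V).
Proof.
rewrite /liouville /tangent_map ddiffE; congr pairing.
have := chart_im_self hA b.1 => b1.
pose L z := chart A b.1 (chart_inv A b.1 (@lsubmx R 1 k k z)).
rewrite -[LHS]/(ddiff L (chart (cotangent_atlas A) b b) V).
rewrite /L (@ddiff_comp _ _ _ _ (@lsubmx R 1 k k)
  (fun y => chart A b.1 (chart_inv A b.1 y))); last 2 first.
- exact/differentiable_linear_rV/lsubmx_is_linear.
- rewrite /= row_mxKl; apply/smooth_at_diff/transition_smooth => //.
  by apply: dom_chart_inv.
rewrite /= row_mxKl velocity_chart_inv //.
by rewrite ddiff_linear_rV //; exact: lsubmx_is_linear.
Qed.

(** This is p dq in a standard chart. At the point of coordinates [z] the definitions switch to the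
    chart indexed by that point, so vector and covector are both transported there; the two
    transports cancel in the pairing. *)
Lemma form_rep_liouville b z w : chart_im A b.1 (lsubmx z) ->
  form_rep (cotangent_atlas A) (liouville A) b z w =
  pairing (rsubmx z) (lsubmx w).
Proof.
move=> bz; rewrite /form_rep liouvilleE ddiffE.
set q := chart_inv (cotangent_atlas A) b z; set p := b.1.
have qd : dom A p q.1 by exact: dom_chart_inv.
pose T1 y := chart A q.1 (chart_inv A p y).
pose S y := chart A p (chart_inv A q.1 y).
pose T2 z' := dual_vec (fun v : 'rV[R]_k =>
  pairing (rsubmx z') (ddiff S (T1 (@lsubmx R 1 k k z')) v)).
have sT1 : smooth_at T1 (lsubmx z) by apply: transition_smooth => //;
  exact: dom_self.
have sl : smooth_at (fun z' : 'rV[R]_(k + k) => T1 (lsubmx z')) z.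
  exact: (smooth_at_comp (smooth_at_lsubmx (smooth_at_id z)) sT1).
have sT2 : smooth_at T2 z.
  apply: smooth_at_dual_vec => v; apply: smooth_at_pairing.
    exact/smooth_at_rsubmx/smooth_at_id.
  apply: smooth_at_ddiff2 => //; last exact: smooth_at_cst.
  apply: transition_smooth; rewrite ?chartK //; try exact: dom_self.
  exact: chart_im_self.
have nearz : \forall z' \near z, chart_im A p (lsubmx z') /\
    dom A q.1 (chart_inv A p (lsubmx z')).
  refine (@differentiable_near _ _ _ _ _ (fun y => chart_im A p y /\
    dom A q.1 (chart_inv A p y)) (@differentiable_lsubmx R 1 k k z) _).
  by apply: overlap_near => //; exact: dom_self.
have ldual (a : 'rV[R]_k) (f : 'rV[R]_k -> 'rV[R]_k) x :
    linear (fun v => pairing a (ddiff f x v)).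
  by move=> c u v; rewrite ddiffvD ddiffvZ pairing_linear.
(* The coordinate change of the cotangent bundle from the chart at [b] to that at [q]. Its
   definition passes through the chart indexed by the moving point, which the cocycle identity
   eliminates; what remains in [T2] is visibly smooth in [z']. *)
have TE : {near z, (fun z' => row_mx (T1 (lsubmx z')) (T2 z')) =1
    chart (cotangent_atlas A) q \o chart_inv (cotangent_atlas A) b}.
  apply: filterS nearz => z' [z'p z'q].
  rewrite /comp chart_cotangentE chart_inv_cotangentE /=.
  congr row_mx; congr dual_vec; apply/funext => v.
  rewrite pairing_dual_vec //; congr pairing.
  rewrite (@ddiff_transition q.1 (chart_inv A p (lsubmx z')) p) ?chartK //.
  - exact: chart_im_chart.
  - exact: dom_self.
  - exact: dom_chart_inv.
rewrite (ddiff_near _ TE); last first.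
  apply: differentiable_row_mx; exact: smooth_at_diff.
rewrite ddiff_row_mx; try exact: smooth_at_diff.
rewrite row_mxKl (@ddiff_comp _ _ _ _ (@lsubmx R 1 k k) T1); last 2 first.
- exact/differentiable_linear_rV/lsubmx_is_linear.
- exact: smooth_at_diff.
rewrite (@ddiff_linear_rV _ _ _ (@lsubmx R 1 k k));
  last exact: lsubmx_is_linear.
rewrite [X in pairing X.2]chart_inv_cotangentE pairing_dual_vec //.
congr pairing.
(* From the chart at [p] to that at [q] and back is the identity. *)
rewrite -[X in ddiff _ X _]/(T1 (lsubmx z)) -(@ddiff_transition p q.1 p) //.
- by rewrite velocity_chart_inv.
- exact: dom_self.
Qed.

(** Against a constant vector, p dq is linear in the fibre coordinate and constant in the base
    coordinate, so its derivative is read off at once. *)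
Lemma canonical_formE b V W : canonical_form A b V W =
  pairing (rsubmx V) (lsubmx W) - pairing (rsubmx W) (lsubmx V).
Proof.
rewrite /canonical_form /ext_deriv !ddiffE.
set z := chart (cotangent_atlas A) b b.
have dE u v : ddiff (fun y => form_rep (cotangent_atlas A) (liouville A) b y v)
  z u =
    pairing (rsubmx u) (lsubmx v).
  have lE : linear (fun y => pairing (@rsubmx R 1 k k y) (lsubmx v)).
    by move=> c y y'; rewrite linearP pairingC pairing_linear !(pairingC (lsubmx
      v)).
  rewrite -(ddiff_linear_rV z u lE); apply: ddiff_near.
    have nz : \forall y \near z, chart_im A b.1 (lsubmx y).
      refine (@differentiable_near _ _ _ _ _ (chart_im A b.1)
        (@differentiable_lsubmx R 1 k k z) _).
      by rewrite /z /= row_mxKl; apply: chart_im_near => //;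
        exact: chart_im_self.
    by apply: filterS nz => y yb; rewrite form_rep_liouville.
  exact: differentiable_linear_rV.
by rewrite !dE.
Qed.
End CanonicalForm.

(** * Right-invariant fields and the Lie bracket *)

Section Partials.
Variables (R : realType) (n m p : nat).
Implicit Type f : 'rV[R]_(n + m) -> 'rV[R]_p.

Lemma smooth_at_row_mxl x (y : 'rV[R]_m) :
  smooth_at (fun x' : 'rV[R]_n => row_mx x' y) x.
Proof. by apply: smooth_at_row_mx;
  [exact: smooth_at_id|exact: smooth_at_cst]. Qed.

Lemma smooth_at_row_mxr (x : 'rV[R]_n) y :
  smooth_at (fun y' : 'rV[R]_m => row_mx x y') y.
Proof. by apply: smooth_at_row_mx;
  [exact: smooth_at_cst|exact: smooth_at_id]. Qed.

Lemma ddiff_row_mxl x (y : 'rV[R]_m) v :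
  ddiff (fun x' : 'rV[R]_n => row_mx x' y) x v = row_mx v 0.
Proof.
by rewrite ddiff_row_mx ?ddiff_cst ?ddiff_linear_rV.
Qed.

Lemma ddiff_row_mxr (x : 'rV[R]_n) y v :
  ddiff (fun y' : 'rV[R]_m => row_mx x y') y v = row_mx 0 v.
Proof.
by rewrite ddiff_row_mx ?ddiff_cst ?ddiff_linear_rV.
Qed.

Lemma ddiff_partial_l f x y v : differentiable f (row_mx x y) ->
  ddiff (fun x' => f (row_mx x' y)) x v = ddiff f (row_mx x y) (row_mx v 0).
Proof.
move=> df; rewrite -(ddiff_row_mxl x y).
exact: (ddiff_comp v (smooth_at_diff (smooth_at_row_mxl x y)) df).
Qed.

Lemma ddiff_partial_r f x y v : differentiable f (row_mx x y) ->
  ddiff (fun y' => f (row_mx x y')) y v = ddiff f (row_mx x y) (row_mx 0 v).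
Proof.
move=> df; rewrite -(ddiff_row_mxr x y).
exact: (ddiff_comp v (smooth_at_diff (smooth_at_row_mxr x y)) df).
Qed.

Lemma partial_l_near f x y v : smooth_at f (row_mx x y) ->
  {near y, (fun y' => ddiff f (row_mx x y') (row_mx v 0)) =1
    (fun y' => ddiff (fun x' => f (row_mx x' y')) x v)}.
Proof.
move=> sf; have := differentiable_near
  (smooth_at_diff (smooth_at_row_mxr x y)) (smooth_at_near sf).
by apply: filterS => y' sy'; rewrite ddiff_partial_l //; exact: smooth_at_diff.
Qed.

Lemma partial_r_near f x y v : smooth_at f (row_mx x y) ->
  {near x, (fun x' => ddiff f (row_mx x' y) (row_mx 0 v)) =1
    (fun x' => ddiff (fun y' => f (row_mx x' y')) y v)}.
Proof.
move=> sf; have := differentiable_near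
  (smooth_at_diff (smooth_at_row_mxl x y)) (smooth_at_near sf).
by apply: filterS => x' sx'; rewrite ddiff_partial_r //; exact: smooth_at_diff.
Qed.

Lemma smooth_at_partial_l f x y v : smooth_at f (row_mx x y) ->
  smooth_at (fun y' => ddiff (fun x' => f (row_mx x' y')) x v) y.
Proof.
move=> sf; apply: smooth_at_eq (partial_l_near v sf) _.
apply: smooth_at_ddiff2 => //; first exact: smooth_at_row_mxr.
exact: smooth_at_cst.
Qed.

Lemma smooth_at_partial_r f x y v : smooth_at f (row_mx x y) ->
  smooth_at (fun x' => ddiff (fun y' => f (row_mx x' y')) y v) x.
Proof.
move=> sf; apply: smooth_at_eq (partial_r_near v sf) _.
apply: smooth_at_ddiff2 => //; first exact: smooth_at_row_mxl.
exact: smooth_at_cst.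
Qed.

(** The inner partial derivatives agree near the point with differentials of [f] in the directions
    (v, 0) and (0, w), to which [schwarz] applies. *)
Lemma schwarz_partial f x y v w : smooth_at f (row_mx x y) ->
  ddiff (fun y' => ddiff (fun x' => f (row_mx x' y')) x v) y w =
  ddiff (fun x' => ddiff (fun y' => f (row_mx x' y')) y w) x v.
Proof.
move=> sf.
have sv := smooth_at_diff (smooth_at_ddiff (row_mx v 0) sf).
have sw := smooth_at_diff (smooth_at_ddiff (row_mx 0 w) sf).
have dr := smooth_at_diff (smooth_at_row_mxr x y).
have dl := smooth_at_diff (smooth_at_row_mxl x y).
rewrite (ddiff_near w (partial_l_near v sf) (differentiable_comp dr sv)).
rewrite (ddiff_near v (partial_r_near w sf) (differentiable_comp dl sw)).
rewrite (ddiff_comp w dr sv) (ddiff_comp v dl sw) ddiff_row_mxr ddiff_row_mxl.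
exact: schwarz.
Qed.
End Partials.

Section LinearFamily.
Variables (R : realType).

Lemma ddiff_scale_fun (E : normedModType R) k (s : E -> R) (f : E -> 'rV[R]_k)
    x v : differentiable s x -> differentiable f x ->
  differentiable (fun y => s y *: f y) x /\
  ddiff (fun y => s y *: f y) x v = ddiff s x v *: f x + s x *: ddiff f x v.
Proof.
move=> ds df.
have cE i : (fun y => (s y *: f y) 0 i) = (fun y => s y * f y 0 i).
  by apply/funext => y; rewrite mxE.
have d : differentiable (fun y => s y *: f y) x.
  apply: differentiable_rV => i; rewrite cE.
  by apply: differentiableM => //; have [] := diff_coord i df.
split=> //; apply/rowP => i; have [dfi fiE] := diff_coord i df.
have [_ <-] := diff_coord i d; rewrite cE ddiffM // fiE !mxE.
by rewrite addrC (mulrC (f x 0 i)).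
Qed.

(** A product rule: expanding the first argument in coordinates leaves a finite sum of scalar
    functions times the maps [K (delta_mx 0 j)]. *)
Lemma ddiff_linear_family (E : normedModType R) m k l
    (K : 'rV[R]_m -> 'rV[R]_k -> 'rV[R]_l) (b : E -> 'rV[R]_m)
    (c : E -> 'rV[R]_k) x v :
  (forall y, linear (K ^~ y)) -> (forall u, differentiable (K u) (c x)) ->
  differentiable b x -> differentiable c x ->
  ddiff (fun y => K (b y) (c y)) x v =
  K (ddiff b x v) (c x) + ddiff (K (b x)) (c x) (ddiff c x v).
Proof.
move=> lK dK db dc.
have KE u y : K u y = \sum_(j < m) u 0 j *: K (delta_mx 0 j) y.
  pose lM := GRing.isLinear.Build _ _ _ _ _ (lK y).
  pose lL : {linear 'rV[R]_m -> 'rV[R]_l} := HB.pack (K ^~ y) lM.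
  rewrite -[LHS]/(lL u) [in LHS](row_sum_delta u) linear_sum.
  by apply: eq_bigr => j _; rewrite linearZ.
have dj j : differentiable (fun y => b y 0 j) x by have [] := diff_coord j db.
have dKj j : differentiable (fun y => K (delta_mx 0 j) (c y)) x.
  exact: (differentiable_comp dc (dK _)).
have -> : (fun y => K (b y) (c y)) =
    (fun y => \sum_(j < m) b y 0 j *: K (delta_mx 0 j) (c y)).
  by apply/funext => y; exact: KE.
rewrite ddiff_sum => [|j]; last by have [] := ddiff_scale_fun v (dj j) (dKj j).
rewrite (_ : K (b x) = fun y => \sum_(j < m) b x 0 j *: K (delta_mx 0 j) y).
  rewrite ddiff_sum => [|j]; last exact: differentiableZ.
  rewrite KE -big_split; apply: eq_bigr => j _ /=.
  have [_ ->] := ddiff_scale_fun v (dj j) (dKj j).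
  have [_ ->] := diff_coord j db.
  by rewrite (ddiff_comp v dc (dK _)) ddiffZ.
by apply/funext => y; exact: KE.
Qed.
End LinearFamily.

(** Near [x] the map [F] factors through the chart at [F x], so this is the chain rule. Smoothness
    of [f] is asked at one point in coordinates, which suits translations and conjugations. *)
Lemma velocity_tangent (R : realType) (M N : Type) (k l : nat)
    (A : atlas R M k) (B : atlas R N l) (hA : is_manifold A)
    (hB : is_manifold B) (f : M -> N) (E : normedModType R) (F : E -> M) x v :
  psmooth A F x ->
  psmooth B (fun y => f (chart_inv A (F x) y)) (chart A (F x) (F x)) ->
  velocity B (fun y => f (F y)) x v =
    tangent_map A B f (F x) (velocity A F x v).
Proof.
move=> sF sf; rewrite (tangent_mapE _ hA) /=.
have sp := psmooth_self hA sF.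
rewrite -(velocity_comp hB v sf sp); apply: velocity_near => //.
  apply: filterS (psmooth_dom sF (dom_self hA (F x))) => y xy.
  by rewrite chartK.
exact: (psmooth_comp sf sp).
Qed.

Section LieGroup.
Variables (R : realType) (n : nat) (G : groupType) (A : atlas R G n).
Hypothesis hG : is_lie_group A.

Lemma lie_manifold : is_manifold A. Proof. by case: hG. Qed.
Let hA := lie_manifold.

Local Notation cinv := (chart_inv A).
Local Notation e0 := (chart A 1%g 1%g).

Lemma psmooth_mul (E : normedModType R) (F F' : E -> G) x :
  psmooth A F x -> psmooth A F' x -> psmooth A (fun y => (F y * F' y)%g) x.
Proof.
move=> sF sF'; have [_ sm _] := hG.
exact: (psmooth_map (prod_atlas_manifold hA hA) hA sm (psmooth_pair sF sF')).
Qed.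

Lemma psmooth_inv (E : normedModType R) (F : E -> G) x :
  psmooth A F x -> psmooth A (fun y => (F y)^-1%g) x.
Proof. by move=> sF; have [_ _ si] := hG; exact: (psmooth_map hA hA si). Qed.

Lemma psmooth_cinv (E : normedModType R) p (a : E -> 'rV[R]_n) x :
  chart_im A p (a x) -> smooth_at a x -> psmooth A (fun y => cinv p (a y)) x.
Proof.
by move=> px sa; exact: (psmooth_comp (psmooth_chart_inv hA px) sa).
Qed.

Lemma psmooth_cinv_self p : psmooth A (cinv p) (chart A p p).
Proof. exact/psmooth_chart_inv/chart_im_self. Qed.

Lemma cinv_self p : cinv p (chart A p p) = p.
Proof. exact/chartK/dom_self. Qed.

Lemma velocity_cinv p v : velocity A (cinv p) (chart A p p) v = v.
Proof. by rewrite /velocity cinv_self velocity_chart_inv //;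
  exact: chart_im_self. Qed.

Lemma psmooth_mulr (E : normedModType R) (F : E -> G) g x :
  psmooth A F x -> psmooth A (fun y => (F y * g)%g) x.
Proof. by move=> sF; apply: psmooth_mul => //; exact: psmooth_cst. Qed.

Lemma psmooth_conj (E : normedModType R) (F : E -> G) g x :
  psmooth A F x -> psmooth A (fun y => (g * F y * g^-1)%g) x.
Proof.
move=> sF; apply: psmooth_mulr; apply: psmooth_mul => //; exact: psmooth_cst.
Qed.

Lemma velocity_mulr (E : normedModType R) (F : E -> G) g x v :
  psmooth A F x -> F x = 1%g ->
  velocity A (fun y => (F y * g)%g) x v = TR A g (velocity A F x v).
Proof.
move=> sF F1; rewrite (velocity_tangent hA hA v (f := fun h => (h * g)%g) sF).
  by rewrite F1.
exact/psmooth_mulr/psmooth_cinv_self.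
Qed.

Lemma velocity_conj (E : normedModType R) (F : E -> G) g x v :
  psmooth A F x -> F x = 1%g ->
  velocity A (fun y => (g * F y * g^-1)%g) x v = Ad A g (velocity A F x v).
Proof.
move=> sF F1.
rewrite (velocity_tangent hA hA v (f := fun h => (g * h * g^-1)%g) sF).
  by rewrite F1.
exact/psmooth_conj/psmooth_cinv_self.
Qed.

Lemma AdE g xi :
  Ad A g xi = ddiff (fun x => chart A 1%g (g * cinv 1%g x * g^-1)%g) e0 xi.
Proof.
rewrite -[in LHS](velocity_cinv 1%g xi) -velocity_conj ?cinv_self //;
  last first.
  exact: psmooth_cinv_self.
by rewrite /velocity cinv_self mulg1 mulgV.
Qed.

Lemma TRE g xi : TR A g xi = ddiff (fun x =>
  chart A g (cinv 1%g x * g)%g) e0 xi.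
Proof.
rewrite -[in LHS](velocity_cinv 1%g xi) -velocity_mulr ?cinv_self //;
  last first.
  exact: psmooth_cinv_self.
by rewrite /velocity cinv_self mul1g.
Qed.

Lemma AdD g xi eta : Ad A g (xi + eta) = Ad A g xi + Ad A g eta.
Proof. by rewrite !AdE ddiffvD. Qed.

Lemma AdZ g (a : R) xi : Ad A g (a *: xi) = a *: Ad A g xi.
Proof. by rewrite !AdE ddiffvZ. Qed.

Lemma AdM g h xi : Ad A (g * h)%g xi = Ad A g (Ad A h xi).
Proof.
rewrite -[in RHS](velocity_cinv 1%g xi) -velocity_conj ?cinv_self //;
  last first.
  exact: psmooth_cinv_self.
rewrite -velocity_conj ?cinv_self ?mulg1 ?mulgV //; last first.
  exact/psmooth_conj/psmooth_cinv_self.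
rewrite -[in LHS](velocity_cinv 1%g xi) -velocity_conj ?cinv_self //;
  last first.
  exact: psmooth_cinv_self.
by congr velocity; apply/funext => y; rewrite invgM !mulgA.
Qed.

Lemma Ad1 xi : Ad A 1%g xi = xi.
Proof.
rewrite AdE (_ : (fun x => _) = (fun x => chart A 1%g (cinv 1%g x))).
  by rewrite velocity_chart_inv //; exact: chart_im_self.
by apply/funext => x; rewrite mul1g invg1 mulg1.
Qed.

(* The right-invariant vector field generated by xi, in the chart at p. *)
Definition rfield p (xi y : 'rV[R]_n) : 'rV[R]_n :=
  ddiff (fun x => chart A p (cinv 1%g x * cinv p y)%g) e0 xi.

(* The inverse of rfield p ^~ y. *)
Definition rfield_inv p (v y : 'rV[R]_n) : 'rV[R]_n :=
  ddiff (fun x => chart A 1%g (cinv p x * (cinv p y)^-1)%g) y v.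

Lemma rfield_linear p y : linear (rfield p ^~ y).
Proof. by move=> a u v; rewrite /rfield ddiffvD ddiffvZ. Qed.

Lemma rfield_self p xi : rfield p xi (chart A p p) = TR A p xi.
Proof. by rewrite /rfield cinv_self TRE. Qed.

Lemma rfieldE p xi y : chart_im A p y -> rfield p xi y =
  ddiff (fun x => chart A p (cinv (cinv p y) x))
    (chart A (cinv p y) (cinv p y)) (TR A (cinv p y) xi).
Proof.
move=> py; have s1 := @psmooth_cinv_self 1%g.
rewrite -[in RHS](velocity_cinv 1%g xi) -velocity_mulr ?cinv_self //.
rewrite /rfield (velocity_chart hA) ?cinv_self ?mul1g //.
  exact: psmooth_mulr.
exact: dom_chart_inv.
Qed.

(** Any parametrization through the identity with the right velocity computes the field;
    [rfield_structure] uses a conjugated one. *)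
Lemma rfield_velocity p (E : normedModType R) (F : E -> G) x v y :
  psmooth A F x -> F x = 1%g -> chart_im A p y ->
  ddiff (fun z => chart A p (F z * cinv p y)%g) x v =
    rfield p (velocity A F x v) y.
Proof.
move=> sF F1 py.
rewrite (velocity_chart hA v (psmooth_mulr (g := cinv p y) sF)) F1 mul1g.
  by rewrite velocity_mulr // -rfieldE.
exact: dom_chart_inv.
Qed.

(** Right translations by g and g^-1 are mutually inverse, and the chain rule carries this over to
    their derivatives. *)
Lemma rfield_invK p xi y : chart_im A p y -> rfield_inv p (rfield p xi y) y = xi.
Proof.
move=> py; set g := cinv p y.
have s1 : psmooth A (fun x => (cinv 1%g x * g)%g) e0.
  exact/psmooth_mulr/psmooth_cinv_self.
have g1 : (cinv 1%g e0 * g)%g = g by rewrite cinv_self mul1g.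
have pg : dom A p (cinv 1%g e0 * g)%g by rewrite g1; exact: dom_chart_inv.
have s2 : smooth_at (fun x => chart A 1%g (cinv p x * g^-1)%g) y.
  apply: psmooth_chart; last by rewrite mulgV; exact: dom_self.
  exact/psmooth_mulr/psmooth_chart_inv.
have yE : y = chart A p (cinv 1%g e0 * g)%g by rewrite g1 chart_invK.
have d1 := smooth_at_diff (psmooth_chart s1 pg).
rewrite /rfield_inv -/g /rfield -/g yE.
have d2 := smooth_at_diff s2; rewrite yE in d2.
rewrite -(ddiff_comp xi d1 d2).
rewrite -[RHS](velocity_chart_inv hA xi (chart_im_self hA 1%g)).
apply: ddiff_near.
  apply: filterS (psmooth_dom s1 pg) => x px.
  by rewrite chartK // mulgK.
apply: smooth_at_diff; apply: transition_smooth => //.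
  exact: chart_im_self.
by rewrite cinv_self; exact: dom_self.
Qed.

Lemma rfieldK p v y : chart_im A p y -> rfield p (rfield_inv p v y) y = v.
Proof.
move=> py; set g := cinv p y.
have s1 : psmooth A (fun x => (cinv p x * g^-1)%g) y.
  exact/psmooth_mulr/psmooth_chart_inv.
rewrite (_ : rfield_inv p v y = velocity A (fun x => (cinv p x * g^-1)%g) y v).
  rewrite -rfield_velocity ?mulgV // -[RHS](velocity_chart_inv hA v py).
  by congr ddiff; apply/funext => x; rewrite mulgVK.
by rewrite /velocity mulgV.
Qed.

Lemma smooth_at_rfield p xi y : chart_im A p y -> smooth_at (rfield p xi) y.
Proof.
move=> py; rewrite /rfield.
pose f z := chart A p (cinv 1%g (lsubmx z) * cinv p (@rsubmx R 1 n n z))%g.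
have -> : (fun y => ddiff (fun x =>
  chart A p (cinv 1%g x * cinv p y)%g) e0 xi) =
    (fun y => ddiff (fun x => f (row_mx x y)) e0 xi).
  apply/funext => y'; congr ddiff; apply/funext => x.
  by rewrite /f row_mxKl row_mxKr.
apply: smooth_at_partial_l; apply: psmooth_chart; last first.
  by rewrite row_mxKl row_mxKr cinv_self mul1g; exact: dom_chart_inv.
apply: psmooth_mul; apply: psmooth_cinv.
- by rewrite row_mxKl; exact: chart_im_self.
- exact/smooth_at_lsubmx/smooth_at_id.
- by rewrite row_mxKr.
- exact/smooth_at_rsubmx/smooth_at_id.
Qed.

(** The point [y] is both where the derivative is taken and a parameter, so the value is the
    derivative of a two-variable map on the diagonal, in the direction (v, 0). *)
Lemma smooth_at_rfield_inv p v y : chart_im A p y -> smooth_at (rfield_inv p v) y.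
Proof.
move=> py; rewrite /rfield_inv.
pose f z := chart A 1%g (cinv p (lsubmx z) * (cinv p (@rsubmx R 1 n n z))^-1)%g.
have sf y' : chart_im A p y' -> smooth_at f (row_mx y' y').
  move=> py'; apply: psmooth_chart; last first.
    by rewrite row_mxKl row_mxKr mulgV; exact: dom_self.
  apply: psmooth_mul; last apply: psmooth_inv; apply: psmooth_cinv.
  - by rewrite row_mxKl.
  - exact/smooth_at_lsubmx/smooth_at_id.
  - by rewrite row_mxKr.
  - exact/smooth_at_rsubmx/smooth_at_id.
apply: (@smooth_at_eq _ _ _ (fun y => ddiff f (row_mx y y) (row_mx v 0))).
  apply: filterS (chart_im_near hA py) => y' py'.
  rewrite -ddiff_partial_l; last exact/smooth_at_diff/sf.
  by congr ddiff; apply/funext => x; rewrite /f row_mxKl row_mxKr.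
apply: smooth_at_ddiff2; [exact: sf| |exact: smooth_at_cst].
by apply: smooth_at_row_mx; exact: smooth_at_id.
Qed.

(* The Lie bracket as the differential of g |-> Ad g eta at the identity: unlike
   ad, this does not refer to the exponential.  They agree by adE. *)
Definition bracket (xi eta : 'rV[R]_n) : 'rV[R]_n :=
  ddiff (fun x => Ad A (cinv 1%g x) eta) e0 xi.

Lemma smooth_at_Ad eta : smooth_at (fun x => Ad A (cinv 1%g x) eta) e0.
Proof.
under eq_fun do rewrite AdE.
pose f z := chart A 1%g (cinv 1%g (lsubmx z) * cinv 1%g (@rsubmx R 1 n n z) *
  (cinv 1%g (lsubmx z))^-1)%g.
have -> : (fun x => ddiff (fun y => chart A 1%g
    (cinv 1%g x * cinv 1%g y * (cinv 1%g x)^-1)%g) e0 eta) =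
    (fun x => ddiff (fun y => f (row_mx x y)) e0 eta).
  apply/funext => x; congr ddiff; apply/funext => y.
  by rewrite /f row_mxKl row_mxKr.
apply: smooth_at_partial_r; apply: psmooth_chart; last first.
  by rewrite row_mxKl row_mxKr cinv_self mulg1 mulgV; exact: dom_self.
have s1 : psmooth A (fun z => cinv 1%g (@lsubmx R 1 n n z)) (row_mx e0 e0).
  apply: psmooth_cinv; last exact/smooth_at_lsubmx/smooth_at_id.
  by rewrite row_mxKl; exact: chart_im_self.
apply: psmooth_mul; last exact: psmooth_inv.
apply: psmooth_mul => //; apply: psmooth_cinv.
  by rewrite row_mxKr; exact: chart_im_self.
exact/smooth_at_rsubmx/smooth_at_id.
Qed.

Lemma bracketDr xi eta zeta :
  bracket xi (eta + zeta) = bracket xi eta + bracket xi zeta.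
Proof.
rewrite /bracket -ddiffD; try exact/smooth_at_diff/smooth_at_Ad.
by congr ddiff; apply/funext => x; rewrite AdD.
Qed.

Lemma bracketZr xi (a : R) eta : bracket xi (a *: eta) = a *: bracket xi eta.
Proof.
rewrite /bracket -ddiffZ; last exact/smooth_at_diff/smooth_at_Ad.
by congr ddiff; apply/funext => x; rewrite AdZ.
Qed.

Lemma bracketDl xi eta zeta :
  bracket (xi + eta) zeta = bracket xi zeta + bracket eta zeta.
Proof. exact: ddiffvD. Qed.

Lemma bracketZl xi (a : R) eta : bracket (a *: xi) eta = a *: bracket xi eta.
Proof. exact: ddiffvZ. Qed.

Lemma ddiff_Ad (E : normedModType R) (F : E -> G) x v eta :
  psmooth A F x -> F x = 1%g ->
  differentiable (fun y => Ad A (F y) eta) x /\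
  ddiff (fun y => Ad A (F y) eta) x v = bracket (velocity A F x v) eta.
Proof.
move=> sF F1; have sc := psmooth_self hA sF; rewrite F1 in sc.
have dc := smooth_at_diff sc.
have nF : {near x, (fun y => Ad A (cinv 1%g (chart A 1%g (F y))) eta) =1
    (fun y => Ad A (F y) eta)}.
  have := psmooth_dom sF (dom_self hA (F x)); rewrite F1.
  by apply: filterS => y Fy; rewrite chartK.
have dA : differentiable (fun x => Ad A (cinv 1%g x) eta) (chart A 1%g (F x)).
  by rewrite F1; exact/smooth_at_diff/smooth_at_Ad.
have dd := differentiable_comp dc dA.
split; first by have [] := near_differentiable nF dd.
by rewrite (ddiff_near v nF dd) (ddiff_comp v dc dA) /velocity F1.
Qed.

(* [X_xi, X_eta] = - X_[xi, eta] for the right-invariant fields: both sides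
   compute the mixed second derivative of exp(s xi) exp(t eta) g, written on
   the right-hand side as (Ad_exp(s xi) exp(t eta)) exp(s xi) g. *)
Lemma rfield_structure g xi eta :
  ddiff (rfield g xi) (chart A g g) (TR A g eta) =
  TR A g (bracket xi eta) + ddiff (rfield g eta) (chart A g g) (TR A g xi).
Proof.
pose f z := chart A g (cinv 1%g (lsubmx z) * (cinv 1%g (@rsubmx R 1 n n z) *
  g))%g.
have sf : smooth_at f (row_mx e0 e0).
  apply: psmooth_chart; last first.
    by rewrite row_mxKl row_mxKr !cinv_self !mul1g; exact: dom_self.
  apply: psmooth_mul; last apply: psmooth_mulr; apply: psmooth_cinv.
  - by rewrite row_mxKl; exact: chart_im_self.
  - exact/smooth_at_lsubmx/smooth_at_id.
  - by rewrite row_mxKr; exact: chart_im_self.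
  - exact/smooth_at_rsubmx/smooth_at_id.
have fE x y : f (row_mx x y) = chart A g (cinv 1%g x * (cinv 1%g y * g))%g.
  by rewrite /f row_mxKl row_mxKr.
pose c x := chart A g (cinv 1%g x * g)%g.
have pc : psmooth A (fun x => (cinv 1%g x * g)%g) e0.
  exact/psmooth_mulr/psmooth_cinv_self.
have dg : dom A g (cinv 1%g e0 * g)%g by rewrite cinv_self mul1g;
  exact: dom_self.
have sc : smooth_at c e0 := psmooth_chart pc dg.
have cE : c e0 = chart A g g by rewrite /c cinv_self mul1g.
have nc : \forall x \near e0, dom A g (cinv 1%g x * g)%g := psmooth_dom pc dg.
have dr u : differentiable (rfield g u) (c e0).
  by rewrite cE; apply/smooth_at_diff/smooth_at_rfield/chart_im_self.
have L : ddiff (fun y => ddiff (fun x => f (row_mx x y)) e0 xi) e0 eta =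
    ddiff (rfield g xi) (chart A g g) (TR A g eta).
  rewrite TRE -cE -(ddiff_comp eta (smooth_at_diff sc) (dr xi)).
  apply: ddiff_near; last exact: (differentiable_comp (smooth_at_diff sc) (dr
    xi)).
  apply: filterS nc => y gy; rewrite /rfield /c chartK //.
  by congr ddiff; apply/funext => x; rewrite fE.
rewrite -L (schwarz_partial _ _ sf).
have sA := smooth_at_diff (smooth_at_Ad eta).
(* Product rule for the field generated by Ad_h eta, taken at h g: the moving generator gives the
   bracket, the moving point the second derivative. *)
have dE : ddiff (fun x => rfield g (Ad A (cinv 1%g x) eta) (c x)) e0 xi =
    rfield g (bracket xi eta) (c e0) +
    ddiff (rfield g (Ad A (cinv 1%g e0) eta)) (c e0) (ddiff c e0 xi).
  exact: (ddiff_linear_family xi (rfield_linear g) dr sA (smooth_at_diff sc)).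
rewrite cE rfield_self cinv_self Ad1 -[ddiff c e0 xi]TRE in dE.
rewrite -dE; apply/esym/ddiff_near.
  apply: filterS nc => x gx; set h := cinv 1%g x.
  have cx : chart_im A g (c x) by exact: chart_im_chart.
  have s1 := @psmooth_cinv_self 1%g.
  rewrite -[in RHS](velocity_cinv 1%g eta) -velocity_conj ?cinv_self //.
  rewrite -rfield_velocity //; first last.
  - by rewrite cinv_self mulg1 mulgV.
  - exact: psmooth_conj.
  congr ddiff; apply/funext => y.
  by rewrite fE /c chartK // !mulgA mulgVK.
exact: (smooth_at_diff (smooth_at_partial_r eta sf)).
Qed.

(** The structure equation at the identity and its copy with [xi] and [eta] exchanged show that the
    field generated by [xi, eta] + [eta, xi] vanishes there, and a right-invariant field determines
    its generator. *)
Lemma bracketC xi eta : bracket xi eta = - bracket eta xi.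
Proof.
have e1 := chart_im_self hA 1%g.
have E1 := rfield_structure 1%g xi eta; have E2 := rfield_structure 1%g eta xi.
apply/eqP; rewrite -addr_eq0 -[_ + _](rfield_invK _ e1).
have -> : rfield 1%g (bracket xi eta + bracket eta xi) e0 = 0.
  rewrite -[bracket xi eta]scale1r rfield_linear scale1r !rfield_self.
  by apply: (addIr (ddiff (rfield 1%g eta) e0 (TR A 1%g xi)));
    rewrite add0r addrAC -E1 addrC -E2.
by rewrite /rfield_inv ddiffv0.
Qed.

(** Differentiate Ad_g Ad_h eta = Ad_(g h g^-1) Ad_g eta in h at the identity. *)
Lemma Ad_bracket g xi eta : Ad A g (bracket xi eta) =
  bracket (Ad A g xi) (Ad A g eta).
Proof.
have s1 := @psmooth_cinv_self 1%g.
have lAd : linear (Ad A g) by move=> a u v; rewrite AdD AdZ.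
have sA := smooth_at_diff (smooth_at_Ad eta).
rewrite -(ddiff_comp_linear xi lAd sA).
have [|_ E] := ddiff_Ad xi (Ad A g eta) (psmooth_conj (g := g) s1).
  by rewrite cinv_self mulg1 mulgV.
rewrite velocity_conj ?cinv_self // velocity_cinv in E.
have fE : (fun x => Ad A g (Ad A (cinv 1%g x) eta)) =
    fun x => Ad A (g * cinv 1%g x * g^-1)%g (Ad A g eta).
  by apply/funext => x; rewrite -AdM -[RHS]AdM mulgVK.
exact: (etrans (congr1 (fun F => ddiff F e0 xi) fE) E).
Qed.

(** Differentiate Ad_h [eta, zeta] = [Ad_h eta, Ad_h zeta] in h at the identity. *)
Lemma bracket_jacobi xi eta zeta : bracket xi (bracket eta zeta) =
  bracket (bracket xi eta) zeta + bracket eta (bracket xi zeta).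
Proof.
have lb u : linear (bracket u) by move=> a v w; rewrite bracketDr bracketZr.
have lb' v : linear (bracket ^~ v) by move=> a u w; rewrite bracketDl bracketZl.
have sA u := smooth_at_diff (smooth_at_Ad u).
have := ddiff_linear_family xi lb' (fun u => differentiable_linear_rV _ (lb u))
  (sA eta) (sA zeta).
rewrite cinv_self !Ad1 (ddiff_linear_rV zeta _ (lb eta)) => dE.
have fE : (fun x => Ad A (cinv 1%g x) (bracket eta zeta)) =
    fun x => bracket (Ad A (cinv 1%g x) eta) (Ad A (cinv 1%g x) zeta).
  by apply/funext => x; rewrite -Ad_bracket.
exact: (etrans (congr1 (fun F => ddiff F e0 xi) fE) dE).
Qed.

End LieGroup.

(** * One-parameter subgroups *)

Section RowNorm.
Variables (R : realType) (m : nat).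
Implicit Type v : 'rV[R]_m.

Lemma rV_norm_coord v i : `|v 0 i| <= `|v|.
Proof.
rewrite [in leRHS]/Num.norm /= mx_normrE.
exact: (le_bigmax _ (fun ij => `|v ij.1 ij.2|) (0, i)).
Qed.

Lemma rV_norm_le v (c : R) : 0 <= c -> (forall i, `|v 0 i| <= c) -> `|v| <= c.
Proof.
move=> c0 vc; rewrite /Num.norm /= mx_normrE;
  apply: bigmax_le => // -[i j] _ /=.
by rewrite ord1.
Qed.
End RowNorm.

Section QuadraticEstimate.
Variables (R : realType).

Lemma differentiable_lipschitz_at (V W : normedModType R) (f : V -> W) x :
  differentiable f x -> exists2 L : R, 0 < L &
    \forall h \near 0, `|f (h + x) - f x| <= L * `|h|.
Proof.
move=> df; have [k k0 kE] := linear_lipschitz (diff_continuous df).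
exists (k + 1); first by rewrite addr_gt0.
apply: filterS (diff_eps df ltr01) => h hE.
rewrite -(subrK ('d f x h) (f (h + x) - f x)).
apply: le_trans (ler_normD _ _) _; rewrite addrC mulrDl; exact: lerD.
Qed.

(** By the mean value theorem each coordinate of the difference is one of (Df(y) - Df(x0)) (u - v),
    with y within max(|u|, |v|) of [x0]; Df, being differentiable at [x0], obeys a linear bound
    there. *)
Lemma quadratic_estimate m k (f : 'rV[R]_m -> 'rV[R]_k) x0 : smooth_at f x0 ->
  exists r C : R, [/\ 0 < r, 0 < C & forall u v, `|u| < r -> `|v| < r ->
    `|f (u + x0) - f (v + x0) - ddiff f x0 (u - v)|
      <= C * Num.max `|u| `|v| * `|u - v|].
Proof.
move=> sf.
have sp j := smooth_at_diff (smooth_at_ddiff (delta_mx 0 j) sf).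
have [L LP] := choice (fun j => let: ex_intro2 L L0 LP :=
  differentiable_lipschitz_at (sp j) in ex_intro _ L (conj L0 LP)).
(* The bounds of the partial derivatives add up over the basis; the summand 1 keeps [C] positive
   also for m = 0. *)
pose C := 1 + \sum_(j < m) L j.
have C0 : 0 < C by rewrite ltr_pwDl // sumr_ge0 // => j _; have [/ltW] := LP j.
have nL j := (LP j).2.
have nS : \forall h \near (0 : 'rV[R]_m), smooth_at f (h + x0).
  have := smooth_at_near sf; rewrite (near_shift 0 x0) /=.
  by apply: filterS => h; rewrite subr0.
have : \forall h \near (0 : 'rV[R]_m), smooth_at f (h + x0) /\ forall j,
    `|ddiff f (h + x0) (delta_mx 0 j) - ddiff f x0 (delta_mx 0 j)| <= L j *
      `|h|.
  exact: filterI nS (filter_forall _ nL).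
move=> /nbhs_ballP[r /= r0 rP].
exists r, C; split=> // u v ur vr.
have bound h w : `|h| < r -> `|ddiff f (h + x0) w - ddiff f x0 w| <= C * `|h| *
  `|w|.
  move=> hr; have /rP[_ hP] : ball 0 r h by rewrite -ball_normE /= sub0r normrN.
  rewrite {1 2}(row_sum_delta w) !ddiffv_sum -sumrB.
  apply: le_trans (ler_norm_sum _ _ _) _.
  apply: le_trans (_ : \sum_(j < m) L j * `|h| * `|w| <= _).
    apply: ler_sum => j _; rewrite !ddiffvZ -scalerBr normrZ mulrC.
    by apply: ler_pM => //; exact: rV_norm_coord.
  rewrite -!mulr_suml -!mulrA ler_wpM2r ?mulr_ge0 //.
  by rewrite lerDr.
have seg (t : R) : 0 <= t <= 1 -> `|v + t *: (u - v)| <= Num.max `|u| `|v|.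
  move=> /andP[t0 t1].
  have -> : v + t *: (u - v) = (1 - t) *: v + t *: u.
    by rewrite scalerBr scalerBl scale1r addrA addrAC.
  apply: le_trans (ler_normD _ _) _; rewrite !normrZ !ger0_norm ?subr_ge0 //.
  have uM : `|u| <= Num.max `|u| `|v| by rewrite le_max lexx.
  have vM : `|v| <= Num.max `|u| `|v| by rewrite le_max lexx orbT.
  have t1' : 0 <= 1 - t by rewrite subr_ge0.
  apply: le_trans (lerD (ler_wpM2l t1' vM) (ler_wpM2l t0 uM)) _.
  by rewrite -mulrDl subrK mul1r.
apply: rV_norm_le => [|i].
  by rewrite !mulr_ge0 ?(ltW C0) // le_max normr_ge0.
have sfi t : 0 <= t <= 1 -> smooth_at f (v + x0 + t *: (u - v)).
  move=> t01; rewrite addrAC.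
  have /rP[] // : ball 0 r (v + t *: (u - v)).
  rewrite -ball_normE /= sub0r normrN; apply: le_lt_trans (seg t t01) _.
  by rewrite gt_max ur vr.
have [t t01|t t01] := @segment_MVT R _ (fun y => f y 0 i) (v + x0) (u - v).
  by have [] := diff_coord i (smooth_at_diff (sfi t t01)).
have [_ ->] := diff_coord i (smooth_at_diff (sfi t t01)).
rewrite (addrAC v) (addrC v) subrK => E.
rewrite !mxE E; have := bound (v + t *: (u - v)) (u - v).
rewrite addrAC => bE.
have -> : ddiff f (v + x0 + t *: (u - v)) (u - v) 0 i - ddiff f x0 (u - v) 0 i =
  (ddiff f (v + x0 + t *: (u - v)) (u - v) - ddiff f x0 (u - v)) 0 i by
    rewrite !mxE.
apply: le_trans (rV_norm_coord _ _) _; apply: le_trans (bE _) _.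
  by apply: le_lt_trans (seg t t01) _; rewrite gt_max ur vr.
by rewrite ler_wpM2r // ler_wpM2l ?(ltW C0) // seg.
Qed.
End QuadraticEstimate.

Section Halving.
Variable R : realType.

Lemma halving_small (s t : R) : 0 < t -> exists k, `|s| / 2 ^+ k < t.
Proof.
move=> t0; exists (Num.bound (`|s| / t)).
rewrite ltr_pdivrMr ?exprn_gt0 // mulrC -ltr_pdivrMr //.
exact: upper_nthrootP.
Qed.

(* The weight 1 + 2 C |s| absorbs the factors 1 + C |s| / 2 of the iteration. *)
Lemma halving_zero (d : R -> R) (C : R) : 0 < C ->
  (\forall s \near 0, 0 <= d s <= (2 + C * `|s|) * d (s / 2)) ->
  (forall e, 0 < e -> \forall s \near 0, d s <= e * `|s|) ->
  \forall s \near 0, d s = 0.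
Proof.
move=> C0 /nbhs_ballP[r0 /= r00 dP] dO.
(* The bound [C^-1] gives C |s| <= 1, so the weight is at most 3, whence the 3 in [e']. *)
pose r := Num.min r0 C^-1.
have rpos : 0 < r by rewrite lt_min r00 invr_gt0.
have inr s : `|s| < r -> 0 <= d s <= (2 + C * `|s|) * d (s / 2).
  move=> sr; apply: dP; rewrite -ball_normE /= sub0r normrN.
  by apply: lt_le_trans sr _; rewrite ge_min lexx.
apply/nbhs_ballP; exists r => // s; rewrite -ball_normE /= sub0r normrN => sr.
apply/eqP; rewrite eq_le; have /andP[-> _] := inr s sr; rewrite andbT.
apply/ler_addgt0Pr => e e0; rewrite add0r.
pose e' := e / (3 * r).
have e'0 : 0 < e' by rewrite divr_gt0 // mulr_gt0.
have /nbhs_ballP[t /= t0 tP] := dO e' e'0.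
have claim k : forall s, `|s| < r -> `|s| / 2 ^+ k < t ->
    d s <= e' * `|s| * (1 + 2 * C * `|s|).
  elim: k => [|k IH] {sr}s sr sk.
    have : d s <= e' * `|s|.
      apply: tP; rewrite -ball_normE /= sub0r normrN;
        by rewrite expr0 divr1 in sk.
    move/le_trans; apply; rewrite -[leLHS]mulr1 ler_wpM2l //.
      by rewrite mulr_ge0 // ltW.
    by rewrite lerDl !mulr_ge0 // ltW.
  have s2 : `|s / 2| = `|s| / 2 by rewrite normrM [`|2^-1|]ger0_norm.
  have s2r : `|s / 2| < r.
    by rewrite s2; apply: le_lt_trans sr;
      rewrite ler_pdivrMr // ler_peMr // ler1n.
  have := IH (s / 2) s2r; rewrite s2 -mulrA -invfM -exprS => /(_ sk) H.
  have /andP[_ /le_trans] := inr s sr; apply.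
  have s0 := normr_ge0 s; set a := `|s| in s0 H sr *.
  have Cs : C * a <= 1.
    rewrite -(divff (lt0r_neq0 C0)) ler_wpM2l ?(ltW C0) // ltW //.
    by apply: lt_le_trans sr _; rewrite ge_min lexx orbT.
  apply: le_trans (ler_wpM2l _ H) _;
    first by rewrite addr_ge0 // mulr_ge0 // ltW.
  have : 0 <= C * a by rewrite mulr_ge0 // ltW.
  move: Cs; set b := C * a => b1 b0.
  have -> : (2 + b) * (e' * (a / 2) * (1 + 2 * C * (a / 2))) =
    (e' * a) * ((1 + b / 2) * (1 + b)) by rewrite /b; field.
  have -> : 2 * C * a = 2 * b by rewrite /b mulrA.
  have e'a : 0 <= e' * a := mulr_ge0 (ltW e'0) s0.
  apply: (ler_wpM2l e'a).
  (* The induction step needs (1 + b/2)(1 + b) <= 1 + 2b, which amounts to b^2 <= b and holds for 0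
     <= b <= 1. *)
  have : b * b <= b by rewrite ler_piMr.
  by rewrite (_ : (1 + b / 2) * (1 + b) = 1 + b + b / 2 + b * b / 2);
    [lra|ring].
have [k sk] := halving_small s t0.
apply: le_trans (claim k s sr sk) _.
have s0 := normr_ge0 s; set a := `|s| in s0 sr *.
have Cs : C * a <= 1.
  rewrite -(divff (lt0r_neq0 C0)) ler_wpM2l ?(ltW C0) // ltW //.
  by apply: lt_le_trans sr _; rewrite ge_min lexx orbT.
apply: le_trans (_ : e' * a * 3 <= _).
  have e'a : 0 <= e' * a := mulr_ge0 (ltW e'0) s0.
  by apply: (ler_wpM2l e'a); rewrite -mulrA; lra.
have -> : e' * a * 3 = e * (a / r) by rewrite /e'; field; rewrite gt_eqF.
by rewrite ler_piMr ?(ltW e0) // ler_pdivrMr // mul1r ltW.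
Qed.
End Halving.

Section GeometricLimit.
Variables (R : realType) (m : nat).

Lemma geometric_cvg_scalar (u : nat -> R) (a q : R) : 0 <= a -> 0 <= q < 1 ->
  (forall k, `|u k.+1 - u k| <= a * q ^+ k) -> cvgn u.
Proof.
move=> a0 /andP[q0 q1] uP.
have : cvgn (series (telescope u)).
  apply: normed_cvg; apply: (@series_le_cvg _ _ (geometric a q)).
  - by move=> k; exact: normr_ge0.
  - by move=> k; rewrite /= mulr_ge0 // exprn_ge0.
  - by move=> k; exact: uP.
  - by apply: is_cvg_geometric_series; rewrite ger0_norm.
move=> cs; rewrite (_ : u = (fun k => u 0%N + series (telescope u) k)).
  by apply: is_cvgD => //; exact: is_cvg_cst.
by apply/funext => k; exact: eq_sum_telescope.
Qed.

Lemma geometric_cvg (u : nat -> 'rV[R]_m) (a q : R) : 0 <= a -> 0 <= q < 1 ->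
  (forall k, `|u k.+1 - u k| <= a * q ^+ k) -> cvgn u.
Proof.
move=> a0 q01 uP.
have cu i : cvgn (fun k => u k 0 i).
  apply: (geometric_cvg_scalar a0 q01) => k.
  by apply: le_trans (uP k); have := rV_norm_coord (u k.+1 - u k) i;
    rewrite !mxE.
apply/cvg_ex; exists (\row_i limn (fun k => u k 0 i)).
apply/cvgrPdist_le => e e0.
have ne i : \forall k \near \oo, `|limn (fun k => u k 0 i) - u k 0 i| <= e.
  by have /cvgrPdist_le/(_ _ e0) := cu i.
apply: filterS (filter_forall _ ne) => k ke.
by apply: rV_norm_le (ltW e0) _ => i; rewrite !mxE.
Qed.

Lemma limn_dist_le (u : nat -> 'rV[R]_m) v c : cvgn u ->
  (forall k, `|u k - v| <= c) -> `|limn u - v| <= c.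
Proof.
move=> cu uP; have cd : `|u k - v| @[k --> \oo] --> `|limn u - v|.
  by apply: cvg_norm; apply: cvgB => //; exact: cvg_cst.
by rewrite -(cvg_lim _ cd) //; apply: limr_le; [exact: cvgP cd|exact: nearW].
Qed.
End GeometricLimit.

Section HalvingCurve.
Variables (R : realType) (m : nat) (sq : 'rV[R]_m -> 'rV[R]_m) (r C : R).
Hypotheses (r0 : 0 < r) (C0 : 0 < C) (sq0 : sq 0 = 0).
Hypothesis sqP : forall u v, `|u| < r -> `|v| < r ->
  `|sq u - sq v - (u - v) *+ 2| <= C * Num.max `|u| `|v| * `|u - v|.

(* u is the limit of t |-> sq^k (2^-k t xi). *)
Lemma halving_curve_exists (xi : 'rV[R]_m) :
  exists (d B : R) (u : R -> 'rV[R]_m), 0 < d /\ forall t, `|t| <= d ->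
    [/\ `|u t| < r, `|u t - t *: xi| <= B * t ^+ 2 & u t = sq (u (t / 2))].
Proof.
(* [sq] sends t xi / 2 to t xi up to C |t xi / 2|^2 = B t^2 / 4. As [sq] is 3-Lipschitz on the ball
   of radius [rho], the bound B t^2 survives iteration: 3 (t/2)^2 + t^2/4 = t^2. *)
pose B := C * `|xi| ^+ 2; have B0 : 0 <= B by
  rewrite mulr_ge0 ?exprn_ge0 // ltW.
(* [C^-1] makes [sq] 3-Lipschitz on this ball (2 from the linear part, at most 1 from C rho);
   [r / 2] keeps it strictly inside radius [r]. *)
pose rho := Num.min (r / 2) C^-1.
have rho0 : 0 < rho by rewrite lt_min divr_gt0 // invr_gt0.
(* With d <= 1 the term B d^2 is at most B d, so d |xi| + B d^2 <= rho. *)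
pose d := Num.min 1 (rho / (`|xi| + B + 1)).
have D0 : 0 < `|xi| + B + 1 by rewrite ltr_wpDl // addr_ge0.
have d0 : 0 < d by rewrite lt_min ltr01 divr_gt0.
have d1 : d <= 1 by rewrite ge_min lexx.
have dB : d * `|xi| + B * d ^+ 2 <= rho.
  apply: le_trans (_ : d * (`|xi| + B + 1) <= _); last first.
    by rewrite -ler_pdivlMr // ge_min lexx orbT.
  rewrite !mulrDr mulr1 -addrA lerD2l expr2 mulrA mulrC -[leLHS]addr0.
  by rewrite lerD ?(ltW d0) // ler_wpM2l ?(ltW d0) // ler_piMr.
have small t v : `|t| <= d -> `|v - t *: xi| <= B * t ^+ 2 -> `|v| <= rho.
  move=> td vt; rewrite -(subrK (t *: xi) v).
  apply: le_trans (ler_normD _ _) _; apply: le_trans _ dB.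
  rewrite addrC lerD //; first by rewrite normrZ ler_wpM2r.
  apply: le_trans vt _; rewrite ler_wpM2l // -[t ^+ 2]ger0_norm ?sqr_ge0 //.
  by rewrite normrX lerXn2r // ?nnegrE // ltW.
have rhor : rho < r.
  by apply: le_lt_trans (_ : r / 2 < r);
    rewrite ?ge_min ?lexx // ltr_pdivrMr // ltr_pMr // ltr1n.
have Crho : C * rho <= 1.
  by rewrite -(divff (lt0r_neq0 C0)) ler_wpM2l ?(ltW C0) // ge_min lexx orbT.
have half t : `|t| <= d -> `|t / 2| <= d.
  move=> td; rewrite normrM [`|2^-1|]ger0_norm //; apply: le_trans td.
  by rewrite ler_pdivrMr // ler_peMr // ler1n.
have sq3 v w : `|v| <= rho -> `|w| <= rho -> `|sq v - sq w| <= 3 * `|v - w|.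
  move=> vr wr; rewrite -(subrK ((v - w) *+ 2) (sq v - sq w)).
  apply: le_trans (ler_normD _ _) _.
  have -> : 3 * `|v - w| = `|v - w| + `|v - w| *+ 2 by rewrite -mulr_natl; ring.
  rewrite lerD ?normrMn //.
  apply: le_trans (sqP (le_lt_trans vr rhor) (le_lt_trans wr rhor)) _.
  rewrite -[leRHS]mul1r ler_wpM2r //; apply: le_trans Crho.
  by rewrite ler_wpM2l ?(ltW C0) // ge_max vr wr.
have lin t : `|t| <= d -> `|t *: xi| <= rho.
  move=> td; apply: (small t) => //.
  by rewrite subrr normr0 mulr_ge0 // sqr_ge0.
have sqlin t : `|t| <= d -> `|sq ((t / 2) *: xi) - t *: xi| <= B * t ^+ 2 / 4.
  move=> td; have l0 := lin _ (half t td).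
  have := sqP (le_lt_trans l0 rhor) (_ : `|0| < r); rewrite normr0 => /(_ r0).
  rewrite sq0 !subr0 scalerMnl -[t / 2 *+ 2]mulr_natr divfK // max_l // =>
    /le_trans; apply.
  rewrite -mulrA normrZ -expr2 exprMn -normrX ger0_norm ?sqr_ge0 //.
  by rewrite le_eqVlt /B; apply/orP; left; apply/eqP; field.
pose fix u (k : nat) (t : R) {struct k} :=
  if k is j.+1 then sq (u j (t / 2)) else t *: xi.
have uB k : forall t, `|t| <= d -> `|u k t - t *: xi| <= B * t ^+ 2.
  elim: k => [|k IH] t td /=.
    by rewrite subrr normr0 mulr_ge0 // sqr_ge0.
  rewrite -(subrK (sq ((t / 2) *: xi)) (sq _)) -addrA.
  apply: le_trans (ler_normD _ _) _.
  have t2 := half t td; have uk := IH _ t2.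
  apply: le_trans (lerD (sq3 _ _ (small _ _ t2 uk) (lin _ t2)) (sqlin t td)) _.
  apply: le_trans (lerD (ler_wpM2l _ uk) (lexx _)) _ => //.
  by rewrite le_eqVlt; apply/orP; left; apply/eqP; field.
have urho k t : `|t| <= d -> `|u k t| <= rho.
  by move=> td; apply: (small t) => //; exact: uB.
(* The ratio 3/4 is the Lipschitz constant 3 times the factor (1/2)^2 gained by a quadratic bound at
   t/2. *)
have ustep k : forall t, `|t| <= d ->
    `|u k.+1 t - u k t| <= B * t ^+ 2 * (3 / 4) ^+ k.
  elim: k => [|k IH] t td.
    rewrite expr0 mulr1 /=; apply: le_trans (sqlin t td) _.
    have Bt : 0 <= B * t ^+ 2 := mulr_ge0 B0 (sqr_ge0 t).
    by rewrite ler_pdivrMr // ler_peMr // ler1n.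
  have t2 := half t td.
  apply: le_trans (sq3 (u k.+1 (t / 2)) (u k (t / 2)) (urho _ _ t2) (urho _ _
    t2)) _.
  apply: le_trans (ler_wpM2l _ (IH _ t2)) _ => //.
  rewrite (exprS (3 / 4) k) le_eqVlt; apply/orP; left; apply/eqP.
  by move: (_ ^+ k) => q; field.
have ucvg t : `|t| <= d -> cvgn (u ^~ t).
  move=> td; apply: (@geometric_cvg _ _ _ (B * t ^+ 2) (3 / 4)).
  - by rewrite mulr_ge0 // sqr_ge0.
  - by rewrite divr_ge0 //= ltr_pdivrMr // mul1r ltr_nat.
  - by move=> k; exact: ustep.
exists d, B, (fun t => limn (u ^~ t)); split=> // t td.
have lB s : `|s| <= d -> `|limn (u ^~ s) - s *: xi| <= B * s ^+ 2.
  by move=> sd; apply: limn_dist_le; [exact: ucvg|move=> k; exact: uB].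
have t2 := half t td.
have l2 := small _ _ t2 (lB _ t2).
split; [exact: le_lt_trans (small _ _ td (lB _ td)) rhor|exact: lB|].
(* The shifted sequence is sq applied to the sequence at t/2, and the Lipschitz bound lets [sq] pass
   to the limit. *)
apply: cvg_lim => //; rewrite -(cvg_shiftS (u ^~ t)) /=.
apply/cvgrPdist_le => e e0.
have e3 : 0 < e / 3 by rewrite divr_gt0.
have /cvgrPdist_le/(_ _ e3) := ucvg _ t2.
apply: filterS => k uk; apply: le_trans (sq3 _ _ l2 (urho _ _ t2)) _.
by rewrite mulrC -ler_pdivlMr.
Qed.
End HalvingCurve.

Lemma is_derive_row_mx (R : realType) n m (f : R -> 'rV[R]_n) (g : R ->
  'rV[R]_m)
    (t : R) u w :
  is_derive t 1 (fun s => row_mx (f s) (g s)) (row_mx u w) <->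
  is_derive t 1 f u /\ is_derive t 1 g w.
Proof.
split=> [/is_derive_diff[d dE]|[/is_derive_diff[df dfE] /is_derive_diff[dg
  dgE]]].
  have [df dg] := differentiable_row_mxP d.
  by move: dE; rewrite ddiff_row_mx // => /eq_row_mx[fE gE];
    split; exact/is_derive_diff.
apply/is_derive_diff; split; first exact: differentiable_row_mx.
by rewrite ddiff_row_mx // dfE dgE.
Qed.

Lemma is_derive_near (R : realType) (W : normedModType R) (f g : R ->
  W) (t : R) w :
  {near t, f =1 g} -> is_derive t 1 f w -> is_derive t 1 g w.
Proof.
move=> fg /is_derive_diff[df fE]; apply/is_derive_diff.
by rewrite (ddiff_near (1 : R) fg df); split=> //;
  have [] := near_differentiable fg df.
Qed.

Lemma is_derive_littleo (R : realType) (W : normedModType R) (f : R ->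
  W) (w : W) :
  is_derive (0 : R) 1 f w -> forall e : R, 0 < e ->
  \forall t \near (0 : R), `|f t - f 0 - t *: w| <= e * `|t|.
Proof.
move=> /is_derive_diff[df fE] e e0; apply: filterS (diff_eps df e0) => t.
by rewrite addr0 -fE ddiffE -ddiffvZ [t *: _]mulr1.
Qed.

Lemma near_half (R : realType) (P : set R) :
  (\forall t \near (0 : R), P t) -> \forall t \near (0 : R), P (t / 2).
Proof.
move=> /nbhs_ballP[r /= r0 rP]; apply/nbhs_ballP; exists r => // t.
rewrite -ball_normE /= sub0r normrN => tr; apply: rP.
rewrite -ball_normE /= sub0r normrN normrM [`|2^-1|]ger0_norm //.
by apply: le_lt_trans tr; rewrite ler_pdivrMr // ler_peMr // ler1n.
Qed.

(** * Curves through the identity and uniqueness under the halving equation *)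

Section OneParameter.
Variables (R : realType) (n : nat) (G : groupType) (A : atlas R G n).
Hypothesis hG : is_lie_group A.
Let hA := lie_manifold hG.

Local Notation cinv := (chart_inv A).
Local Notation e0 := (chart A 1%g 1%g).

Lemma psmooth_mul_charts : psmooth A
  (fun z => (cinv 1%g (@lsubmx R 1 n n z) * cinv 1%g (rsubmx z))%g) (row_mx e0
    e0).
Proof.
apply: (psmooth_mul hG); apply: (psmooth_cinv hG).
- by rewrite row_mxKl; exact: chart_im_self.
- exact/smooth_at_lsubmx/smooth_at_id.
- by rewrite row_mxKr; exact: chart_im_self.
- exact/smooth_at_rsubmx/smooth_at_id.
Qed.

(** With the other factor at 1, multiplication is the identity in each factor, so its derivative at
    (e, e) is addition. *)
Lemma velocity_mul_charts u v : velocity A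
  (fun z => (cinv 1%g (@lsubmx R 1 n n z) * cinv 1%g (rsubmx z))%g)
  (row_mx e0 e0) (row_mx u v) = u + v.
Proof.
have c1 := cinv_self hG 1%g; have i1 := chart_im_self hA 1%g.
rewrite /velocity row_mxKl row_mxKr c1 mulg1.
set f := fun z => chart A 1%g _.
have sf : differentiable f (row_mx e0 e0).
  apply/smooth_at_diff/(psmooth_chart psmooth_mul_charts).
  by rewrite row_mxKl row_mxKr c1 mulg1; exact: dom_self.
have -> : row_mx u v = row_mx u 0 + row_mx 0 v by
  rewrite add_row_mx addr0 add0r.
rewrite ddiffvD -ddiff_partial_l // -ddiff_partial_r //; congr (_ + _).
  rewrite -[RHS](velocity_chart_inv hA u i1); congr ddiff; apply/funext => x.
  by rewrite /f row_mxKl row_mxKr c1 mulg1.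
rewrite -[RHS](velocity_chart_inv hA v i1); congr ddiff; apply/funext => x.
by rewrite /f row_mxKl row_mxKr c1 mul1g.
Qed.

Lemma psmooth_inv_chart : psmooth A (fun x => (cinv 1%g x)^-1%g) e0.
Proof. exact/(psmooth_inv hG)/psmooth_cinv_self. Qed.

(** Differentiate x x^-1 = e. *)
Lemma velocity_inv_chart v : velocity A (fun x => (cinv 1%g x)^-1%g) e0 v = - v.
Proof.
have c1 := cinv_self hG 1%g; have i1 := chart_im_self hA 1%g.
have si := psmooth_inv_chart.
have d1 : dom A 1%g (cinv 1%g e0)^-1%g by rewrite c1 invg1; exact: dom_self.
have sc := psmooth_chart si d1.
pose m z := (cinv 1%g (@lsubmx R 1 n n z) * cinv 1%g (rsubmx z))%g.
pose a x := row_mx x (chart A 1%g (cinv 1%g x)^-1%g).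
have sa : smooth_at a e0 by apply: smooth_at_row_mx => //; exact: smooth_at_id.
have aE : a e0 = row_mx e0 e0 by rewrite /a c1 invg1.
have sm : psmooth A m (a e0) by rewrite aE; exact: psmooth_mul_charts.
have := velocity_comp hA v sm sa.
have -> : velocity A (fun x => m (a x)) e0 v = 0.
  rewrite -[RHS](ddiff_cst (chart A 1%g 1%g) e0 v).
  rewrite /velocity; have -> : m (a e0) = 1%g.
    by rewrite /m /a row_mxKl row_mxKr c1 invg1 c1 mulg1.
  apply: ddiff_near; last exact: differentiable_cst.
  have nd := psmooth_dom si d1.
  apply: filterS nd => x dx.
  by rewrite /m /a row_mxKl row_mxKr (chartK hA dx) mulgV.
rewrite ddiff_row_mx; [|exact: differentiable_linear_rV|exact: smooth_at_diff].
rewrite ddiff_linear_rV // aE velocity_mul_charts.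
have -> : velocity A (fun x => (cinv 1%g x)^-1%g) e0 v =
    ddiff (fun x => chart A 1%g (cinv 1%g x)^-1%g) e0 v.
  by rewrite /velocity c1 invg1.
by move/esym/eqP; rewrite addrC addr_eq0 => /eqP.
Qed.

(** The chart is fixed as the one at 1, whereas [has_velocity] indexes it by [c 0], which would
    obstruct rewriting. *)
Definition curve1 (c : R -> G) (xi : 'rV[R]_n) : Prop :=
  [/\ c 0 = 1%g, \forall t \near (0 : R), dom A 1%g (c t) &
      is_derive (0 : R) 1 (fun t => chart A 1%g (c t)) xi].

Lemma curve1_has_velocity c xi :
  curve1 c xi <-> c 0 = 1%g /\ has_velocity A c 0 xi.
Proof.
split=> [[c0 nc dc]|[c0 [nc dc]]]; first by split=> //; split; rewrite c0.
by move: nc dc; rewrite c0.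
Qed.

Lemma curve1_near c c' xi : {near 0, c =1 c'} -> curve1 c xi -> curve1 c' xi.
Proof.
move=> cc' [c0 nc dc]; split; first by rewrite -(nbhs_singleton cc').
  by apply: filterS2 cc' nc => t ->.
by apply: is_derive_near dc; apply: filterS cc' => t ->.
Qed.

Lemma curve1_psmooth m (F : 'rV[R]_m -> G) (a : R -> 'rV[R]_m) w :
  psmooth A F (a 0) -> F (a 0) = 1%g -> is_derive (0 : R) 1 a w ->
  curve1 (fun t => F (a t)) (velocity A F (a 0) w).
Proof.
move=> sF F1 da; have [da' _] := (is_derive_diff a 0 w).1 da.
split=> //.
  apply: (differentiable_near (P := fun y => dom A 1%g (F y)) da').
  by apply: psmooth_dom => //; rewrite F1; exact: dom_self.
rewrite /velocity F1.
apply: (is_derive_comp (f := fun y => chart A 1%g (F y)) da).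
by apply: smooth_at_diff; apply: psmooth_chart => //; rewrite F1;
  exact: dom_self.
Qed.

Lemma curve1_chart c xi : curve1 c xi ->
  {near 0, (fun t => cinv 1%g (chart A 1%g (c t))) =1 c}.
Proof. by move=> [_ nc _]; apply: filterS nc => t; exact: chartK. Qed.

Lemma curve1_map (f : G -> G) c xi : curve1 c xi -> f 1%g = 1%g ->
  psmooth A (fun x => f (cinv 1%g x)) e0 ->
  curve1 (fun t => f (c t)) (velocity A (fun x => f (cinv 1%g x)) e0 xi).
Proof.
move=> cc f1 sf; have [c0 nc dc] := cc.
have := @curve1_psmooth _ (fun x => f (cinv 1%g x)) (fun t =>
  chart A 1%g (c t)) xi.
rewrite c0 cinv_self // => /(_ sf f1 dc); apply: curve1_near.
by apply: filterS (curve1_chart cc) => t ->.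
Qed.

Lemma curve1_inv c xi : curve1 c xi -> curve1 (fun t => (c t)^-1%g) (- xi).
Proof.
move=> cc; rewrite -velocity_inv_chart;
  apply: (curve1_map (f := fun g => g^-1%g)) cc _ _.
  exact: invg1.
exact: psmooth_inv_chart.
Qed.

Lemma curve1_conj g c xi : curve1 c xi ->
  curve1 (fun t => (g * c t * g^-1)%g) (Ad A g xi).
Proof.
move=> cc; have s1 := @psmooth_cinv_self _ _ _ _ hG 1%g.
have := curve1_map (f := fun h => (g * h * g^-1)%g) cc _ (psmooth_conj hG s1).
rewrite (velocity_conj hG) ?cinv_self // velocity_cinv //.
by apply; rewrite mulg1 mulgV.
Qed.

Lemma curve1_mul c c' xi xi' : curve1 c xi -> curve1 c' xi' ->
  curve1 (fun t => (c t * c' t)%g) (xi + xi').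
Proof.
move=> cc cc'; have [c0 nc dc] := cc; have [c0' nc' dc'] := cc'.
have := @curve1_psmooth _
  (fun z => (cinv 1%g (@lsubmx R 1 n n z) * cinv 1%g (rsubmx z))%g)
  (fun t => row_mx (chart A 1%g (c t)) (chart A 1%g (c' t))) (row_mx xi xi').
rewrite c0 c0' velocity_mul_charts => /(_ psmooth_mul_charts) H.
apply: curve1_near (H _ _).
- apply: filterS2 (curve1_chart cc) (curve1_chart cc') => t.
  by rewrite row_mxKl row_mxKr => -> ->.
- by rewrite row_mxKl row_mxKr cinv_self // mulg1.
- exact/is_derive_row_mx.
Qed.

Lemma curve1_scale c xi (a : R) : curve1 c xi ->
  curve1 (fun t => c (t * a)) (a *: xi).
Proof.
move=> [c0 nc dc].
have da : is_derive (0 : R) 1 (fun t : R => t * a) a.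
  rewrite (_ : (fun t : R => t * a) = fun t => 0 + t *: a).
    exact: is_derive_line.
  by apply/funext => t; rewrite add0r.
have [da' _] := (is_derive_diff (fun t : R => t * a) 0 a).1 da.
have n0 (P : set R) : (\forall t \near (0 : R), P t) ->
    \forall t \near (0 : R), P (t * a).
  by move=> nP; apply: (differentiable_near (P := P) da'); rewrite mul0r.
split; first by rewrite mul0r.
  exact: (n0 (fun t => dom A 1%g (c t)) nc).
have [dc' cE] := (is_derive_diff (fun t => chart A 1%g (c t)) 0 xi).1 dc.
have := is_derive_comp (f := fun t => chart A 1%g (c t)) da.
rewrite mul0r => /(_ dc').
by rewrite -cE -ddiffvZ [a *: _]mulr1.
Qed.

Lemma is_derive_Ad c xi eta : curve1 c xi ->
  is_derive (0 : R) 1 (fun t => Ad A (c t) eta) (bracket A xi eta).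
Proof.
move=> cc; have [c0 nc dc] := cc.
have := is_derive_comp (f := fun x => Ad A (cinv 1%g x) eta) dc.
rewrite c0 => /(_ (smooth_at_diff (smooth_at_Ad hG eta)));
  apply: is_derive_near.
by apply: filterS (curve1_chart cc) => t ->.
Qed.

(** Passes to limits of repeated squarings, conjugates and rescalings; with a velocity at 0 it
    yields the homomorphism property ([dyadic_hom]). *)
Definition dyadic (c : R -> G) := forall t, c t = (c (t / 2)%R * c (t / 2)%R)%g.

Lemma dyadic_pow c k t : dyadic c -> c t = (c (t / 2 ^+ k)%R ^+ (2 ^ k))%g.
Proof.
move=> dc; elim: k => [|k ->]; first by rewrite expr0 divr1 expg1.
by rewrite dc -expg2 -expgnA -expnS exprSr invfM mulrA.
Qed.

(** c(t) is a power of c(t / 2^k), so the germ at 0 determines the curve. *)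
Lemma dyadic_near_eq c c' : dyadic c -> dyadic c' -> {near 0, c =1 c'} ->
  forall t, c t = c' t.
Proof.
move=> dc dc' /nbhs_ballP[r /= r0 cc'] t.
have [k tk] := halving_small t r0.
rewrite (dyadic_pow k t dc) (dyadic_pow k t dc') cc' //.
by rewrite -ball_normE /= sub0r normrN normrM normfV [`|2 ^+ k|]ger0_norm //
  exprn_ge0.
Qed.

Let sq x := chart A 1%g (cinv 1%g x * cinv 1%g x)%g.

Lemma smooth_at_sq : smooth_at sq e0.
Proof.
have s1 := @psmooth_cinv_self _ _ _ _ hG 1%g.
apply: (psmooth_chart (psmooth_mul hG s1 s1)).
by rewrite cinv_self // mulg1; exact: dom_self.
Qed.

(** Squaring is multiplication on the diagonal, and the differential of multiplication is
    addition. *)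
Lemma ddiff_sq v : ddiff sq e0 v = v *+ 2.
Proof.
have c1 := cinv_self hG 1%g.
pose a (x : 'rV[R]_n) := row_mx x x.
have sa : smooth_at a e0 by apply: smooth_at_row_mx; exact: smooth_at_id.
have := velocity_comp (a := a) hA v psmooth_mul_charts sa.
rewrite ddiff_row_mx; try exact: differentiable_linear_rV.
rewrite ddiff_linear_rV // velocity_mul_charts mulr2n => <-.
rewrite /velocity row_mxKl c1 row_mxKr c1 mulg1; congr ddiff.
by apply/funext => x; rewrite /a row_mxKl row_mxKr.
Qed.

Lemma dyadic_unique c c' xi : dyadic c -> dyadic c' ->
  curve1 c xi -> curve1 c' xi -> forall t, c t = c' t.
Proof.
move=> dc dc' cc cc'; apply: dyadic_near_eq => //.
have [c0 nc hc] := cc; have [c0' nc' hc'] := cc'.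
have [r [C [r0 C0 qP]]] := quadratic_estimate smooth_at_sq.
pose x t := chart A 1%g (c t); pose x' t := chart A 1%g (c' t).
have x0 : x 0 = e0 by rewrite /x c0.
have x0' : x' 0 = e0 by rewrite /x' c0'.
have [dx _] := (is_derive_diff x 0 xi).1 hc.
have [dx' _] := (is_derive_diff x' 0 xi).1 hc'.
have [L L0 LP] := differentiable_lipschitz_at dx.
have [L' L0' LP'] := differentiable_lipschitz_at dx'.
have small y : differentiable y (0 : R) -> y 0 = e0 ->
    \forall t \near (0 : R), `|y t - e0| < r.
  move=> dy y0; apply: (differentiable_near (P := fun z => `|z - e0| < r) dy).
  rewrite y0; apply/nbhs_ballP; exists r => // z.
  by rewrite -ball_normE /= distrC.
(* The curves stay within L |t| and L' |t| of the identity in the chart, so the maximum in the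
   quadratic estimate is at most (L + L') |t|. *)
pose M := C * (L + L'); have M0 : 0 < M by rewrite mulr_gt0 // addr_gt0.
have W : \forall t \near (0 : R), `|x t - x' t| = 0.
  apply: (@halving_zero _ (fun t => `|x t - x' t|) M M0).
    have nP : \forall t \near (0 : R), [/\ dom A 1%g (c t), `|x t - e0| < r &
        `|x t - e0| <= L * `|t|].
      by apply: filterS3 nc (small _ dx x0) LP => t; rewrite addr0 x0; split.
    have nP' : \forall t \near (0 : R), [/\ dom A 1%g (c' t), `|x' t - e0| < r &
        `|x' t - e0| <= L' * `|t|].
      by apply: filterS3 nc' (small _ dx' x0') LP' => t; rewrite addr0 x0';
        split.
    apply: filterS2 (near_half nP) (near_half nP') =>
      t [c2 xr xL] [c2' xr' xL'].
    rewrite normr_ge0 /=.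
    have := qP _ _ xr xr'; rewrite !subrK opprB addrA subrK ddiff_sq.
    rewrite /sq /x /x' !chartK // -dc -dc' -/(x t) -/(x' t) => H.
    rewrite -(subrK ((x (t / 2) - x' (t / 2)) *+ 2) (x t - x' t)).
    apply: le_trans (ler_normD _ _) _; rewrite addrC mulrDl; apply: lerD.
      by rewrite normrMn -[leLHS]mulr_natl.
    apply: le_trans H _; rewrite ler_wpM2r // /M -mulrA ler_wpM2l ?(ltW C0) //.
    have tt : `|t / 2| <= `|t|.
      rewrite normrM [`|2^-1|]ger0_norm // ler_pdivrMr // ler_peMr //.
      by rewrite ler1n.
    rewrite ge_max mulrDl; apply/andP; split.
      apply: le_trans xL _; rewrite -[leLHS]addr0 lerD //.
        by rewrite ler_wpM2l // ltW.
      by rewrite mulr_ge0 // ltW.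
    apply: le_trans xL' _; rewrite -[leLHS]add0r lerD //.
      by rewrite mulr_ge0 // ltW.
    by rewrite ler_wpM2l // ltW.
  (* Equal velocities at 0 make the difference of the curves o(t). *)
  move=> e e0'; have e2 : 0 < e / 2 by rewrite divr_gt0.
  have H1 := is_derive_littleo hc e2; have H2 := is_derive_littleo hc' e2.
  apply: filterS2 H1 H2 => t; rewrite -/(x t) -/(x' t) -/(x 0) -/(x' 0) x0 x0'.
  move=> h1 h2; rewrite (splitr e) mulrDl.
  have -> : x t - x' t = (x t - e0 - t *: xi) - (x' t - e0 - t *: xi).
    by apply/rowP => i; rewrite !mxE; ring.
  by apply: le_trans (ler_normB _ _) _; exact: lerD.
apply: filterS2 W (filterI nc nc') => t /eqP;
  rewrite normr_eq0 subr_eq0 => /eqP xx'.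
by move=> [ct ct']; rewrite -(chartK hA ct) -(chartK hA ct') -/(x t) xx'.
Qed.

End OneParameter.

(** * Existence of one-parameter subgroups, the exponential, and [ad] as the bracket *)

Section Exponential.
Variables (R : realType) (n : nat) (G : groupType) (A : atlas R G n).
Hypothesis hG : is_lie_group A.
Let hA := lie_manifold hG.

Implicit Type c : R -> G.

Local Notation cinv := (chart_inv A).
Local Notation e0 := (chart A 1%g 1%g).

(** Take c(t) = g(t / 2^k)^(2^k) for any k with |t| / 2^k <= d; the halving equation of [g] makes
    this independent of k. *)
Lemma dyadic_extend (g : R -> G) (d : R) : 0 < d ->
  (forall t, `|t| <= d -> g t = (g (t / 2)%R * g (t / 2)%R)%g) ->
  exists2 c, dyadic c & forall t, `|t| <= d -> c t = g t.
Proof.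
move=> d0 gP; pose P k t := (g (t / 2 ^+ k)%R ^+ (2 ^ k))%g.
have absP k (t : R) : `|t / 2 ^+ k| = `|t| / 2 ^+ k.
  by rewrite normrM normfV [`|2 ^+ k|]ger0_norm // exprn_ge0.
have PS k t : `|t| / 2 ^+ k <= d -> P k.+1 t = P k t.
  move=> tk; rewrite /P expnS expgnA expg2 exprSr invfM mulrA -gP // absP.
  exact: tk.
have Pj k j t : `|t| / 2 ^+ k <= d -> P (j + k)%N t = P k t.
  move=> tk; elim: j => [//|j <-]; rewrite addSn PS //.
  apply: le_trans tk; rewrite ler_wpM2l // lef_pV2 ?posrE ?exprn_gt0 //.
  by rewrite ler_eXn2l ?ltr1n // leq_addl.
have KP t := halving_small t d0.
have [K KE] := choice KP.
have PK k t : `|t| / 2 ^+ k <= d -> P (K t) t = P k t.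
  by move=> tk; rewrite -(Pj (K t) k) ?(ltW (KE t)) // addnC Pj.
exists (fun t => P (K t) t) => [t|t td]; last first.
  by rewrite (PK 0%N) /P expr0 divr1 ?expg1.
(* Level k is admissible for t/2 and level k + 1 for t, so both values are powers of the same
   element. *)
pose k := (K t + K (t / 2)%R)%N.
have tk : `|t| / 2 ^+ k.+1 <= d.
  apply: le_trans (ltW (KE t)); rewrite ler_wpM2l // lef_pV2 ?posrE ?exprn_gt0
    //.
  by rewrite ler_eXn2l ?ltr1n // -addnS leq_addr.
have t2k : `|t / 2| / 2 ^+ k <= d.
  by have := absP 1%N t; rewrite expr1 => ->; rewrite -mulrA -invfM -exprS.
rewrite (PK _ _ tk) (PK _ _ t2k) /P expnS mulnC expgnA expg2.
by rewrite exprS invfM mulrA.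
Qed.

Lemma dyadic_exists xi : exists2 c : R -> G, dyadic c & curve1 A c xi.
Proof.
have c1 := cinv_self hG 1%g; have i1 := chart_im_self hA 1%g.
pose sq x := chart A 1%g (cinv 1%g x * cinv 1%g x)%g.
have [r [C [r0 C0 qP]]] := quadratic_estimate (smooth_at_sq hG).
have s1 := @psmooth_cinv_self _ _ _ _ hG 1%g.
have d1 : dom A 1%g (cinv 1%g e0 * cinv 1%g e0)%g.
  by rewrite c1 mulg1; exact: dom_self.
have : \forall x \near e0, dom A 1%g (cinv 1%g x * cinv 1%g x)%g /\ chart_im A
  1%g x.
  exact: filterI (psmooth_dom (psmooth_mul hG s1 s1) d1) (chart_im_near hA i1).
rewrite (near_shift 0 e0) => /nbhs_ballP[r' /= r0' rP].
(* The quadratic estimate holds within [r]; within [r'] the point and its square lie in the chart at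
   1. *)
pose r2 := Num.min r r'.
have r20 : 0 < r2 by rewrite lt_min r0.
pose sq' u := sq (u + e0) - e0.
have sq0 : sq' 0 = 0 by rewrite /sq' /sq add0r c1 mulg1 subrr.
have sqP u v : `|u| < r2 -> `|v| < r2 ->
    `|sq' u - sq' v - (u - v) *+ 2| <= C * Num.max `|u| `|v| * `|u - v|.
  rewrite !lt_min => /andP[ur _] /andP[vr _].
  by rewrite /sq' opprB addrA subrK -(ddiff_sq hG); exact: qP.
have [d [B [u [d0 uP]]]] := halving_curve_exists r20 C0 sq0 sqP xi.
have uin t : `|t| <= d -> dom A 1%g (cinv 1%g (u t + e0) * cinv 1%g (u t +
  e0))%g /\
    chart_im A 1%g (u t + e0).
  move=> td; have [+ _ _] := uP t td; rewrite lt_min => /andP[_ ur].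
  have := rP (u t); rewrite /= subr0; apply.
  by rewrite -ball_normE /= sub0r normrN.
have half t : `|t| <= d -> `|t / 2| <= d.
  move=> td; rewrite normrM [`|2^-1|]ger0_norm //; apply: le_trans td.
  by rewrite ler_pdivrMr // ler_peMr // ler1n.
have [|c dc cE] := @dyadic_extend (fun t => cinv 1%g (u t + e0)) d d0.
  move=> t td; have [_ _ ->] := uP t td; rewrite subrK.
  by rewrite chartK //; have [] := uin _ (half t td).
exists c => //.
have nd : \forall t \near (0 : R), `|t| <= d.
  apply/nbhs_ballP; exists d => // t; rewrite -ball_normE /= sub0r normrN.
  exact: ltW.
have z0 : `|0 : R| <= d by rewrite normr0 ltW.
have u0 : u 0 = 0.
  have [_ + _] := uP 0 z0; rewrite scale0r subr0 expr0n mulr0 normr_le0.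
  by move/eqP.
split.
- by rewrite cE // u0 add0r.
- apply: filterS nd => t td; rewrite cE //; apply: (dom_chart_inv hA).
  by have [] := uin t td.
apply: (@is_derive_near _ _ (fun t => u t + e0)).
  apply: filterS nd => t td; rewrite cE // chart_invK //.
  by have [] := uin t td.
have du : is_derive (0 : R) 1 u xi.
  have [L LE] : exists L : {linear R -> 'rV[R]_n}, (L : R ->
    'rV[R]_n) = (fun t => t *: xi).
    have ll : linear (fun t : R => t *: xi).
      by move=> a s t; rewrite scalerDl scalerA.
    pose lM := GRing.isLinear.Build _ _ _ _ _ ll.
    pose lL : {linear R -> 'rV[R]_n} := HB.pack (fun t : R => t *: xi) lM.
    by exists lL.
  have cL : continuous L by rewrite LE; exact: scalel_continuous.
  have [|du dE] := @diff_epsP _ _ _ u (0 : R) L cL.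
    (* The quadratic bound comes without a sign for [B]; if B <= 0 it forces u t = t xi. *)
    move=> e e0'; have [B0|B0] := leP B 0.
      apply: filterS nd => t td; rewrite addr0 u0 subr0 LE.
      have [_ /le_trans + _] := uP t td; apply.
      apply: (@le_trans _ _ 0); last by rewrite mulr_ge0 // ltW.
      by rewrite mulr_le0_ge0 // sqr_ge0.
    have nB : \forall t \near (0 : R), `|t| <= e / B.
      apply/nbhs_ballP; exists (e / B); first by rewrite /= divr_gt0.
      by move=> t; rewrite -ball_normE /= sub0r normrN => /ltW.
    apply: filterS2 nd nB => t td tB; rewrite addr0 u0 subr0 LE.
    have [_ /le_trans + _] := uP t td; apply.
    rewrite -[t ^+ 2]ger0_norm ?sqr_ge0 // normrX expr2 mulrA ler_wpM2r //.
    by rewrite mulrC -ler_pdivlMr.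
  apply/is_derive_diff; split=> //.
  by rewrite -ddiffE dE LE scale1r.
have := is_deriveD du (is_derive_cst e0 (0 : R) 1); rewrite addr0; exact.
Qed.

Lemma dyadic_conj c g : dyadic c -> dyadic (fun t => (g * c t * g^-1)%g).
Proof. by move=> dc t; rewrite {1}dc !mulgA mulgVK. Qed.

Lemma dyadic_scale c (a : R) : dyadic c -> dyadic (fun t => c (t * a)).
Proof. by move=> dc t; rewrite {1}dc mulrAC. Qed.

(** Ad_c(t) is the identity up to O(t), uniformly in [v]: each of the finitely many basis vectors
    gives a curve differentiable at 0. *)
Lemma Ad_bound c xi : curve1 A c xi -> exists2 C : R, 0 < C &
  \forall t \near (0 : R), forall v, `|Ad A (c t) v| <= (1 + C * `|t|) * `|v|.
Proof.
move=> cc; have [c0 _ _] := cc.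
have dA j := proj1 ((is_derive_diff _ _ _).1 (is_derive_Ad hG (delta_mx 0 j)
  cc)).
have [L LP] := choice (fun j => let: ex_intro2 L L0 LP :=
  differentiable_lipschitz_at (dA j) in ex_intro _ L (conj L0 LP)).
have nL j := (LP j).2.
exists (1 + \sum_(j < n) L j).
  by rewrite ltr_pwDl // sumr_ge0 // => j _; have [/ltW] := LP j.
apply: filterS (filter_forall _ nL) => t tL v.
rewrite -(subrK v (Ad A (c t) v)); apply: le_trans (ler_normD _ _) _.
rewrite mulrDl mul1r addrC lerD2l.
have lAd : linear (Ad A (c t)) by move=> a u w; rewrite AdD // AdZ.
pose lM := GRing.isLinear.Build _ _ _ _ _ lAd.
pose lL : {linear 'rV[R]_n -> 'rV[R]_n} := HB.pack (Ad A (c t)) lM.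
have -> : Ad A (c t) v - v =
    \sum_(j < n) v 0 j *: (Ad A (c t) (delta_mx 0 j) - delta_mx 0 j).
  rewrite -[Ad A (c t) v]/(lL v) {1 2}(row_sum_delta v) linear_sum -sumrB.
  by apply: eq_bigr => j _; rewrite linearZ scalerBr.
apply: le_trans (ler_norm_sum _ _ _) _.
apply: le_trans (_ : \sum_(j < n) L j * `|t| * `|v| <= _).
  apply: ler_sum => j _; rewrite normrZ mulrC; apply: ler_pM => //.
    by have := tL j; rewrite addr0 c0 Ad1.
  exact: rV_norm_coord.
rewrite -!mulr_suml -!mulrA ler_wpM2r ?mulr_ge0 //.
by rewrite lerDr.
Qed.

Lemma dyadic_Ad_fixed c xi s : dyadic c -> curve1 A c xi -> Ad A (c s) xi = xi.
Proof.
move=> dc cc; have [c0 nc _] := cc.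
have [C C0 CP] := Ad_bound cc.
have AdB g v w : Ad A g (v - w) = Ad A g v - Ad A g w.
  by rewrite AdD // -scaleN1r AdZ // scaleN1r.
(* For w(t) = Ad_c(t) xi - xi this reads w(t) = Ad_c(t/2) w(t/2) + w(t/2), and [Ad_bound] turns it
   into the estimate of [halving_zero]. *)
have half t : Ad A (c t) xi - xi = Ad A (c (t / 2)) (Ad A (c (t / 2)) xi - xi) +
    (Ad A (c (t / 2)) xi - xi).
  by rewrite {1}dc AdM // AdB addrA subrK.
have bxx : bracket A xi xi = 0.
  have := bracketC hG xi xi => /eqP;
    rewrite -addr_eq0 -mulr2n -scaler_nat scaler_eq0 pnatr_eq0.
  by move/eqP.
have step (t : R) : (forall v, `|Ad A (c (t / 2)) v| <= (1 + C * `|t / 2|) *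
  `|v|) ->
    `|Ad A (c t) xi - xi| <= (2 + C * `|t|) * `|Ad A (c (t / 2)) xi - xi|.
  move=> tC; rewrite [in leLHS](half t); set w := (X in _ <= _ * `|X|).
  apply: le_trans (ler_normD _ _) _.
  apply: le_trans (lerD (tC w) (lexx _)) _.
  rewrite -[X in _ + X]mul1r -mulrDl ler_wpM2r // addrAC lerD2l.
  rewrite ler_wpM2l ?(ltW C0) // normrM [`|2^-1|]ger0_norm //.
  by rewrite ler_pdivrMr // ler_peMr // ler1n.
have : \forall t \near (0 : R), `|Ad A (c t) xi - xi| = 0.
  apply: (@halving_zero _ (fun t => `|Ad A (c t) xi - xi|) C C0).
    by apply: filterS (near_half CP) => t tC; apply/andP; split;
      [exact: normr_ge0|exact: step].
  move=> e e0'; have := is_derive_littleo (is_derive_Ad hG xi cc) e0'.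
  by apply: filterS => t; rewrite bxx scaler0 subr0 c0 Ad1.
move=> /nbhs_ballP[d /= d0 dP].
(* From a neighbourhood of 0 to all s: c(s) is a power of c(s / 2^k). *)
have [k sk] := halving_small s d0.
have fixd t : `|t| < d -> Ad A (c t) xi = xi.
  move=> td; apply/eqP; rewrite -subr_eq0 -normr_eq0; apply/eqP/dP.
  by rewrite -ball_normE /= sub0r normrN.
rewrite (dyadic_pow k s dc); elim: (2 ^ k)%N => [|j IH]; first by rewrite Ad1.
rewrite expgS AdM // IH fixd // normrM normfV [`|2 ^+ k|]ger0_norm //.
Qed.

Lemma dyadic_hom c xi : dyadic c -> curve1 A c xi ->
  forall s t, c (s + t) = (c s * c t)%g.
Proof.
move=> dc cc s t.
have comm a b : (c a * c b = c b * c a)%g.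
  (* Conjugation by c(a) fixes the velocity [xi], so by uniqueness it fixes the curve. *)
  have := curve1_conj hG (c a) cc; rewrite (dyadic_Ad_fixed a dc cc) => cc'.
  have E := dyadic_unique hG (dyadic_conj (c a) dc) dc cc' cc b.
  by rewrite -[in RHS]E mulgVK.
have d2 : dyadic (fun r => (c (r * s)%R * c (r * t)%R)%g).
  move=> r; rewrite {1}(dyadic_scale s dc r) {1}(dyadic_scale t dc r) /=.
  by rewrite !mulgA; congr (_ * _)%g; rewrite -!mulgA; congr (_ * _)%g;
    exact: comm.
have v2 := curve1_mul hG (curve1_scale s cc) (curve1_scale t cc).
rewrite -scalerDl in v2.
have := dyadic_unique hG (dyadic_scale (s + t) dc) d2 (curve1_scale (s + t) cc)
  v2 1.
by rewrite !mul1r.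
Qed.

Lemma hom_dyadic c : (forall s t : R, c (s + t) = (c s * c t)%g) -> dyadic c.
Proof. by move=> ch t; rewrite -ch -splitr. Qed.

Lemma one_parameter_subgroupP xi c :
  one_parameter_subgroup A xi c <-> dyadic c /\ curve1 A c xi.
Proof.
split=> [[ch vc]|[dc cc]].
  split; first exact: hom_dyadic.
  apply/curve1_has_velocity; split=> //.
  by apply: (@mulgI _ (c 0)); rewrite -ch addr0 mulg1.
split; first exact: dyadic_hom cc.
by have /curve1_has_velocity[] := cc.
Qed.

(** [lie_exp] is a choice: the rescaled curve s |-> c(s t) shows that there is something to choose,
    and uniqueness that every choice ends at c(t). *)
Lemma lie_exp_curve xi c : dyadic c -> curve1 A c xi ->
  forall t, lie_exp A (t *: xi) = c t.
Proof.
move=> dc cc t; rewrite /lie_exp.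
case: xgetP => [g _ [c' /one_parameter_subgroupP[dc' cc'] ->]|].
  rewrite (dyadic_unique hG dc' (dyadic_scale t dc) cc' (curve1_scale t cc)).
  by rewrite mul1r.
move=> /(_ (c (1 * t))) []; exists (fun s => c (s * t)) => //.
by apply/one_parameter_subgroupP; split;
  [exact: dyadic_scale|exact: curve1_scale].
Qed.

Lemma adE xi eta : ad A xi eta = bracket A xi eta.
Proof.
have [c dc cc] := dyadic_exists xi.
rewrite /ad; under eq_fun do rewrite (lie_exp_curve dc cc).
rewrite derive1E; have [_ ->] := is_derive_Ad hG eta cc; by [].
Qed.

(** The minus sign is that of the velocity of c(t)^-1, as [Adstar] at g involves Ad at g^-1. *)
Lemma adstarE xi mu :
  adstar A xi mu = dual_vec (fun eta => - pairing mu (bracket A xi eta)).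
Proof.
have [c dc cc] := dyadic_exists xi.
rewrite /adstar; under eq_fun do rewrite (lie_exp_curve dc cc).
have di i : is_derive (0 : R) 1
    (fun t => pairing mu (Ad A (c t)^-1%g (delta_mx 0 i)))
    (pairing mu (bracket A (- xi) (delta_mx 0 i))).
  have dA := is_derive_Ad hG (delta_mx 0 i) (curve1_inv hG cc).
  rewrite -(ddiff_linear_rV (Ad A (c 0)^-1%g (delta_mx 0 i)) _ (pairing_linear
    mu)).
  apply: (is_derive_comp (f := pairing mu) dA).
  exact/differentiable_linear_rV/pairing_linear.
rewrite derive1E; suff [_ ->] : is_derive (0 : R) 1 (fun t => Adstar A (c t) mu)
    (dual_vec (fun eta => - pairing mu (bracket A xi eta))) by [].
have dd i : differentiable (fun t => Adstar A (c t) mu 0 i) (0 : R) /\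
    ddiff (fun t => Adstar A (c t) mu 0 i) (0 : R) 1 =
    - pairing mu (bracket A xi (delta_mx 0 i)).
  apply/is_derive_diff; rewrite /Adstar; under eq_fun do rewrite mxE.
  by have := di i; rewrite -scaleN1r bracketZl scaleN1r pairingNr.
have d : differentiable (fun t => Adstar A (c t) mu) (0 : R).
  by apply: differentiable_rV => i; have [] := dd i.
apply/is_derive_diff; split=> //; apply/rowP => i; rewrite mxE.
by have [_ <-] := diff_coord i d; have [_ ->] := dd i.
Qed.

End Exponential.

(** * The trivialized symplectic form *)

Section Tangent4.
Variables (R : realType) (n : nat).
Local Notation V4 := 'rV[R]_((n + n) + (n + n)).
Implicit Type z : V4.

Definition proj_g z : 'rV[R]_n := lsubmx (lsubmx z).
Definition proj_xi z : 'rV[R]_n := rsubmx (lsubmx z).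
Definition proj_mu z : 'rV[R]_n := lsubmx (rsubmx z).
Definition proj_nu z : 'rV[R]_n := rsubmx (rsubmx z).

Lemma proj_gE (a b c d : 'rV[R]_n) : proj_g (tangent4 a b c d) = a.
Proof. by rewrite /proj_g /tangent4 !row_mxKl. Qed.
Lemma proj_xiE (a b c d : 'rV[R]_n) : proj_xi (tangent4 a b c d) = b.
Proof. by rewrite /proj_xi /tangent4 row_mxKl row_mxKr. Qed.
Lemma proj_muE (a b c d : 'rV[R]_n) : proj_mu (tangent4 a b c d) = c.
Proof. by rewrite /proj_mu /tangent4 row_mxKr row_mxKl. Qed.
Lemma proj_nuE (a b c d : 'rV[R]_n) : proj_nu (tangent4 a b c d) = d.
Proof. by rewrite /proj_nu /tangent4 !row_mxKr. Qed.
Definition projE := (proj_gE, proj_xiE, proj_muE, proj_nuE).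

Lemma tangent4K z : tangent4 (proj_g z) (proj_xi z) (proj_mu z) (proj_nu z) = z.
Proof. by rewrite /tangent4 !hsubmxK. Qed.

Lemma proj_g_linear : linear proj_g.
Proof. by move=> a u v; rewrite /proj_g !linearP. Qed.
Lemma proj_xi_linear : linear proj_xi.
Proof. by move=> a u v; rewrite /proj_xi !linearP. Qed.
Lemma proj_mu_linear : linear proj_mu.
Proof. by move=> a u v; rewrite /proj_mu !linearP. Qed.
Lemma proj_nu_linear : linear proj_nu.
Proof. by move=> a u v; rewrite /proj_nu !linearP. Qed.

Lemma tangent4D (a b c d a' b' c' d' : 'rV[R]_n) :
  tangent4 a b c d + tangent4 a' b' c' d' =
  tangent4 (a + a') (b + b') (c + c') (d + d').
Proof. by rewrite /tangent4 !add_row_mx. Qed.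

Lemma ddiff_affine (f : V4 -> R) (k : V4) (L : 'rV[R]_n -> V4) x v :
  linear L -> smooth_at f (k + L x) ->
  ddiff (fun y => f (k + L y)) x v = ddiff f (k + L x) (L v).
Proof.
move=> lL /smooth_at_diff df.
have dk : differentiable (fun=> k) x by exact: differentiable_cst.
have dL := differentiable_linear_rV x lL.
have ds : differentiable (fun y => k + L y) x := differentiableD dk dL.
have dsE : ddiff (fun y => k + L y) x v = L v.
  by rewrite (ddiffD v dk dL) ddiff_cst add0r; exact: ddiff_linear_rV.
by rewrite (ddiff_comp v ds df) dsE.
Qed.

Lemma ddiff_tangent4 (f : V4 -> R) (a b c d va vb vc vd : 'rV[R]_n) :
  smooth_at f (tangent4 a b c d) ->
  ddiff f (tangent4 a b c d) (tangent4 va vb vc vd) =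
  ddiff (fun y => f (tangent4 y b c d)) a va +
  ddiff (fun y => f (tangent4 a y c d)) b vb +
  ddiff (fun y => f (tangent4 a b y d)) c vc +
  ddiff (fun y => f (tangent4 a b c y)) d vd.
Proof.
move=> sf.
have E1 : (fun y => f (tangent4 y b c d)) =
    (fun y => f (tangent4 0 b c d + tangent4 y 0 0 0)).
  by apply/funext => y; rewrite tangent4D !addr0 add0r.
have E2 : (fun y => f (tangent4 a y c d)) =
    (fun y => f (tangent4 a 0 c d + tangent4 0 y 0 0)).
  by apply/funext => y; rewrite tangent4D !addr0 add0r.
have E3 : (fun y => f (tangent4 a b y d)) =
    (fun y => f (tangent4 a b 0 d + tangent4 0 0 y 0)).
  by apply/funext => y; rewrite tangent4D !addr0 add0r.
have E4 : (fun y => f (tangent4 a b c y)) =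
    (fun y => f (tangent4 a b c 0 + tangent4 0 0 0 y)).
  by apply/funext => y; rewrite tangent4D !addr0 add0r.
have s4 (t : R) (u1 u2 u3 u4 : 'rV[R]_n) : t *: tangent4 u1 u2 u3 u4 =
    tangent4 (t *: u1) (t *: u2) (t *: u3) (t *: u4).
  by rewrite /tangent4 !scale_row_mx.
rewrite E1 E2 E3 E4 !ddiff_affine; first last.
all: try by [move=> t u v; rewrite s4 tangent4D !scaler0 !addr0
  | rewrite tangent4D !addr0 add0r].
by rewrite !tangent4D !addr0 !add0r -!ddiffvD !tangent4D !addr0 !add0r.
Qed.
End Tangent4.

Section Trivialization.
Variables (R : realType) (n : nat) (G : groupType) (A : atlas R G n).
Hypothesis hG : is_lie_group A.
Let hA := lie_manifold hG.

Local Notation cinv := (chart_inv A).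
Local Notation br := (bracket A).

Lemma TR_linear g : linear (TR A g).
Proof. by move=> a u v; rewrite !(TRE hG) ddiffvD ddiffvZ. Qed.

Lemma bracket_linear xi : linear (br xi).
Proof. by move=> a u v; rewrite bracketDr // bracketZr. Qed.

Lemma pairing_adstar xi mu eta :
  pairing (adstar A xi mu) eta = - pairing mu (br xi eta).
Proof.
rewrite (adstarE hG) pairing_dual_vec // => a u v.
by rewrite bracket_linear pairing_linear [in LHS]opprD -scalerN.
Qed.

Lemma pairing_TRstar g a eta : pairing (TRstar A g a) eta =
  pairing a (TR A g eta).
Proof.
by rewrite pairing_dual_vec // => c u v; rewrite TR_linear pairing_linear.
Qed.

Lemma rfield_inv_TR g eta : rfield_inv A g (TR A g eta) (chart A g g) = eta.
Proof.
by rewrite -(rfield_self hG) (rfield_invK hG) //; exact: chart_im_self.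
Qed.

Lemma TR_rfield_inv g v : TR A g (rfield_inv A g v (chart A g g)) = v.
Proof.
by rewrite -(rfield_self hG) (rfieldK hG) //; exact: chart_im_self.
Qed.

Lemma rfield_inv_linear p y : linear (rfield_inv A p ^~ y).
Proof. by move=> a u v; rewrite /rfield_inv ddiffvD ddiffvZ. Qed.

(** [rfield_inv] represents the inverse tangent map of a right translation, with values in g, so it
    is independent of the chart once the vector is transported. *)
Lemma rfield_inv_transition p q v y : chart_im A p y -> dom A q (cinv p y) ->
  rfield_inv A q (ddiff (fun x => chart A q (cinv p x)) y v) (chart A q (cinv p y))
    =
  rfield_inv A p v y.
Proof.
move=> py qy; set eta := rfield_inv A p v y.
have qi : chart_im A q (chart A q (cinv p y)) by exact: chart_im_chart.
rewrite -[v in LHS](rfieldK hG v py) -/eta -[RHS](rfield_invK hG eta qi).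
have tr w := @ddiff_transition _ _ _ _ hA (cinv p y) p q
  (chart A (cinv p y) (cinv p y)) w (chart_im_self hA _).
rewrite cinv_self // chart_invK // in tr.
congr (rfield_inv A q _ _); rewrite !(rfieldE hG) // (chartK hA qy).
by rewrite -tr //; exact: dom_chart_inv.
Qed.

(* The alpha_g of the inverse trivialization, read in the chart at p, at the
   point of coordinates y. *)
Definition covector p y (xi mu nu : 'rV[R]_n) : 'rV[R]_n :=
  dual_vec (fun v => pairing mu (rfield_inv A p v y) +
    pairing nu (br xi (rfield_inv A p v y))).

Lemma pairing_covector p y xi mu nu v :
  pairing (covector p y xi mu nu) v =
  pairing mu (rfield_inv A p v y) + pairing nu (br xi (rfield_inv A p v y)).
Proof.
rewrite pairing_dual_vec // => a u w; rewrite rfield_inv_linear bracket_linear.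
by rewrite !pairing_linear [in RHS]scalerDr addrACA.
Qed.

Definition triv_inv (p : trivT R n G) : (G * 'rV[R]_n) * 'rV[R]_(n + n) :=
  let g := p.1.1 in
  (p.1, row_mx (covector g (chart A g g) p.1.2 p.2.1 p.2.2) p.2.2).

Lemma triv_invK : cancel triv_inv (trivialization A).
Proof.
move=> [[g xi] [mu nu]]; rewrite /trivialization /triv_inv /=.
rewrite row_mxKl row_mxKr; congr (_, (_, _)); apply: pairing_inj => eta.
rewrite pairingDl pairing_TRstar pairing_covector rfield_inv_TR pairing_adstar.
by rewrite addrK.
Qed.

Lemma trivializationK : cancel (trivialization A) triv_inv.
Proof.
move=> [[g xi] a]; rewrite /trivialization /triv_inv /=; congr (_, _).
rewrite -[in RHS](hsubmxK a); congr row_mx; apply: pairing_inj => v.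
rewrite pairing_covector pairingDl pairing_TRstar pairing_adstar TR_rfield_inv.
by rewrite addrNK.
Qed.

(** The explicit two-sided inverse replaces the chosen one: [pinvK] applies because every point is
    in the image, and injectivity does the rest. *)
Lemma trivialization_invE : trivialization_inv A = triv_inv.
Proof.
apply/funext => p; rewrite /trivialization_inv.
apply: (can_inj trivializationK); rewrite triv_invK.
by apply: pinvK; rewrite inE; exists (triv_inv p) => //; exact: triv_invK.
Qed.

(** At the moving point the covector is expressed in that point's own chart; carried back to the
    chart at [g] it keeps the formula [covector], by [rfield_inv_transition]. *)
Lemma chart_triv_inv g xi mu nu z : let p := ((g, xi), (mu, nu)) in
  chart_im A g (proj_g z) ->
  chart (cotangent_atlas (TG_atlas A)) (triv_inv p)
    (triv_inv (chart_inv (triv_atlas A) p z)) =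
  tangent4 (proj_g z) (proj_xi z)
    (covector g (proj_g z) (proj_xi z) (proj_mu z) (proj_nu z)) (proj_nu z).
Proof.
move=> p gz; rewrite chart_cotangentE /= -/(proj_g z) -/(proj_xi z)
  -/(proj_mu z) -/(proj_nu z) chart_invK //.
set g' := cinv g (proj_g z).
congr row_mx; apply: pairing_inj => w.
rewrite -(hsubmxK w); move: (lsubmx w) (rsubmx w) => w1 w2 {w}.
rewrite pairing_dual_vec; last first.
  by move=> a u v; rewrite ddiffvD ddiffvZ pairing_linear.
have gg' : dom A g' (cinv g (proj_g z)) by exact: dom_self.
rewrite (@ddiff_row_mx _ _ _ _
  (fun y => chart A g' (cinv g (@lsubmx R 1 n n y))) rsubmx); last 2 first.
- apply: smooth_at_diff; apply: (@smooth_at_comp _ _ _ _ (@lsubmx R 1 n n)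
    (fun y => chart A g' (cinv g y))).
    exact/smooth_at_linear/lsubmx_is_linear.
  by rewrite row_mxKl; exact: transition_smooth.
- exact/differentiable_linear_rV/rsubmx_is_linear.
rewrite (@ddiff_comp _ _ _ _ (@lsubmx R 1 n n)
  (fun y => chart A g' (cinv g y))); last 2 first.
- exact/differentiable_linear_rV/lsubmx_is_linear.
- by rewrite row_mxKl; apply: smooth_at_diff; exact: transition_smooth.
rewrite (ddiff_linear_rV _ _ (@lsubmx_is_linear R n n)).
rewrite (ddiff_linear_rV _ _ (@rsubmx_is_linear R n n)) !row_mxKl !row_mxKr.
rewrite !pairing_row_mx; congr (_ + _).
by rewrite !pairing_covector rfield_inv_transition.
Qed.

(** Both arguments of the bracket move; expanding the second in the standard basis leaves brackets
    that are linear in z. *)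
Lemma smooth_at_covector p (a b c d : 'rV[R]_n) : chart_im A p a ->
  smooth_at (fun z => covector p (proj_g z) (proj_xi z) (proj_mu z) (proj_nu z))
    (tangent4 a b c d).
Proof.
move=> pa; apply: smooth_at_dual_vec => v.
have sl : smooth_at (fun z => rfield_inv A p v (proj_g z)) (tangent4 a b c d).
  apply: (@smooth_at_comp _ _ _ _ (@proj_g R n) (rfield_inv A p v)).
    exact/smooth_at_linear/proj_g_linear.
  by rewrite proj_gE; exact: smooth_at_rfield_inv.
apply: smooth_atD; apply: smooth_at_pairing => //.
- exact/smooth_at_linear/proj_mu_linear.
- exact/smooth_at_linear/proj_nu_linear.
have -> : (fun z => br (proj_xi z) (rfield_inv A p v (proj_g z))) = (fun z =>
    \sum_(j < n) rfield_inv A p v (proj_g z) 0 j *: br (proj_xi z) (delta_mx 0 j)).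
  apply/funext => z; rewrite [in LHS](row_sum_delta (rfield_inv A p v (proj_g z))).
  pose lM := GRing.isLinear.Build _ _ _ _ _ (bracket_linear (proj_xi z)).
  pose lL : {linear 'rV[R]_n -> 'rV[R]_n} := HB.pack (br (proj_xi z)) lM.
  rewrite -[LHS]/(lL _) linear_sum; apply: eq_bigr => j _; exact: linearZ.
apply: smooth_at_rV => i.
have -> : (fun z => (\sum_(j < n) rfield_inv A p v (proj_g z) 0 j *:
    br (proj_xi z) (delta_mx 0 j)) 0 i) = (fun z =>
    \sum_(j < n) rfield_inv A p v (proj_g z) 0 j * br (proj_xi z) (delta_mx 0 j) 0
      i).
  by apply/funext => z; rewrite summxE; apply: eq_bigr => j _; rewrite mxE.
apply: (@smooth_at_sum _ _ _ _ (fun j z =>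
  rfield_inv A p v (proj_g z) 0 j * br (proj_xi z) (delta_mx 0 j) 0 i)) => j.
apply: smooth_atM; apply: smooth_at_coord => //.
apply: smooth_at_linear => t u w.
by rewrite proj_xi_linear bracketDl // bracketZl.
Qed.

End Trivialization.

(** * The symplectic form and dH in the right-invariant frame *)

Section OmegaFormula.
Variables (R : realType) (n : nat) (G : groupType) (A : atlas R G n).
Hypothesis hG : is_lie_group A.
Let hA := lie_manifold hG.

Local Notation cinv := (chart_inv A).
Local Notation br := (bracket A).

Section Point.
Variables (g : G) (xi mu nu : 'rV[R]_n).
Let p : trivT R n G := ((g, xi), (mu, nu)).
Let y0 := chart A g g.
Let z0 := tangent4 y0 xi mu nu.
Let alpha z := covector A g (proj_g z) (proj_xi z) (proj_mu z) (proj_nu z).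

Let sg : differentiable (@proj_g R n) z0.
Proof. exact/differentiable_linear_rV/proj_g_linear. Qed.

Let near_z0 : \forall z \near z0, chart_im A g (proj_g z).
Proof.
apply: (differentiable_near (P := chart_im A g) sg).
by rewrite proj_gE; apply: chart_im_near => //; exact: chart_im_self.
Qed.

Let sa : smooth_at alpha z0.
Proof. by apply: (smooth_at_covector hG); exact: chart_im_self. Qed.

Lemma tangent_triv_inv V :
  tangent_map (triv_atlas A) (cotangent_atlas (TG_atlas A))
    (trivialization_inv A) p V =
  tangent4 (proj_g V) (proj_xi V) (ddiff alpha z0 V) (proj_nu V).
Proof.
rewrite /tangent_map ddiffE (trivialization_invE hG).
pose F z := tangent4 (proj_g z) (proj_xi z) (alpha z) (proj_nu z).
have dxi : differentiable (@proj_xi R n) z0.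
  exact/differentiable_linear_rV/proj_xi_linear.
have dnu : differentiable (@proj_nu R n) z0.
  exact/differentiable_linear_rV/proj_nu_linear.
have da := smooth_at_diff sa.
have d1 := differentiable_row_mx sg dxi;
  have d2 := differentiable_row_mx da dnu.
have -> : ddiff (local_rep (triv_atlas A) (cotangent_atlas (TG_atlas A))
    (triv_inv A) p) (chart (triv_atlas A) p p) V = ddiff F z0 V.
  apply: ddiff_near; last exact: (differentiable_row_mx d1 d2).
  by apply: filterS near_z0 => z gz; rewrite /local_rep /comp chart_triv_inv.
rewrite /F /tangent4 (ddiff_row_mx V d1 d2) (ddiff_row_mx V sg dxi).
rewrite (ddiff_row_mx V da dnu) (ddiff_linear_rV _ _ (@proj_g_linear R n)).
by rewrite (ddiff_linear_rV _ _ (@proj_xi_linear R n))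
  (ddiff_linear_rV _ _ (@proj_nu_linear R n)).
Qed.

(** Paired with the frame, the covector equals an expression free of g, so the displacement of g
    contributes only the derivative of the frame, the last term. *)
Lemma ddiff_covector (V : 'rV[R]_((n + n) + (n + n))) eta :
  pairing (ddiff alpha z0 V) (TR A g eta) =
  pairing (proj_mu V) eta + pairing (proj_nu V) (br xi eta) +
  pairing nu (br (proj_xi V) eta) -
  pairing (alpha z0) (ddiff (rfield A g eta) y0 (proj_g V)).
Proof.
pose h z := pairing (proj_mu z) eta + pairing (proj_nu z) (br (proj_xi z) eta).
have da := smooth_at_diff sa.
have gim := chart_im_self hA g.
have dr : differentiable (rfield A g eta) (proj_g z0).
  by rewrite proj_gE; apply/smooth_at_diff/smooth_at_rfield.
have hE : {near z0, (fun z => pairing (alpha z) (rfield A g eta (proj_g z))) =1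
  h}.
  apply: filterS near_z0 => z gz.
  by rewrite /alpha pairing_covector // rfield_invK.
have lbr : linear (fun z : 'rV[R]_((n + n) + (n + n)) => br (proj_xi z) eta).
  by move=> t u w; rewrite proj_xi_linear bracketDl // bracketZl.
have dmu := differentiable_linear_rV z0 (@proj_mu_linear R n).
have dnu := differentiable_linear_rV z0 (@proj_nu_linear R n).
have dbr := differentiable_linear_rV z0 lbr.
have dc : differentiable (fun=> eta) z0 by exact: differentiable_cst.
have dgr : differentiable (fun z => rfield A g eta (proj_g z)) z0.
  exact: differentiable_comp sg dr.
have smu : smooth_at (@proj_mu R n) z0 by exact/smooth_at_linear/proj_mu_linear.
have snu : smooth_at (@proj_nu R n) z0 by exact/smooth_at_linear/proj_nu_linear.
have sbr := smooth_at_linear z0 lbr.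
have := ddiff_near V hE (smooth_at_diff (smooth_at_pairing sa _)).
have sgr : smooth_at (fun z => rfield A g eta (proj_g z)) z0.
  apply: (@smooth_at_comp _ _ _ _ (@proj_g R n) (rfield A g eta)).
    exact/smooth_at_linear/proj_g_linear.
  by rewrite proj_gE; exact: smooth_at_rfield.
move=> /(_ sgr).
rewrite (ddiff_pairing V da dgr) (ddiff_comp V sg dr).
rewrite (ddiff_linear_rV _ _ (@proj_g_linear R n)) [proj_g z0]proj_gE.
rewrite /y0 rfield_self // -/y0.
rewrite /h ddiffD; last 2 first.
- exact: (smooth_at_diff (smooth_at_pairing smu (smooth_at_cst eta z0))).
- exact: (smooth_at_diff (smooth_at_pairing snu sbr)).
rewrite (ddiff_pairing V dmu dc) (ddiff_pairing V dnu dbr) ddiff_cst pairing0r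
  addr0.
rewrite (ddiff_linear_rV _ _ (@proj_mu_linear R n)).
rewrite (ddiff_linear_rV _ _ (@proj_nu_linear R n)) (ddiff_linear_rV _ _ lbr).
rewrite [proj_nu z0]proj_nuE [proj_xi z0]proj_xiE => E.
by rewrite -(addrA (pairing (proj_mu V) eta)) E addrK.
Qed.

Lemma pairing_alpha eta :
  pairing (alpha z0) (TR A g eta) = pairing mu eta + pairing nu (br xi eta).
Proof. by rewrite /alpha pairing_covector // /z0 !projE /y0 rfield_inv_TR. Qed.

Lemma OmegaE a vxi vmu vnu b wxi wmu wnu :
  Omega A p (tangent4 (TR A g a) vxi vmu vnu) (tangent4 (TR A g b) wxi wmu wnu)
    =
  pairing vmu b + pairing vnu (br xi b) + pairing nu (br vxi b)
  - (pairing wmu a + pairing wnu (br xi a) + pairing nu (br wxi a))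
  + pairing mu (br a b) + pairing nu (br xi (br a b))
  + pairing vnu wxi - pairing wnu vxi.
Proof.
rewrite /Omega /pullback2 canonical_formE; last first.
  exact: prod_atlas_manifold hA (@vector_atlas_manifold R n).
rewrite !tangent_triv_inv !projE /tangent4 !row_mxKl !row_mxKr !pairing_row_mx.
rewrite -!/(tangent4 _ _ _ _) !ddiff_covector !projE.
(* The two remaining derivatives of the frame differ by T R_g [a, b], whose pairing with the
   covector gives the terms in [a, b]. *)
have := congr1 (pairing (alpha z0)) (rfield_structure hG g a b).
rewrite pairingDr pairing_alpha -/y0.
move: (pairing (alpha z0) _) (pairing (alpha z0) _) => X Y XY.
by rewrite XY; ring.
Qed.
End Point.

Lemma pairing_dual_diff (f : 'rV[R]_n -> R) x v :
  pairing (dual_vec ('d f x)) v = ddiff f x v.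
Proof.
have lf : linear ('d f x) by move=> t u w; rewrite linearP.
by rewrite (pairing_dual_vec v lf) ddiffE.
Qed.

Section Partials.
Variables (H : trivT R n G -> R) (p : trivT R n G) (v : 'rV[R]_n).

Lemma pairing_dH_g : pairing (dH_g A H p) v =
  ddiff (fun y => H ((cinv p.1.1 y, p.1.2), (p.2.1, p.2.2)))
    (chart A p.1.1 p.1.1) v.
Proof. by rewrite -pairing_dual_diff. Qed.

Lemma pairing_dH_xi : pairing (dH_xi H p) v =
  ddiff (fun y => H ((p.1.1, y), (p.2.1, p.2.2))) p.1.2 v.
Proof. by rewrite -pairing_dual_diff. Qed.

Lemma pairing_dH_mu : pairing (dH_mu H p) v =
  ddiff (fun y => H ((p.1.1, p.1.2), (y, p.2.2))) p.2.1 v.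
Proof. by rewrite -pairing_dual_diff. Qed.

Lemma pairing_dH_nu : pairing (dH_nu H p) v =
  ddiff (fun y => H ((p.1.1, p.1.2), (p.2.1, y))) p.2.2 v.
Proof. by rewrite -pairing_dual_diff. Qed.
End Partials.

Lemma differentialE (H : trivT R n G -> R) (hH : smooth_fun (triv_atlas A) H) p
    vg vxi vmu vnu :
  differential (triv_atlas A) H p (tangent4 vg vxi vmu vnu) =
  pairing (dH_g A H p) vg + pairing (dH_xi H p) vxi +
  pairing (dH_mu H p) vmu + pairing (dH_nu H p) vnu.
Proof.
move: p => [[g xi] [mu nu]]; set p := ((g, xi), (mu, nu)).
rewrite /differential ddiffE; set h := H \o _.
have hT : is_manifold (triv_atlas A).
  by do 2 ?apply: prod_atlas_manifold => //; exact: vector_atlas_manifold.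
have sh : smooth_at h (tangent4 (chart A g g) xi mu nu).
  refine (@smooth_on_at R _ _ (chart_im (triv_atlas A) p) h _
    (@chart_im_open _ _ _ _ hT p) (hH p) _).
  exact: (chart_im_self hT p).
rewrite -[chart _ p p]/(tangent4 (chart A g g) xi mu nu) ddiff_tangent4 //.
have hE y a b c : h (tangent4 y a b c) = H ((cinv g y, a), (b, c)).
  by rewrite /h /= /tangent4 !(row_mxKl, row_mxKr).
have c1 := cinv_self hG g.
have Eg : (fun y => h (tangent4 y xi mu nu)) =
    fun y => H ((cinv g y, xi), (mu, nu)).
  by apply/funext => y; rewrite hE.
have Exi : (fun y => h (tangent4 (chart A g g) y mu nu)) =
    fun y => H ((g, y), (mu, nu)).
  by apply/funext => y; rewrite hE c1.
have Emu : (fun y => h (tangent4 (chart A g g) xi y nu)) =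
    fun y => H ((g, xi), (y, nu)).
  by apply/funext => y; rewrite hE c1.
have Enu : (fun y => h (tangent4 (chart A g g) xi mu y)) =
    fun y => H ((g, xi), (mu, y)).
  by apply/funext => y; rewrite hE c1.
congr (_ + _ + _ + _).
- apply: etrans (esym (pairing_dH_g H p vg)).
  exact: (congr1 (fun f => ddiff f (chart A g g) vg) Eg).
- apply: etrans (esym (pairing_dH_xi H p vxi)).
  exact: (congr1 (fun f => ddiff f xi vxi) Exi).
- apply: etrans (esym (pairing_dH_mu H p vmu)).
  exact: (congr1 (fun f => ddiff f mu vmu) Emu).
- apply: etrans (esym (pairing_dH_nu H p vnu)).
  exact: (congr1 (fun f => ddiff f nu vnu) Enu).
Qed.
End OmegaFormula.

(** * Solving Omega(X, W) = - dH(W) for X *)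

Section HamiltonEquations.
Variables (R : realType) (n : nat) (G : groupType) (A : atlas R G n).
Hypothesis hG : is_lie_group A.

Local Notation br := (bracket A).

Lemma bracket0r xi : br xi 0 = 0.
Proof. by have := bracketZr hG xi 0 0; rewrite !scale0r. Qed.

Lemma bracket0l xi : br 0 xi = 0.
Proof. exact: ddiffv0. Qed.

Lemma bracketBl xi eta zeta : br (xi - eta) zeta = br xi zeta - br eta zeta.
Proof. by rewrite bracketDl // -[- eta]scaleN1r bracketZl // scaleN1r. Qed.

Lemma TR0 g : TR A g 0 = 0.
Proof.
by rewrite (TRE hG) ddiffv0.
Qed.

Section Point.
Variables (g : G) (xi mu nu hg hxi hmu hnu : 'rV[R]_n).
Let p : trivT R n G := ((g, xi), (mu, nu)).
Let fxi := hnu - ad A xi hmu.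
Let fnu := - hxi + adstar A hmu nu.
Let fmu := - TRstar A g hg - adstar A xi hxi + adstar A hmu mu + adstar A hnu
  nu.

(** By the Jacobi identity the double brackets hidden in [fxi] and [fnu] cancel the last term, so
    that of all [nu] terms only - <nu, [hnu, b]> is left. *)
Lemma pairing_fmu b : pairing fmu b = - pairing hg (TR A g b) -
  pairing fnu (br xi b) - pairing nu (br fxi b) - pairing mu (br hmu b) -
  pairing nu (br xi (br hmu b)).
Proof.
have pT := pairing_TRstar hG g hg b.
have p1 := pairing_adstar hG xi hxi b; have p2 := pairing_adstar hG hmu mu b.
have p3 := pairing_adstar hG hnu nu b.
have p4 := pairing_adstar hG hmu nu (br xi b).
have jac := congr1 (pairing nu) (bracket_jacobi hG xi hmu b).
have bB := congr1 (pairing nu) (bracketBl hnu (br xi hmu) b).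
rewrite /fmu /fnu /fxi (adE hG).
move: (TRstar A g hg) (adstar A xi hxi) (adstar A hmu mu) (adstar A hnu nu)
  (adstar A hmu nu) pT p1 p2 p3 p4 => t1 t2 t3 t4 t5 pT p1 p2 p3 p4.
rewrite bB jac !(pairingDl, pairingBl, pairingNl, pairingDr,
  pairingNr) pT p1 p2 p3 p4.
by ring.
Qed.

(** Linear algebra at one point: the covectors are arbitrary here and become the partial derivatives
    of H through [differentialE]. *)
Lemma hamilton_equations V :
  (forall vg vxi vmu vnu, Omega A p V (tangent4 vg vxi vmu vnu) =
    - (pairing hg vg + pairing hxi vxi + pairing hmu vmu + pairing hnu vnu)) <->
  V = tangent4 (TR A g hmu) fxi fmu fnu.
Proof.
rewrite -(tangent4K V); set a := rfield_inv A g (proj_g V) (chart A g g).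
rewrite -(TR_rfield_inv hG g (proj_g V)) -/a.
move: (proj_xi V) (proj_mu V) (proj_nu V) a => vxi vmu vnu a {V}.
have fa eta : pairing fnu eta = - pairing hxi eta - pairing nu (br hmu eta).
  by rewrite pairingDl pairingNl pairing_adstar.
split=> [E|-> vg wxi wmu wnu].
- have E' b wxi wmu wnu := etrans (esym (OmegaE hG g xi mu nu a vxi vmu vnu b
  wxi wmu wnu))
    (E (TR A g b) wxi wmu wnu).
  (* One slot is tested at a time, and the order matters: a = hmu enters the equations for [vxi] and
     [vnu], and all three enter the one for [vmu]. *)
  have aE : a = hmu.
    apply: pairing_inj => w; have := E' 0 0 w 0.
    rewrite !(TR0, bracket0r, bracket0l, pairing0r, pairing0l).
    by rewrite !(add0r, addr0, sub0r, subr0) (pairingC w) => /oppr_inj.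
  have xiE : vxi = fxi.
    apply: pairing_inj => w; have := E' 0 0 0 w.
    rewrite !(TR0, bracket0r, bracket0l, pairing0r, pairing0l).
    rewrite !(add0r, addr0, sub0r, subr0) !(pairingC w) aE /fxi adE //.
    by rewrite pairingBl -opprD => /oppr_inj <-; rewrite addrC addKr.
  have nuE : vnu = fnu.
    apply: pairing_inj => w; have := E' 0 w 0 0.
    rewrite !(TR0, bracket0r, bracket0l, pairing0r, pairing0l).
    rewrite !(add0r, addr0, sub0r, subr0) fa aE (bracketC hG w) pairingNr => H.
    by lra.
  rewrite xiE nuE aE in E' *; congr tangent4; apply: pairing_inj => b.
  rewrite pairing_fmu; have := E' b 0 0 0.
  by rewrite !(pairing0r, pairing0l, bracket0l) => H; lra.
rewrite -(TR_rfield_inv hG g vg) OmegaE //; move: (rfield_inv A g vg _) => b.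
have fxiE : pairing wnu fxi = pairing hnu wnu - pairing wnu (br xi hmu).
  by rewrite /fxi adE // pairingBr (pairingC wnu).
have fnuE := fa wxi; have fmuE := pairing_fmu b.
have brE := congr1 (pairing nu) (bracketC hG wxi hmu); rewrite pairingNr in brE.
have wmuE := pairingC wmu hmu.
move: fmu fnu fxi fmuE fnuE fxiE {fa} => f1 f2 f3 -> -> ->.
by rewrite brE wmuE; ring.
Qed.
End Point.
End HamiltonEquations.

Theorem proposition4p1 (R : realType) (n : nat) (G : groupType)
    (A : atlas R G n) (hG : is_lie_group A)
    (H : trivT R n G -> R) (hH : smooth_fun (triv_atlas A) H) :
  (* the Hamiltonian vector field: existence, uniqueness and components *)
  (forall X : trivT R n G -> 'rV[R]_((n + n) + (n + n)),
     is_hamiltonian_field A H X <->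
     forall (g : G) (xi mu nu : 'rV[R]_n),
       let p := ((g, xi), (mu, nu)) in
       X p = tangent4
         (TR A g (dH_mu H p))
         (dH_nu H p - ad A xi (dH_mu H p))
         (- TRstar A g (dH_g A H p) - adstar A xi (dH_xi H p)
          + adstar A (dH_mu H p) mu + adstar A (dH_nu H p) nu)
         (- dH_xi H p + adstar A (dH_mu H p) nu)) /\
  (* Hamilton's equations, i.e. the equations of the integral curves *)
  (forall X : trivT R n G -> 'rV[R]_((n + n) + (n + n)),
     is_hamiltonian_field A H X ->
     forall (g : R -> G) (xi mu nu : R -> 'rV[R]_n) (t : R),
       let c := fun s : R => ((g s, xi s), (mu s, nu s)) in
       let p := c t in
       has_velocity (triv_atlas A) c t (X p) <->
       [/\ has_velocity A g t (TR A (g t) (dH_mu H p)),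
           is_derive t 1 xi (dH_nu H p - ad A (xi t) (dH_mu H p)),
           is_derive t 1 mu
             (- TRstar A (g t) (dH_g A H p) - adstar A (xi t) (dH_xi H p)
              + adstar A (dH_mu H p) (mu t) + adstar A (dH_nu H p) (nu t)) &
           is_derive t 1 nu
             (- dH_xi H p + adstar A (dH_mu H p) (nu t))]).
Proof.
have field X : is_hamiltonian_field A H X <->
    forall (g : G) (xi mu nu : 'rV[R]_n),
       let p := ((g, xi), (mu, nu)) in
       X p = tangent4
         (TR A g (dH_mu H p))
         (dH_nu H p - ad A xi (dH_mu H p))
         (- TRstar A g (dH_g A H p) - adstar A xi (dH_xi H p)
          + adstar A (dH_mu H p) mu + adstar A (dH_nu H p) nu)
         (- dH_xi H p + adstar A (dH_mu H p) nu).
  split=> [hX g xi mu nu p|hX [[g xi] [mu nu]] V].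
    apply/(hamilton_equations hG g xi mu nu) => vg vxi vmu vnu.
    by rewrite -differentialE //; exact: hX.
  rewrite -(tangent4K V) differentialE //.
  by move: (proj_g V) (proj_xi V) (proj_mu V) (proj_nu V);
    apply/(hamilton_equations hG g xi mu nu); exact: hX.
split=> // X /field hX g xi mu nu t c p; rewrite /p /c hX /has_velocity.
split=> [[nc dc]|[[ng dg] dxi dmu dnu]].
  (* In the product chart the curve is a row of four blocks, so its velocity splits; the vector
     factors impose no domain condition. *)
  have [/is_derive_row_mx[dg dxi] /is_derive_row_mx[dmu dnu]] :=
    (is_derive_row_mx _ _ _ _ _).1 dc.
  split; [split; last exact: dg|exact: dxi|exact: dmu|exact: dnu].
  by apply: filterS nc => s [[]].
split; first by apply: filterS ng => s gs; split; split.
have dgxi := (is_derive_row_mx _ _ _ _ _).2 (conj dg dxi).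
have dmunu := (is_derive_row_mx _ _ _ _ _).2 (conj dmu dnu).
exact: (is_derive_row_mx _ _ _ _ _).2 (conj dgxi dmunu).
Qed.
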